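(* Let $H$ be a quasi-Hopf algebra and $A$ an algebra in the Yetter-Drinfeld category ${}_H^H\mathcal{YD}$. Let $j:H\to A\# H$, $j(h)=1_A\# h$. Then the map $$\Pi: A\,\underline{\otimes}\,H_0\to (A\# H)^j,\qquad \Pi(a\otimes h)=x^1\cdot a\,\#\,x^2hS(x^3),$$ is an isomorphism of algebras in ${}_H^H\mathcal{YD}$.
   Context: Throughout, $k$ is a field, all algebras and linear spaces are over $k$, $\otimes=\otimes_k$. A quasi-bialgebra $(H,\Delta,\varepsilon,\Phi)$ is a unital associative algebra $H$ with algebra maps $\Delta:H\to H\otimes H$, $\varepsilon:H\to k$ and an invertible $\Phi\in H^{\otimes 3}$ such that for all $h\in H$: $(id\otimes\Delta)(\Delta(h))=\Phi(\Delta\otimes id)(\Delta(h))\Phi^{-1}$; $(id\otimes\varepsilon)(\Delta(h))=h=(\varepsilon\otimes id)(\Delta(h))$; $(1\otimes\Phi)(id\otimes\Delta\otimes id)(\Phi)(\Phi\otimes 1)=(id\otimes id\otimes\Delta)(\Phi)(\Delta\otimes id\otimes id)(\Phi)$; $(\varepsilon\otimes id\otimes id)(\Phi)=(id\otimes\varepsilon\otimes id)(\Phi)=(id\otimes id\otimes\varepsilon)(\Phi)=1\otimes 1$. Notation (summation understood): $\Delta(h)=h_1\otimes h_2$, $(\Delta\otimes id)\Delta(h)=h_{(1,1)}\otimes h_{(1,2)}\otimes h_2$, $(id\otimes\Delta)\Delta(h)=h_1\otimes h_{(2,1)}\otimes h_{(2,2)}$; $\Phi=X^1\otimes X^2\otimes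 X^3=Y^1\otimes Y^2\otimes Y^3=T^1\otimes T^2\otimes T^3=\cdots$ and $\Phi^{-1}=x^1\otimes x^2\otimes x^3=y^1\otimes y^2\otimes y^3=t^1\otimes t^2\otimes t^3=\cdots$ (different letters denote independent copies); lower indices denote components of $\Delta$, e.g. $\Delta(X^3)=X^3_1\otimes X^3_2$. A quasi-Hopf algebra is a quasi-bialgebra $H$ with an algebra anti-automorphism $S$ and $\alpha,\beta\in H$ such that $S(h_1)\alpha h_2=\varepsilon(h)\alpha$, $h_1\beta S(h_2)=\varepsilon(h)\beta$ for all $h$, $X^1\beta S(X^2)\alpha X^3=1$, $S(x^1)\alpha x^2\beta S(x^3)=1$; normalised (as one may) so that $\varepsilon(\alpha)=\varepsilon(\beta)=1$ and $\varepsilon\circ S=\varepsilon$. Drinfeld twist: let $A^1\otimes A^2\otimes A^3\otimes A^4=(\Phi\otimes 1)(\Delta\otimes id\otimes id)(\Phi^{-1})$, $B^1\otimes B^2\otimes B^3\otimes B^4=(\Delta\otimes id\otimes id)(\Phi)(\Phi^{-1}\otimes 1)$, $\gamma=S(A^2)\alpha A^3\otimes S(A^1)\alpha A^4$, $\delta=B^1\beta S(B^4)\otimes B^2\beta S(B^3)$, $\Delta^{cop}(h)=h_2\otimes h_1$. Then $f=f^1\otimes f^2=(S\otimes S)(\Delta^{cop}(x^1))\,\gamma\,\Delta(x^2\beta S(x^3))$ is invertible with inverse $f^{-1}=g^1\otimes g^2=\Delta(S(x^1)\alpha x^2)\,\delta\,(S\otimes S)(\Delta^{cop}(x^3))$.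 Also $q_R=q^1\otimes q^2=X^1\otimes S^{-1}(\alpha X^3)X^2$. A left $H$-module algebra is a left $H$-module $A$ with a multiplication and (usual) unit $1_A$ such that $(aa')a''=(X^1\cdot a)[(X^2\cdot a')(X^3\cdot a'')]$, $h\cdot(aa')=(h_1\cdot a)(h_2\cdot a')$, $h\cdot 1_A=\varepsilon(h)1_A$. The smash product $A\# H$ is $A\otimes H$ with the associative multiplication $(a\# h)(a'\# h')=(x^1\cdot a)(x^2h_1\cdot a')\# x^3h_2h'$ and unit $1_A\# 1$. A left Yetter-Drinfeld module over $H$ is a left $H$-module $M$ with a linear map $\lambda_M:M\to H\otimes M$, $\lambda_M(m)=m_{(-1)}\otimes m_{(0)}$, such that $X^1m_{(-1)}\otimes(X^2\cdot m_{(0)})_{(-1)}X^3\otimes(X^2\cdot m_{(0)})_{(0)}=X^1(Y^1\cdot m)_{(-1)_1}Y^2\otimes X^2(Y^1\cdot m)_{(-1)_2}Y^3\otimes X^3\cdot(Y^1\cdot m)_{(0)}$, $\varepsilon(m_{(-1)})m_{(0)}=m$, $h_1m_{(-1)}\otimes h_2\cdot m_{(0)}=(h_1\cdot m)_{(-1)}h_2\otimes(h_1\cdot m)_{(0)}$. Morphisms in ${}_H^H\mathcal{YD}$ are $H$-linear maps intertwining the coactions. For $M,N$ in ${}_H^H\mathcal{YD}$, $M\otimes N$ is in ${}_H^H\mathcal{YD}$ with action $h\cdot(m\otimes n)=h_1\cdot m\otimes h_2\cdot n$ and coaction $\lambda_{M\otimes N}(m\otimes n)=X^1(x^1Y^1\cdot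 m)_{(-1)}x^2(Y^2\cdot n)_{(-1)}Y^3\otimes X^2\cdot(x^1Y^1\cdot m)_{(0)}\otimes X^3x^3\cdot(Y^2\cdot n)_{(0)}$; associativity constraint $(u\otimes v)\otimes w\mapsto X^1\cdot u\otimes(X^2\cdot v\otimes X^3\cdot w)$; (pre)braiding $m\otimes n\mapsto m_{(-1)}\cdot n\otimes m_{(0)}$. An algebra in ${}_H^H\mathcal{YD}$ is a left $H$-module algebra $A$ that is a Yetter-Drinfeld module with $\lambda_A(1_A)=1\otimes 1_A$ and $\lambda_A(aa')=X^1(x^1Y^1\cdot a)_{(-1)}x^2(Y^2\cdot a')_{(-1)}Y^3\otimes[X^2\cdot(x^1Y^1\cdot a)_{(0)}][X^3x^3\cdot(Y^2\cdot a')_{(0)}]$; morphisms of such algebras are unital multiplicative morphisms in ${}_H^H\mathcal{YD}$. If $B$ is an associative algebra and $v:H\to B$ an algebra map, $B^v$ is the left $H$-module algebra with underlying space $B$, multiplication $b\star b'=v(X^1)bv(S(x^1X^2)\alpha x^2X^3_1)b'v(S(x^3X^3_2))$, unit $v(\beta)$, action $h\triangleright_v b=v(h_1)bv(S(h_2))$. $H_0:=H^{id_H}$ (multiplication denoted $*$, action $h\triangleright h'=h_1h'S(h_2)$) is an algebra in ${}_H^H\mathcal{YD}$ with coaction $h\mapsto h_{(-1)}\otimes h_{(0)}=X^1Y^1_1h_1g^1S(q^2Y^2_2)Y^3\otimes X^2Y^1_2h_2g^2S(X^3q^1Y^2_1)$. $A\,\underline{\otimes}\,H_0$ is the braided tensor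 product algebra in ${}_H^H\mathcal{YD}$: the object $A\otimes H_0$ with unit $1_A\otimes\beta$ and multiplication $(a\otimes h)(a'\otimes h')=(y^1X^1\cdot a)(y^2Y^1(x^1X^2\triangleright h)_{(-1)}x^2X^3_1\cdot a')\otimes(y^3_1Y^2\triangleright(x^1X^2\triangleright h)_{(0)})*(y^3_2Y^3x^3X^3_2\triangleright h')$. $(A\# H)^j$ is the left $H$-module algebra $B^v$ for $B=A\# H$, $v=j$, regarded as an algebra in ${}_H^H\mathcal{YD}$ with coaction $$a\# h\mapsto X^1Y^1_1T^1(t^1\cdot a)_{(-1)}t^2h_1g^1S(q^2Y^2_2)Y^3\otimes\big[X^2_1Y^1_{(2,1)}T^2\cdot(t^1\cdot a)_{(0)}\,\#\,X^2_2Y^1_{(2,2)}T^3t^3h_2g^2S(X^3q^1Y^2_1)\big].$$ *)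

(* Defs.v *)
From HB Require Import structures.
From mathcomp Require Import all_boot all_order all_algebra.
From mathcomp Require Import generic_quotient.
From mathcomp Require Import boolp classical_sets.

Set Implicit Arguments.
Unset Strict Implicit.
Unset Printing Implicit Defensive.

Import GRing.Theory.
Local Open Scope ring_scope.
Local Open Scope quotient_scope.

Reserved Notation "x ⊗ y" (at level 45, right associativity).

Definition bilin (k : fieldType) (U V W : lmodType k) (f : U -> V -> W) :=
  (forall v, linear (f^~ v)) /\ (forall u, linear (f u)).

Section Tensor.
Variables (k : fieldType) (U V : lmodType k).

(* U ⊗ V is the set of formal sums of pairs (u, v), two of them being
   identified when no bilinear map to a k-space distinguishes them. *)
Definition tens_eq : rel (seq (U * V)) := fun s t =>
  `[< forall (W : lmodType k) (f : U -> V -> W), bilin f ->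
        \sum_(p <- s) f p.1 p.2 = \sum_(p <- t) f p.1 p.2 >].

Lemma tens_eq_refl : reflexive tens_eq.
Proof. by move=> s; apply/asboolP. Qed.

Lemma tens_eq_sym : symmetric tens_eq.
Proof.
by move=> s t; apply/asboolP/asboolP => h W f hf; rewrite (h W f hf).
Qed.

Lemma tens_eq_trans : transitive tens_eq.
Proof.
move=> t s r /asboolP h1 /asboolP h2; apply/asboolP => W f hf.
by rewrite (h1 W f hf) (h2 W f hf).
Qed.

Canonical tens_equiv := EquivRel tens_eq tens_eq_refl tens_eq_sym tens_eq_trans.

Definition tensor := {eq_quot tens_equiv}.

HB.instance Definition _ := Choice.on tensor.
HB.instance Definition _ := EqQuotient.on tensor.

Implicit Types (s t : seq (U * V)) (x y z : tensor).

Definition tens (u : U) (v : V) : tensor := \pi_tensor [:: (u, v)].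

Lemma tensor_piP s t :
  \pi_tensor s = \pi_tensor t <->
  (forall (W : lmodType k) (f : U -> V -> W), bilin f ->
     \sum_(p <- s) f p.1 p.2 = \sum_(p <- t) f p.1 p.2).
Proof.
split=> [/eqP|h]; first by rewrite piE => /asboolP.
by apply/eqP; rewrite piE; apply/asboolP.
Qed.

(* The Sweedler sum [\sum F u v] over a representative of x; it is independent
   of the representative only when F is bilinear (see [tsumE]). *)
Definition tsum {W : zmodType} x (F : U -> V -> W) : W :=
  \sum_(p <- repr x) F p.1 p.2.

Lemma tsum_pi (W : lmodType k) (F : U -> V -> W) s : bilin F ->
  tsum (\pi_tensor s) F = \sum_(p <- s) F p.1 p.2.
Proof.
move=> hF; rewrite /tsum.
have /tensor_piP h : \pi_tensor (repr (\pi_tensor s)) = \pi_tensor s.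
  by rewrite reprK.
exact: h.
Qed.

Definition tens_add x y : tensor := \pi_tensor (repr x ++ repr y).
Definition tens_scale (a : k) x : tensor :=
  \pi_tensor [seq (a *: p.1, p.2) | p <- repr x].
Definition tens_zero : tensor := \pi_tensor [::].

Lemma tsum_add (W : lmodType k) (F : U -> V -> W) x y : bilin F ->
  tsum (tens_add x y) F = tsum x F + tsum y F.
Proof. by move=> hF; rewrite tsum_pi // big_cat. Qed.

Lemma tsum_scale (W : lmodType k) (F : U -> V -> W) a x : bilin F ->
  tsum (tens_scale a x) F = a *: tsum x F.
Proof.
move=> hF; rewrite tsum_pi // big_map scaler_sumr; apply: eq_bigr => p _ /=.
exact: (scalable_linear (proj1 hF p.2)).
Qed.

Lemma tsum_zero (W : lmodType k) (F : U -> V -> W) : bilin F ->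
  tsum tens_zero F = 0.
Proof. by move=> hF; rewrite tsum_pi // big_nil. Qed.

Lemma tensorP x y :
  (forall (W : lmodType k) (F : U -> V -> W), bilin F -> tsum x F = tsum y F) ->
  x = y.
Proof.
by move=> h; rewrite -(reprK x) -(reprK y); apply/tensor_piP => W f /h.
Qed.

Lemma tens_addA : associative tens_add.
Proof. by move=> x y z; apply: tensorP => W F hF; rewrite !tsum_add // addrA. Qed.
Lemma tens_addC : commutative tens_add.
Proof. by move=> x y; apply: tensorP => W F hF; rewrite !tsum_add // addrC. Qed.
Lemma tens_add0 : left_id tens_zero tens_add.
Proof.
by move=> x; apply: tensorP => W F hF; rewrite tsum_add // tsum_zero // add0r.
Qed.
Lemma tens_addN : left_inverse tens_zero (tens_scale (-1)) tens_add.
Proof.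
move=> x; apply: tensorP => W F hF.
by rewrite tsum_add // tsum_scale // tsum_zero // scaleN1r addNr.
Qed.

HB.instance Definition _ :=
  GRing.isZmodule.Build tensor tens_addA tens_addC tens_add0 tens_addN.

Lemma tens_scaleA a b x : tens_scale a (tens_scale b x) = tens_scale (a * b) x.
Proof. by apply: tensorP => W F hF; rewrite !tsum_scale // scalerA. Qed.
Lemma tens_scale1 : left_id 1 tens_scale.
Proof. by move=> x; apply: tensorP => W F hF; rewrite tsum_scale // scale1r. Qed.
Lemma tens_scaleDr : right_distributive tens_scale +%R.
Proof.
move=> a x y; apply: tensorP => W F hF.
by rewrite !(tsum_add, tsum_scale) // scalerDr.
Qed.
Lemma tens_scaleDl x : {morph tens_scale^~ x : a b / a + b}.
Proof.
move=> a b; apply: tensorP => W F hF.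
by rewrite !(tsum_add, tsum_scale) // scalerDl.
Qed.

HB.instance Definition _ := GRing.Zmodule_isLmodule.Build k tensor
  tens_scaleA tens_scale1 tens_scaleDr tens_scaleDl.

Section Tsum.
Variables (W : lmodType k) (F : U -> V -> W).
Hypothesis (hF : bilin F).

Lemma tsumE u v : tsum (tens u v) F = F u v.
Proof. by rewrite tsum_pi // big_seq1. Qed.

Lemma tsumD x y : tsum (x + y) F = tsum x F + tsum y F.
Proof. exact: tsum_add. Qed.

Lemma tsumZ a x : tsum (a *: x) F = a *: tsum x F.
Proof. exact: tsum_scale. Qed.

Lemma tsum0 : tsum 0 F = 0.
Proof. exact: tsum_zero. Qed.

Lemma tsum_linear : linear (fun x => tsum x F).
Proof. by move=> a x y; rewrite tsumD tsumZ. Qed.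

End Tsum.

Lemma tens_bilin : bilin tens.
Proof.
by split=> [v|u] a p q; apply: tensorP => W F hF;
  rewrite (tsumD hF) (tsumZ hF) !(tsumE hF) ?(proj1 hF v) ?(proj2 hF u).
Qed.

Lemma tsum_tens x : tsum x tens = x.
Proof.
apply: tensorP => W F hF; rewrite -[x in RHS]reprK (tsum_pi _ hF) /tsum.
elim: (repr x) => [|[u v] s IHs]; rewrite ?big_nil ?big_cons; first exact: tsum0.
by rewrite -IHs -(tsumE hF) -(tsumD hF).
Qed.

Lemma tensor_ind (P : tensor -> Prop) :
  P 0 -> (forall u v x, P x -> P (tens u v + x)) -> forall x, P x.
Proof.
move=> P0 PD x; rewrite -(tsum_tens x) /tsum.
by elim: (repr x) => [|p s IHs]; rewrite ?big_nil // big_cons; apply: PD.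
Qed.

End Tensor.

Notation "U ⊗ V" := (tensor U%type V%type) : type_scope.
Notation "u ⊗ v" := (tens u v) : ring_scope.

Lemma eq_tsum (k : fieldType) (U V : lmodType k) (W : zmodType)
    (F G : U -> V -> W) (x : U ⊗ V) :
  (forall u v, F u v = G u v) -> tsum x F = tsum x G.
Proof. by move=> e; apply: eq_bigr => p _; apply: e. Qed.

Lemma tsum_linF (k : fieldType) (U V W : lmodType k) (F G : U -> V -> W) a
    (x : U ⊗ V) :
  tsum x (fun u v => a *: F u v + G u v) = a *: tsum x F + tsum x G.
Proof. by rewrite /tsum big_split scaler_sumr. Qed.

Section Functional.
Variables (k : fieldType) (U : lmodType k) (u0 : U).
Hypothesis (u0_neq0 : u0 != 0).

Let closedP : set (set U) := fun M =>
  ~ M u0 /\ forall (a : k) x y, M x -> M y -> M (a *: x + y).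

(* A nonzero vector is mapped to 1 by some linear form. *)
Lemma exists_functional : exists phi : U -> k^o, linear phi /\ phi u0 = 1.
Proof.
have [F FP totF|M [[Mu0 Mlin] Mmax]] := @Zorn_bigcup U closedP.
  split=> [[M FM Mu0]|a x y [M FM Mx] [N FN Ny]].
    by have [] := FP M FM.
  have [_ linM] := FP M FM; have [_ linN] := FP N FN.
  have [MN|NM] := totF M N FM FN.
    by exists N => //; apply: linN => //; apply: MN.
  by exists M => //; apply: linM => //; apply: NM.
have M0 : M 0.
  have [//|nM0] := EM (M 0); exfalso.
  have M_empty x : ~ M x.
    by move=> Mx; apply: nM0; have := Mlin (-1) x x Mx Mx; rewrite scaleN1r addNr.
  apply: (Mmax [set 0 : U]%classic); last first.
    split; first by move=> /= /eqP; rewrite (negbTE u0_neq0).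
    by move=> a x y /= -> ->; rewrite scaler0 addr0.
  split; first by move=> x /M_empty.
  by move=> sub; apply: (M_empty 0); apply: sub.
have MZ a x : M x -> M (a *: x) by move=> Mx; rewrite -[_ *: _]addr0; apply: Mlin.
have MD x y : M x -> M y -> M (x + y).
  by move=> Mx My; rewrite -[x]scale1r; apply: Mlin.
have MB x y : M x -> M y -> M (x - y).
  by move=> Mx My; rewrite addrC -scaleN1r; apply: Mlin.
have ex x : exists c : k, M (x - c *: u0).
  have [Mx|nMx] := EM (M x); first by exists 0; rewrite scale0r subr0.
  pose N := [set y | exists a m, M m /\ y = a *: x + m]%classic.
  have MN : (M `<` N)%classic.
    split.
      by move=> m Mm; exists 0, m; rewrite scale0r add0r.
    by move=> sub; apply: nMx; apply: sub; exists 1, 0; rewrite scale1r addr0.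
  have [a [m [Mm e]]] : N u0.
    have [//|nN] := EM (N u0); exfalso; apply: (Mmax N MN); split=> //.
    move=> c _ _ [a [m [Mm ->]]] [b [n [Mn ->]]].
    exists (c * a + b), (c *: m + n); split; first exact: Mlin.
    by rewrite scalerDr scalerA scalerDl addrACA.
  have a_neq0 : a != 0.
    by apply/eqP => a0; apply: Mu0; rewrite e a0 scale0r add0r.
  exists a^-1; rewrite e scalerDr scalerA mulVf // scale1r opprD addNKr -scaleN1r.
  by do 2![apply: (MZ _ _)].
pose phi x := projT1 (cid (ex x)).
have phiP x : M (x - phi x *: u0) by rewrite /phi; case: cid.
have phi_uniq x c : M (x - c *: u0) -> phi x = c.
  move=> Mc; apply/eqP; rewrite -subr_eq0; apply/eqP.
  have [//|/eqP d_neq0] := EM (phi x - c = 0); exfalso; apply: Mu0.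
  have e : x - c *: u0 - (x - phi x *: u0) = (phi x - c) *: u0.
    by rewrite scalerBl opprB addrC addrA subrK.
  have := MZ (phi x - c)^-1 _ (MB _ _ Mc (phiP x)).
  by rewrite e scalerA mulVf // scale1r.
exists phi; split=> [a x y|]; last by apply: phi_uniq; rewrite scale1r subrr.
apply: phi_uniq; rewrite scalerDl opprD addrACA -scalerA -scalerBr.
exact: Mlin.
Qed.

End Functional.

Section TensorAlgebra.
Variables (k : fieldType) (A B : algType k).
Implicit Types (x y z : A ⊗ B).

Local Notation AB := (tensor (A : lmodType k) (B : lmodType k)).

Definition tens_mul x y : A ⊗ B :=
  tsum x (fun a b => tsum y (fun c d => (a * c) ⊗ (b * d))).

Let bilin_in a b : bilin (fun (c : A) (d : B) => (a * c) ⊗ (b * d)).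
Proof.
split=> [d|c] r p q; rewrite mulrDr -scalerAr.
  exact: (proj1 (tens_bilin A B)).
exact: (proj2 (tens_bilin A B)).
Qed.

Let bilin_out y :
  bilin (fun (a : A) (b : B) => tsum y (fun c d => (a * c) ⊗ (b * d))).
Proof.
split=> [b|a] r p q; rewrite -tsum_linF; apply: eq_tsum => c d;
  rewrite mulrDl -scalerAl.
  exact: (proj1 (tens_bilin A B)).
exact: (proj2 (tens_bilin A B)).
Qed.

Lemma tens_mulE a b c d :
  tens_mul (a ⊗ b) (c ⊗ d) = (a * c) ⊗ (b * d) :> A ⊗ B.
Proof. by rewrite /tens_mul (tsumE (bilin_out _)) (tsumE (bilin_in _ _)). Qed.

Lemma tens_mulDl : left_distributive tens_mul +%R.
Proof. by move=> x y z; rewrite /tens_mul (tsumD (bilin_out _)). Qed.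

Lemma tens_mulDr : right_distributive tens_mul +%R.
Proof.
move=> x y z; rewrite /tens_mul -[tsum x _ in RHS]scale1r -tsum_linF.
by apply: eq_tsum => a b; rewrite (tsumD (bilin_in _ _)) scale1r.
Qed.

Lemma tens_mul0l : left_zero 0 tens_mul.
Proof. by move=> x; rewrite /tens_mul (tsum0 (bilin_out _)). Qed.

Lemma tens_mul0r : right_zero 0 tens_mul.
Proof.
by move=> x; apply: (addrI (tens_mul x 0)); rewrite -tens_mulDr !addr0.
Qed.

Lemma tens_mulA : associative tens_mul.
Proof.
move=> x y z; elim/tensor_ind: x => [|a b x IHx]; first by rewrite !tens_mul0l.
rewrite !tens_mulDl IHx; congr (_ + _) => {x IHx}.
elim/tensor_ind: y => [|c d y IHy]; first by rewrite ?(tens_mul0l, tens_mul0r).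
rewrite [in LHS]tens_mulDl !tens_mulDr tens_mulDl IHy; congr (_ + _) => {y IHy}.
elim/tensor_ind: z => [|e f z IHz]; first by rewrite !tens_mul0r.
by rewrite !tens_mulDr IHz !tens_mulE !mulrA.
Qed.

Lemma tens_mul1l : left_id (1 ⊗ 1) tens_mul.
Proof.
elim/tensor_ind=> [|a b x IHx]; first exact: tens_mul0r.
by rewrite tens_mulDr IHx tens_mulE !mul1r.
Qed.

Lemma tens_mul1r : right_id (1 ⊗ 1) tens_mul.
Proof.
elim/tensor_ind=> [|a b x IHx]; first exact: tens_mul0l.
by rewrite tens_mulDl IHx tens_mulE !mulr1.
Qed.

Lemma tens1_neq0 : (1 : A) ⊗ (1 : B) != 0.
Proof.
have [phi [linphi phi1]] := exists_functional (oner_neq0 A).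
have [psi [linpsi psi1]] := exists_functional (oner_neq0 B).
have bil : bilin (fun a b => phi a * psi b : k^o).
  split=> [b|a] r p q.
    by rewrite linphi mulrDl -scalerAl.
  by rewrite linpsi mulrDr -scalerAr.
apply/eqP => /(congr1 (fun x => tsum x (fun a b => phi a * psi b : k^o))).
rewrite (tsumE bil) (tsum0 bil) phi1 psi1 mulr1.
by apply/eqP; apply: oner_neq0.
Qed.

HB.instance Definition _ := GRing.Zmodule_isNzRing.Build AB
  tens_mulA tens_mul1l tens_mul1r tens_mulDl tens_mulDr tens1_neq0.

Lemma tens_scaleAl (r : k) x y : r *: (x * y) = (r *: x) * y.
Proof. by rewrite /GRing.mul /= /tens_mul (tsumZ (bilin_out _)). Qed.

HB.instance Definition _ :=
  GRing.Lmodule_isLalgebra.Build k AB tens_scaleAl.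

Lemma tens_scaleAr (r : k) x y : r *: (x * y) = x * (r *: y).
Proof.
rewrite /GRing.mul /= /tens_mul -[LHS]addr0.
rewrite -[0](_ : tsum x (fun _ _ => 0 : A ⊗ B) = 0); last exact: big1.
rewrite -tsum_linF; apply: eq_tsum => a b.
by rewrite (tsumZ (bilin_in _ _)) addr0.
Qed.

HB.instance Definition _ :=
  GRing.Lalgebra_isAlgebra.Build k AB tens_scaleAr.

Lemma tensM (a c : A) (b d : B) : (a ⊗ b) * (c ⊗ d) = (a * c) ⊗ (b * d).
Proof. exact: tens_mulE. Qed.

Lemma tens1 : 1 = 1 ⊗ 1 :> A ⊗ B.
Proof. by []. Qed.

End TensorAlgebra.

(* [\sw[x, y <- t] E] is the sum of E over a decomposition t = \sum x ⊗ y; every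
   E below is multilinear in the bound variables, so [tsumE] applies.  Iterated
   tensor products are bracketed to the right. *)
Notation "'\sw[' x , y <- t ] E" := (tsum t (fun x y => E))
  (at level 46, x name, y name, t at level 99, E at level 46,
   format "'\sw[' x ,  y  <-  t ]  E") : ring_scope.
Notation "'\sw[' x , y , z <- t ] E" :=
  (tsum t (fun x t' => tsum t' (fun y z => E)))
  (at level 46, x name, y name, z name, t at level 99, E at level 46,
   format "'\sw[' x ,  y ,  z  <-  t ]  E") : ring_scope.
Notation "'\sw[' x , y , z , w <- t ] E" :=
  (tsum t (fun x t' => tsum t' (fun y t'' => tsum t'' (fun z w => E))))
  (at level 46, x name, y name, z name, w name, t at level 99, E at level 46,
   format "'\sw[' x ,  y ,  z ,  w  <-  t ]  E") : ring_scope.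

Record quasiBialgebra (k : fieldType) (H : algType k) := QuasiBialgebra {
  qDelta : {lrmorphism H -> H ⊗ H};
  qeps : {lrmorphism H -> k | *%R};
  qPhi : H ⊗ H ⊗ H;
  qPhi_inv : H ⊗ H ⊗ H;
  qPhi_mulV : qPhi * qPhi_inv = 1;
  qPhi_Vmul : qPhi_inv * qPhi = 1;
  (* (id ⊗ Δ)(Δ h) = Φ (Δ ⊗ id)(Δ h) Φ^-1 *)
  qcoassoc : forall h : H,
    \sw[h1, h2 <- qDelta h] h1 ⊗ qDelta h2 =
    qPhi * (\sw[h1, h2 <- qDelta h] \sw[h11, h12 <- qDelta h1] h11 ⊗ h12 ⊗ h2)
         * qPhi_inv;
  qcounitr : forall h : H, \sw[h1, h2 <- qDelta h] qeps h2 *: h1 = h;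
  qcounitl : forall h : H, \sw[h1, h2 <- qDelta h] qeps h1 *: h2 = h;
  (* (1 ⊗ Φ) (id ⊗ Δ ⊗ id)(Φ) (Φ ⊗ 1) = (id ⊗ id ⊗ Δ)(Φ) (Δ ⊗ id ⊗ id)(Φ) *)
  qpentagon :
    (1 ⊗ qPhi)
    * (\sw[X1, X2, X3 <- qPhi] \sw[Y1, Y2 <- qDelta X2] X1 ⊗ Y1 ⊗ Y2 ⊗ X3)
    * (\sw[X1, X2, X3 <- qPhi] X1 ⊗ X2 ⊗ X3 ⊗ 1) =
    (\sw[X1, X2, X3 <- qPhi] X1 ⊗ X2 ⊗ qDelta X3)
    * (\sw[X1, X2, X3 <- qPhi] \sw[Y1, Y2 <- qDelta X1] Y1 ⊗ Y2 ⊗ X2 ⊗ X3)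
    :> H ⊗ H ⊗ H ⊗ H;
  qPhi_eps1 : \sw[X1, X2, X3 <- qPhi] qeps X1 *: (X2 ⊗ X3) = 1 :> H ⊗ H;
  qPhi_eps2 : \sw[X1, X2, X3 <- qPhi] qeps X2 *: (X1 ⊗ X3) = 1 :> H ⊗ H;
  qPhi_eps3 : \sw[X1, X2, X3 <- qPhi] qeps X3 *: (X1 ⊗ X2) = 1 :> H ⊗ H
}.

(* [qSinv] is the inverse of the antipode, used in [q_R]. *)
Record quasiHopf (k : fieldType) (H : algType k) := QuasiHopf {
  qbialg :> quasiBialgebra H;
  qS : {linear H -> H};
  qSinv : H -> H;
  qalpha : H;
  qbeta : H;
  qSK : cancel qS qSinv;
  qSinvK : cancel qSinv qS;
  qS1 : qS 1 = 1;
  qSM : forall h h' : H, qS (h * h') = qS h' * qS h;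
  qantipodel : forall h : H,
    \sw[h1, h2 <- qDelta qbialg h] qS h1 * qalpha * h2 = qeps qbialg h *: qalpha;
  qantipoder : forall h : H,
    \sw[h1, h2 <- qDelta qbialg h] h1 * qbeta * qS h2 = qeps qbialg h *: qbeta;
  qPhi_antipode :
    \sw[X1, X2, X3 <- qPhi qbialg] X1 * qbeta * qS X2 * qalpha * X3 = 1;
  qPhi_inv_antipode :
    \sw[x1, x2, x3 <- qPhi_inv qbialg] qS x1 * qalpha * x2 * qbeta * qS x3 = 1;
  qeps_alpha : qeps qbialg qalpha = 1;
  qeps_beta : qeps qbialg qbeta = 1;
  qeps_S : forall h : H, qeps qbialg (qS h) = qeps qbialg h
}.

Section QuasiHopfElements.
Variables (k : fieldType) (H : algType k) (Q : quasiHopf H).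

Local Notation Δ := (qDelta Q).
Local Notation Φ := (qPhi Q).
Local Notation Φi := (qPhi_inv Q).
Local Notation S := (qS Q).
Local Notation α := (qalpha Q).
Local Notation β := (qbeta Q).

Definition drinfeld_delta : H ⊗ H :=
  \sw[B1, B2, B3, B4 <-
      (\sw[X1, X2, X3 <- Φ] \sw[Y1, Y2 <- Δ X1] Y1 ⊗ Y2 ⊗ X2 ⊗ X3)
      * (\sw[x1, x2, x3 <- Φi] x1 ⊗ x2 ⊗ x3 ⊗ 1) : H ⊗ H ⊗ H ⊗ H]
    (B1 * β * S B4) ⊗ (B2 * β * S B3).

(* The inverse f^-1 = g^1 ⊗ g^2 of the Drinfeld twist f. *)
Definition drinfeld_twist_inv : H ⊗ H :=
  \sw[x1, x2, x3 <- Φi]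
    Δ (S x1 * α * x2) * drinfeld_delta * (\sw[u, v <- Δ x3] S v ⊗ S u).

Definition q_R : H ⊗ H :=
  \sw[X1, X2, X3 <- Φ] X1 ⊗ (qSinv Q (α * X3) * X2).

End QuasiHopfElements.

Section YetterDrinfeld.
Variables (k : fieldType) (H : algType k) (Q : quasiHopf H).

Local Notation Δ := (qDelta Q).
Local Notation ε := (qeps Q).
Local Notation Φ := (qPhi Q).
Local Notation Φi := (qPhi_inv Q).

Definition is_module (M : lmodType k) (act : H -> M -> M) : Prop :=
  [/\ bilin act,
      forall m, act 1 m = m &
      forall h h' m, act (h * h') m = act h (act h' m)].

Definition is_module_algebra (A : lmodType k) (act : H -> A -> A)
    (mul : A -> A -> A) (one : A) : Prop :=
  is_module act /\ bilin mul /\ left_id one mul /\ right_id one mul /\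
  [/\ forall a b c, mul (mul a b) c =
        \sw[X1, X2, X3 <- Φ] mul (act X1 a) (mul (act X2 b) (act X3 c)),
      forall h a b, act h (mul a b) =
        \sw[h1, h2 <- Δ h] mul (act h1 a) (act h2 b) &
      forall h, act h one = ε h *: one].

Definition is_yetter_drinfeld (M : lmodType k) (act : H -> M -> M)
    (coact : M -> H ⊗ M) : Prop :=
  is_module act /\ linear coact /\
  [/\ forall m,
        \sw[X1, X2, X3 <- Φ] \sw[a, m0 <- coact m]
          \sw[b, n0 <- coact (act X2 m0)] (X1 * a) ⊗ (b * X3) ⊗ n0 =
        \sw[X1, X2, X3 <- Φ] \sw[Y1, Y2, Y3 <- Φ]
          \sw[a, m0 <- coact (act Y1 m)] \sw[a1, a2 <- Δ a]
            (X1 * a1 * Y2) ⊗ (X2 * a2 * Y3) ⊗ act X3 m0,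
      forall m, \sw[a, m0 <- coact m] ε a *: m0 = m &
      forall h m,
        \sw[h1, h2 <- Δ h] \sw[a, m0 <- coact m] (h1 * a) ⊗ act h2 m0 =
        \sw[h1, h2 <- Δ h] \sw[a, m0 <- coact (act h1 m)] (a * h2) ⊗ m0].

(* The operations of an algebra in the Yetter-Drinfeld category; the axioms are
   in [is_yd_algebra]. *)
Record ydAlgOps (A : lmodType k) := YdAlgOps {
  yd_act : H -> A -> A;
  yd_coact : A -> H ⊗ A;
  yd_mul : A -> A -> A;
  yd_one : A
}.

Definition is_yd_algebra (A : lmodType k) (O : ydAlgOps A) : Prop :=
  let act := yd_act O in let coact := yd_coact O in
  let mul := yd_mul O in let one := yd_one O in
  [/\ is_module_algebra act mul one,
      is_yetter_drinfeld act coact,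
      coact one = 1 ⊗ one &
      forall a b, coact (mul a b) =
        \sw[X1, X2, X3 <- Φ] \sw[x1, x2, x3 <- Φi] \sw[Y1, Y2, Y3 <- Φ]
          \sw[a', a0 <- coact (act (x1 * Y1) a)]
            \sw[b', b0 <- coact (act Y2 b)]
              (X1 * a' * x2 * b' * Y3)
              ⊗ mul (act X2 a0) (act (X3 * x3) b0)].

Definition is_yd_algebra_morphism (A B : lmodType k) (OA : ydAlgOps A)
    (OB : ydAlgOps B) (f : A -> B) : Prop :=
  linear f /\
  [/\ forall h a, f (yd_act OA h a) = yd_act OB h (f a),
      forall a, yd_coact OB (f a) = \sw[a', a0 <- yd_coact OA a] a' ⊗ f a0,
      f (yd_one OA) = yd_one OB &
      forall a b, f (yd_mul OA a b) = yd_mul OB (f a) (f b)].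

Definition is_yd_algebra_isomorphism (A B : lmodType k) (OA : ydAlgOps A)
    (OB : ydAlgOps B) (f : A -> B) : Prop :=
  is_yd_algebra_morphism OA OB f /\
  exists g : B -> A,
    [/\ is_yd_algebra_morphism OB OA g, cancel f g & cancel g f].

End YetterDrinfeld.

Section BraidedTensor.
Variables (k : fieldType) (H : algType k) (Q : quasiHopf H).
Variables (A C : lmodType k) (OA : ydAlgOps H A) (OC : ydAlgOps H C).

Local Notation Δ := (qDelta Q).
Local Notation Φ := (qPhi Q).
Local Notation Φi := (qPhi_inv Q).
Local Notation "h · a" := (yd_act OA h a) (at level 39, left associativity).
Local Notation "h ▷ c" := (yd_act OC h c) (at level 39, left associativity).

Definition braided_tensor_act (h : H) (t : A ⊗ C) : A ⊗ C :=
  \sw[a, c <- t] \sw[h1, h2 <- Δ h] (h1 · a) ⊗ (h2 ▷ c).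

Definition braided_tensor_coact (t : A ⊗ C) : H ⊗ A ⊗ C :=
  \sw[a, c <- t]
  \sw[X1, X2, X3 <- Φ] \sw[x1, x2, x3 <- Φi] \sw[Y1, Y2, Y3 <- Φ]
  \sw[a', a0 <- yd_coact OA ((x1 * Y1) · a)] \sw[c', c0 <- yd_coact OC (Y2 ▷ c)]
    (X1 * a' * x2 * c' * Y3) ⊗ (X2 · a0) ⊗ ((X3 * x3) ▷ c0).

Definition braided_tensor_mul (s t : A ⊗ C) : A ⊗ C :=
  \sw[a, c <- s] \sw[a', c' <- t]
  \sw[y1, y2, y3 <- Φi] \sw[X1, X2, X3 <- Φ] \sw[Y1, Y2, Y3 <- Φ]
  \sw[x1, x2, x3 <- Φi] \sw[X31, X32 <- Δ X3] \sw[y31, y32 <- Δ y3]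
  \sw[e, c0 <- yd_coact OC ((x1 * X2) ▷ c)]
    yd_mul OA ((y1 * X1) · a) ((y2 * Y1 * e * x2 * X31) · a')
    ⊗ yd_mul OC ((y31 * Y2) ▷ c0) ((y32 * Y3 * x3 * X32) ▷ c').

Definition braided_tensor : ydAlgOps H (A ⊗ C)%type :=
  YdAlgOps braided_tensor_act braided_tensor_coact braided_tensor_mul
    (yd_one OA ⊗ yd_one OC).

End BraidedTensor.

Section TwistedAlgebra.
Variables (k : fieldType) (H : algType k) (Q : quasiHopf H).
(* B is given by its multiplication only, not as an algType: the smash product
   A # H may be the zero ring. *)
Variables (B : lmodType k) (mulB : B -> B -> B) (v : H -> B).

Local Notation Δ := (qDelta Q).
Local Notation Φ := (qPhi Q).
Local Notation Φi := (qPhi_inv Q).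
Local Notation S := (qS Q).
Local Notation α := (qalpha Q).
Local Notation β := (qbeta Q).
Local Infix "∘" := mulB (at level 40, left associativity).

Definition twisted_mul (b b' : B) : B :=
  \sw[X1, X2, X3 <- Φ] \sw[x1, x2, x3 <- Φi] \sw[X31, X32 <- Δ X3]
    v X1 ∘ b ∘ v (S (x1 * X2) * α * x2 * X31) ∘ b' ∘ v (S (x3 * X32)).

Definition twisted_one : B := v β.

Definition twisted_act (h : H) (b : B) : B :=
  \sw[h1, h2 <- Δ h] v h1 ∘ b ∘ v (S h2).

End TwistedAlgebra.

Section H0.
Variables (k : fieldType) (H : algType k) (Q : quasiHopf H).

Local Notation Δ := (qDelta Q).
Local Notation Φ := (qPhi Q).
Local Notation S := (qS Q).

(* q = q_R and g = f^-1, the inverse of the Drinfeld twist. *)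
Definition H0_coact (h : H) : H ⊗ H :=
  \sw[X1, X2, X3 <- Φ] \sw[Y1, Y2, Y3 <- Φ]
  \sw[q1, q2 <- q_R Q] \sw[g1, g2 <- drinfeld_twist_inv Q]
  \sw[Y11, Y12 <- Δ Y1] \sw[Y21, Y22 <- Δ Y2] \sw[h1, h2 <- Δ h]
    (X1 * Y11 * h1 * g1 * S (q2 * Y22) * Y3)
    ⊗ (X2 * Y12 * h2 * g2 * S (X3 * q1 * Y21)).

Definition H0 : ydAlgOps H H :=
  YdAlgOps (twisted_act Q *%R id) H0_coact (twisted_mul Q *%R id)
    (twisted_one Q id).

End H0.

(* A # H has underlying space A ⊗ H, with a # h written a ⊗ h. *)
Section Smash.
Variables (k : fieldType) (H : algType k) (Q : quasiHopf H).
Variables (A : lmodType k) (OA : ydAlgOps H A).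

Local Notation Δ := (qDelta Q).
Local Notation Φ := (qPhi Q).
Local Notation Φi := (qPhi_inv Q).
Local Notation S := (qS Q).
Local Notation "h · a" := (yd_act OA h a) (at level 39, left associativity).

Definition smash_mul (s t : A ⊗ H) : A ⊗ H :=
  \sw[a, h <- s] \sw[a', h' <- t] \sw[x1, x2, x3 <- Φi] \sw[h1, h2 <- Δ h]
    yd_mul OA (x1 · a) ((x2 * h1) · a') ⊗ (x3 * h2 * h').

Definition smash_j (h : H) : A ⊗ H := yd_one OA ⊗ h.

Definition smash_coact (s : A ⊗ H) : H ⊗ A ⊗ H :=
  \sw[a, h <- s]
  \sw[X1, X2, X3 <- Φ] \sw[Y1, Y2, Y3 <- Φ] \sw[T1, T2, T3 <- Φ]
  \sw[t1, t2, t3 <- Φi] \sw[q1, q2 <- q_R Q] \sw[g1, g2 <- drinfeld_twist_inv Q]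
  \sw[X21, X22 <- Δ X2] \sw[Y11, Y12 <- Δ Y1] \sw[Y121, Y122 <- Δ Y12]
  \sw[Y21, Y22 <- Δ Y2] \sw[h1, h2 <- Δ h] \sw[a', a0 <- yd_coact OA (t1 · a)]
    (X1 * Y11 * T1 * a' * t2 * h1 * g1 * S (q2 * Y22) * Y3)
    ⊗ ((X21 * Y121 * T2) · a0)
    ⊗ (X22 * Y122 * T3 * t3 * h2 * g2 * S (X3 * q1 * Y21)).

(* (A # H)^j *)
Definition smash_j_algebra : ydAlgOps H (A ⊗ H)%type :=
  YdAlgOps (twisted_act Q smash_mul smash_j) smash_coact
    (twisted_mul Q smash_mul smash_j) (twisted_one Q smash_j).

Definition smash_Pi (t : A ⊗ H) : A ⊗ H :=
  \sw[a, h <- t] \sw[x1, x2, x3 <- Φi] (x1 · a) ⊗ (x2 * h * S x3).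

End Smash.

(* Main.v *)
(* Read in the tensor powers of H, every expression in the statement is a fixed
   multilinear functional (a product of action, coaction, S, alpha and beta)
   applied to a product of elements obtained from Phi and Phi^-1 by iterated
   coproducts.  Such an element is a reassociation of bracketed words whose
   letters are tensor factors, and by the pentagon and quasi-coassociativity it
   depends only on the source and the target bracketing (Mac Lane coherence).
   Two tensor factors evaluated against each other through S(-) alpha (-) or
   (-) beta S(-) absorb any common coproduct, hence may be added to or deleted
   from a letter of a bracketing at will.

   Applied to delta and gamma this gives the Drinfeld identities
   Delta(S h) g = g (S v (x) S u), with Delta h = u (x) v, and
   Delta(alpha) = g gamma, for g = f^-1; the twist f itself never occurs.  They
   turn both sides of the colinearity and of the multiplicativity of Pi into the
   values of one functional at two paths with the same ends. *)
From HB Require Import structures.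
Require Import Defs.
From mathcomp Require Import all_boot all_order all_algebra.
Set Implicit Arguments.
Unset Strict Implicit.
Unset Printing Implicit Defensive.
Import GRing.Theory.
Local Open Scope ring_scope.

(** * Linear maps and Sweedler sums *)

(** The twist enters only through the product [Δ h * g], whose two legs stay unexpanded. Π and the
    action on H_0 surround h by factors x and S(y), so the coactions meet Δ(x h S(y)) g; the
    identity for Δ(S y) g makes the new factors act on the two legs of Δ(h) g, that is, on strands.
    The identity for Δ(α) serves the product of (A # H)^j, where Δ is applied to a word containing
    α. Two obstacles keep the sides from being paths with common ends at once. The second leg S^-1(α
    X^3) X^2 of q_R occurs under S and becomes S(X^2) α X^3, an absorbed pair, which has to be
    inserted into neighbouring letters before the bracketings fit. And the coaction of A interrupts
    the path: associators before it act on a and on later factors in H, those after it on its two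
    outputs. The compatibility of action and coaction carries a coproduct across this gap, and
    coherence is used before and after the crossing. H-linearity and bijectivity are of another
    kind: on three strands Π is multiplication by Φ^-1, which is invertible and intertwines the two
    bracketings of a double coproduct. *)

Definition lin (k : fieldType) (U V : lmodType k) (f : U -> V) :=
  forall a x y, f (a *: x + y) = a *: f x + f y.

Section Lin.
Variable k : fieldType.
Implicit Types U V W : lmodType k.

Lemma lin0 U V (f : U -> V) : lin f -> f 0 = 0.
Proof.
move=> hf; have := hf (-1) 0 0.
by rewrite scaler0 addr0 scaleN1r addNr.
Qed.

Lemma linD U V (f : U -> V) : lin f -> {morph f : x y / x + y}.
Proof. by move=> hf x y; rewrite -[x]scale1r hf !scale1r. Qed.

Lemma linZ U V (f : U -> V) : lin f -> forall a x, f (a *: x) = a *: f x.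
Proof. by move=> hf a x; rewrite -[a *: x]addr0 hf (lin0 hf) addr0. Qed.

Lemma lin_idf U : lin (fun x : U => x). Proof. by []. Qed.

Lemma lin_cst0 U V : lin (fun _ : U => 0 : V).
Proof. by move=> a x y; rewrite scaler0 addr0. Qed.

Lemma lin_comp U V W (g : V -> W) (f : U -> V) :
  lin g -> lin f -> lin (fun x => g (f x)).
Proof. by move=> hg hf a x y; rewrite hf hg. Qed.

Lemma lin_sumE U V (f : U -> V) (hf : lin f) I (r : seq I) (F : I -> U) :
  f (\sum_(i <- r) F i) = \sum_(i <- r) f (F i).
Proof. exact: (big_morph f (linD hf) (lin0 hf)). Qed.

Lemma lin_sum U V I (r : seq I) (F : I -> U -> V) :
  (forall i, lin (F i)) -> lin (fun x => \sum_(i <- r) F i x).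
Proof.
by move=> hF a x y; rewrite scaler_sumr -big_split; apply: eq_bigr => i _; apply: hF.
Qed.

Lemma lin_add U V (f g : U -> V) : lin f -> lin g -> lin (fun x => f x + g x).
Proof. by move=> hf hg a x y; rewrite hf hg scalerDr addrACA. Qed.

Lemma lin_scale U V c (f : U -> V) : lin f -> lin (fun x => c *: f x).
Proof. by move=> hf a x y; rewrite hf scalerDr !scalerA [c * a]mulrC. Qed.

Lemma bilinP U V W (F : U -> V -> W) :
  (forall v, lin (fun u => F u v)) -> (forall u, lin (fun v => F u v)) -> bilin F.
Proof. by move=> h1 h2; split. Qed.

Lemma lin_tsumF U V W (X : lmodType k) (t : U ⊗ V) (F : X -> U -> V -> W) :
  (forall u v, lin (fun x : X => F x u v)) -> lin (fun x => tsum t (F x)).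
Proof. by move=> hF; apply: lin_sum => p; apply: hF. Qed.

Lemma lin_tsumx U V W (X : lmodType k) (t : X -> U ⊗ V) (F : U -> V -> W) :
  bilin F -> lin t -> lin (fun x => tsum (t x) F).
Proof. by move=> hF ht a x y; rewrite ht; apply: (tsum_linear hF). Qed.

Lemma lin_tensl U V W (f : U -> V) (w : W) : lin f -> lin (fun x => f x ⊗ w).
Proof. by move=> hf a x y; rewrite hf (proj1 (tens_bilin V W)). Qed.

Lemma lin_tensr U V W (f : U -> V) (w : W) : lin f -> lin (fun x => w ⊗ f x).
Proof. by move=> hf a x y; rewrite hf (proj2 (tens_bilin W V)). Qed.

Lemma lin_mull U (B : algType k) (f : U -> B) c : lin f -> lin (fun x => f x * c).
Proof. by move=> hf a x y; rewrite hf mulrDl -scalerAl. Qed.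

Lemma lin_mulr U (B : algType k) (f : U -> B) c : lin f -> lin (fun x => c * f x).
Proof. by move=> hf a x y; rewrite hf mulrDr -scalerAr. Qed.

Lemma lin_morph U V W (g : {linear V -> W}) (f : U -> V) :
  lin f -> lin (fun x => g (f x)).
Proof. by move=> hf a x y; rewrite hf linearP. Qed.

Lemma lin_lrmorph U (B C : algType k) (g : {lrmorphism B -> C}) (f : U -> B) :
  lin f -> lin (fun x => g (f x)).
Proof. by move=> hf a x y; rewrite hf linearP. Qed.

Lemma lin_form U V (B : algType k) (e : {lrmorphism B -> k | *%R}) (f : U -> B)
  (v : V) : lin f -> lin (fun x => e (f x) *: v).
Proof. by move=> hf a x y; rewrite hf linearP scalerDl scalerA. Qed.

Lemma lin_push U V W (X : lmodType k) (f : W -> X) (t : U ⊗ V) (F : U -> V -> W) :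
  lin f -> f (tsum t F) = tsum t (fun u v => f (F u v)).
Proof.
move=> hf; apply: (big_morph f (linD hf) (lin0 hf)).
Qed.

(** Sweedler sums are finite sums over representatives, so they commute whether or not [F] is
    linear. *)
Lemma tsumC U V U' V' (W : zmodType) (s : U ⊗ V) (t : U' ⊗ V')
    (F : U -> V -> U' -> V' -> W) :
  tsum s (fun a b => tsum t (F a b)) = tsum t (fun c d => tsum s (fun a b => F a b c d)).
Proof. exact: exchange_big. Qed.

Lemma tsum_tsum U V U' V' W (t : U ⊗ V) (G : U -> V -> U' ⊗ V')
    (F : U' -> V' -> W) :
  bilin F -> tsum (tsum t G) F = tsum t (fun u v => tsum (G u v) F).
Proof. by move=> hF; apply: (lin_push (f := fun x => tsum x F)); apply: (tsum_linear hF). Qed.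

Lemma tsum_mul (A B : algType k) W (x y : A ⊗ B) (F : A -> B -> W) :
  bilin F -> tsum (x * y) F =
    tsum x (fun a b => tsum y (fun c d => F (a * c) (b * d))).
Proof.
move=> hF; rewrite [x * y]/(tens_mul x y) /tens_mul tsum_tsum //.
apply: eq_tsum => a b; rewrite tsum_tsum //.
by apply: eq_tsum => c d; rewrite tsumE.
Qed.

Lemma tsum_mull (B : algType k) (U V : lmodType k) (x : U ⊗ V) (F : U -> V -> B) z :
  tsum x F * z = tsum x (fun u v => F u v * z).
Proof. by rewrite /tsum mulr_suml. Qed.

Lemma tsum_mulr (B : algType k) (U V : lmodType k) (x : U ⊗ V) (F : U -> V -> B) z :
  z * tsum x F = tsum x (fun u v => z * F u v).
Proof. by rewrite /tsum mulr_sumr. Qed.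

Lemma tens_eq_lin U V W (f g : U ⊗ V -> W) :
  lin f -> lin g -> (forall u v, f (u ⊗ v) = g (u ⊗ v)) -> f =1 g.
Proof.
move=> hf hg e; elim/tensor_ind=> [|u v x IHx]; first by rewrite (lin0 hf) (lin0 hg).
by rewrite (linD hf) (linD hg) e IHx.
Qed.

Lemma tens3_eq_lin U1 U2 U3 W (f g : U1 ⊗ U2 ⊗ U3 -> W) : lin f -> lin g ->
  (forall a b c, f (a ⊗ b ⊗ c) = g (a ⊗ b ⊗ c)) -> f =1 g.
Proof.
move=> hf hg e; apply: tens_eq_lin => // a.
apply: tens_eq_lin => [||b c]; last exact: e.
  by apply: (lin_comp hf); apply: lin_tensr; apply: lin_idf.
by apply: (lin_comp hg); apply: lin_tensr; apply: lin_idf.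
Qed.

Lemma tens4_eq_lin U1 U2 U3 U4 W (f g : U1 ⊗ U2 ⊗ U3 ⊗ U4 -> W) :
  lin f -> lin g ->
  (forall a b c d, f (a ⊗ b ⊗ c ⊗ d) = g (a ⊗ b ⊗ c ⊗ d)) -> f =1 g.
Proof.
move=> hf hg e; apply: tens_eq_lin => // a.
apply: tens3_eq_lin => [||b c d]; last exact: e.
  by apply: (lin_comp hf); apply: lin_tensr; apply: lin_idf.
by apply: (lin_comp hg); apply: lin_tensr; apply: lin_idf.
Qed.

End Lin.

(* Rebound further down, to teach [lin_tac] more linear maps. *)
Ltac lin_ext := fail.

(** Linearity is read off the shape of the body. For a product, a tensor or a Sweedler sum the
    alternatives of [first] correspond to the possible places of the variable, which a multilinear
    expression contains only once. *)
Ltac lin_tac :=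
  cbv beta;
  lazymatch goal with
  | |- forall _, _ => intro; lin_tac
  | |- bilin _ => apply: bilinP; [intro; lin_tac | intro; lin_tac]
  | |- GRing.linear_for _ ?f => change (lin f); lin_tac
  | |- lin (fun x => _) => lin_fun
  | |- @lin ?k ?U ?V ?f => change (@lin k U V (fun x => f x)); lin_fun
  end
with lin_fun :=
  lazymatch goal with
  | |- lin (fun x => x) => exact: lin_idf
  | |- lin (fun x => 0) => exact: lin_cst0
  | |- lin (fun x => tsum _ _) =>
      first [ apply: lin_tsumF => ? ?; lin_tac
            | apply: lin_tsumx; [lin_tac | lin_tac] ]
  | |- lin (fun x => tens _ _) =>
      first [ apply: lin_tensl; lin_tac | apply: lin_tensr; lin_tac ]
  | |- lin (fun x => _ * _) =>
      first [ apply: lin_mull; lin_tac | apply: lin_mulr; lin_tac ]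
  | |- lin (fun x => _ *: _) =>
      first [ apply: lin_scale; lin_tac | apply: lin_form; lin_tac ]
  | |- lin (fun x => _ + _) => apply: lin_add; lin_tac
  | _ => first
      [ assumption
      | lin_ext
      | apply: lin_lrmorph; lin_tac
      | apply: lin_morph; lin_tac ]
  end.

(** * Coherence *)

(** A bracketed word. The leaves name strands, which need be neither consecutive nor increasing, so
    that a path can involve any selection of tensor factors. *)
Inductive tree := Lf of nat | Nd of tree & tree.

Fixpoint tree_eqb s t := match s, t with
  | Lf i, Lf j => i == j
  | Nd s1 s2, Nd t1 t2 => tree_eqb s1 t1 && tree_eqb s2 t2
  | _, _ => false
  end.

Lemma tree_eqP : Equality.axiom tree_eqb.
Proof.
elim=> [i|s1 IH1 s2 IH2] [j|t1 t2]; apply: (iffP idP) => //=.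
- by move/eqP->.
- by case=> ->.
- by case/andP=> /IH1-> /IH2->.
- by case=> /IH1-> /IH2->.
Qed.

HB.instance Definition _ := hasDecEq.Build tree tree_eqP.

Fixpoint labels t := match t with Lf i => [:: i] | Nd l r => labels l ++ labels r end.

(* A move (true, r, s, t) stands for (rs)t -> r(st), and (false, r, s, t) for
   its inverse. *)
Definition move := (bool * tree * tree * tree)%type.

Definition msrc (m : move) := let: (b, r, s, t) := m in
  if b then Nd (Nd r s) t else Nd r (Nd s t).
Definition mdst (m : move) := let: (b, r, s, t) := m in
  if b then Nd r (Nd s t) else Nd (Nd r s) t.

Inductive step (m : move) : tree -> tree -> Prop :=
| StepHere : step m (msrc m) (mdst m)
| StepL t t' u : step m t t' -> step m (Nd t u) (Nd t' u)
| StepR t t' u : step m t t' -> step m (Nd u t) (Nd u t').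

(** A computable form of [step], by which concrete paths are checked by evaluation. In a tree with
    distinct leaves [a] occurs at most once, so searching the left subtree first is no real
    choice. *)
Fixpoint rewr (a b t : tree) : option tree :=
  if t == a then Some b else
  if t is Nd l r then
    if rewr a b l is Some l' then Some (Nd l' r)
    else if rewr a b r is Some r' then Some (Nd l r') else None
  else None.

Fixpoint run (p : seq move) (t : tree) : option tree :=
  if p is m :: p' then
    if rewr (msrc m) (mdst m) t is Some t' then run p' t' else None
  else Some t.

Lemma rewr_step m t t' : rewr (msrc m) (mdst m) t = Some t' -> step m t t'.
Proof.
elim: t t' => [i|l IHl r IHr] t' /=.
  by case: eqP => // -> [<-]; constructor.
case: eqP => [-> [<-]|_]; first by constructor.
case: (rewr _ _ l) IHl => [l'|] IHl; first by case=> <-; constructor; apply: IHl.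
case: (rewr _ _ r) IHr => [r'|] IHr //; by case=> <-; constructor; apply: IHr.
Qed.

Lemma labels_step m t t' : step m t t' -> labels t' = labels t.
Proof.
elim=> [|{}t {}t' u _ /= ->|{}t {}t' u _ /= ->] //.
by case: m => [[[[] r] s] t0] /=; rewrite catA.
Qed.

Definition mlabels (m : move) := labels (msrc m).

Lemma mlabels_step m t t' : step m t t' -> {subset mlabels m <= labels t}.
Proof.
by elim=> [|{}t {}t' u _ IH|{}t {}t' u _ IH] // i /IH /= hi; rewrite mem_cat hi ?orbT.
Qed.

(** The right comb on the leaves of [t], ending in [u]. It depends only on the sequence of leaves
    and hence is a normal form common to all bracketings; the tail [u] makes it definable by
    recursion on [t]. *)
Fixpoint graft (t u : tree) : tree :=
  match t with Lf i => Nd (Lf i) u | Nd l r => graft l (graft r u) end.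

Lemma labels_graft t u : labels (graft t u) = labels t ++ labels u.
Proof. by elim: t u => [i|l IHl r IHr] u //=; rewrite IHl IHr catA. Qed.

Lemma graft_step m t t' u : step m t t' -> graft t' u = graft t u.
Proof.
move=> h; elim: h u => [|{}t {}t' v _ IH|{}t {}t' v _ IH] u /=; last by rewrite IH.
  by case: m => [[[[] r] s] t0].
by rewrite IH.
Qed.

Lemma labels_run p t t' : run p t = Some t' -> labels t' = labels t.
Proof.
elim: p t => [|m p IH] t /=; first by case=> ->.
by case e: (rewr _ _ t) => [t1|] // /IH->; apply: labels_step (rewr_step e).
Qed.

(** Commuting copies of H in an algebra, one for each natural number. Besides tensor powers, the
    copies obtained by replacing strands with iterated coproducts along disjoint trees are of this
    kind; substitution then is an instance of the universal property. *)
Record strands (k : fieldType) (H T : algType k) := Strands {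
  io :> nat -> H -> T;
  io_lin : forall i, lin (io i);
  io1 : forall i, io i 1 = 1;
  ioM : forall i x y, io i (x * y) = io i x * io i y;
  ioC : forall i j x y, i != j -> io i x * io j y = io j y * io i x
}.

Lemma lin_io (k : fieldType) (H T : algType k) (I : strands H T) i
    (U : lmodType k) (f : U -> H) : lin f -> lin (fun x => I i (f x)).
Proof. by move=> hf a x y; rewrite hf io_lin. Qed.

Section Engine.
Variables (k : fieldType) (H T : algType k) (Q : quasiHopf H).
Variable I : strands H T.

Local Notation Δ := (qDelta Q).
Local Notation Φ := (qPhi Q).
Local Notation Φi := (qPhi_inv Q).
Implicit Types (h : H) (t : tree) (y z : T).

(** The iterated coproduct of [h] bracketed by [t], each component placed on the strand named by its
    leaf. *)
Fixpoint cop t h : T :=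
  match t with
  | Lf i => I i h
  | Nd l r => \sw[h1, h2 <- Δ h] (cop l h1 * cop r h2)
  end.

Lemma cop_lin t : lin (cop t).
Proof.
elim: t => [i|l IHl r IHr] /=; first exact: io_lin.
apply: lin_tsumx; last by lin_tac.
apply: bilinP => u; [apply: lin_mull|apply: lin_mulr]; done.
Qed.

Lemma lin_cop t (U : lmodType k) (f : U -> H) : lin f -> lin (fun x => cop t (f x)).
Proof. by move=> hf a x y; rewrite hf cop_lin. Qed.

Ltac lin_ext ::= first [apply: lin_io; lin_tac | apply: lin_cop; lin_tac].

Definition phi3 r s t (x : H ⊗ H ⊗ H) : T :=
  \sw[a, b, c <- x] (cop r a * cop s b * cop t c).

Lemma bilin_phi3 r s t :
  bilin (fun a x => \sw[b, c <- x] (cop r a * cop s b * cop t c)).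
Proof. lin_tac. Qed.

Lemma phi3_lin r s t : lin (phi3 r s t).
Proof. exact: (tsum_linear (bilin_phi3 r s t)). Qed.

Lemma phi3E r s t a b c : phi3 r s t (a ⊗ b ⊗ c) = cop r a * cop s b * cop t c.
Proof. by rewrite /phi3 tsumE ?tsumE //; lin_tac. Qed.

Definition cm (L : seq nat) y := forall i h, i \in L -> I i h * y = y * I i h.

Lemma cm_mul L y z : cm L y -> cm L z -> cm L (y * z).
Proof. by move=> hy hz i h hi; rewrite mulrA hy // -mulrA hz // mulrA. Qed.

Lemma cm1 L : cm L 1.
Proof. by move=> i h _; rewrite mulr1 mul1r. Qed.

Lemma cm_tsum (U V : lmodType k) L (x : U ⊗ V) F :
  (forall u v, cm L (F u v)) -> cm L (tsum x F).
Proof.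
move=> hF i h hi; rewrite /tsum mulr_sumr mulr_suml.
by apply: eq_bigr => p _; apply: hF.
Qed.

Lemma cm_cat L1 L2 y : cm (L1 ++ L2) y <-> cm L1 y /\ cm L2 y.
Proof.
split=> [h|[h1 h2] i x]; last by rewrite mem_cat => /orP[/h1|/h2]; apply.
by split=> i x hi; apply: h; rewrite mem_cat hi ?orbT.
Qed.

Lemma cm_sub L1 L2 y : {subset L1 <= L2} -> cm L2 y -> cm L1 y.
Proof. by move=> s h i x /s; apply: h. Qed.

Lemma cop_cm t y : cm (labels t) y -> forall h, cop t h * y = y * cop t h.
Proof.
elim: t => [i|l IHl r IHr] /=; first by move=> hy h; apply: hy; rewrite inE.
case/cm_cat=> hl hr h; rewrite /tsum mulr_suml mulr_sumr.
by apply: eq_bigr => p _; rewrite -mulrA IHr // mulrA IHl // mulrA.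
Qed.

Definition disj (L1 L2 : seq nat) := ~~ has (mem L1) L2.

Lemma disjC L1 L2 : disj L1 L2 = disj L2 L1.
Proof. by rewrite /disj has_sym. Qed.

Lemma disj_cat L1 L2 L3 : disj L1 (L2 ++ L3) = disj L1 L2 && disj L1 L3.
Proof. by rewrite /disj has_cat negb_or. Qed.

Lemma disj_subl L1 L2 L3 : {subset L1 <= L2} -> disj L2 L3 -> disj L1 L3.
Proof.
move=> s /hasPn h; apply/hasPn => i /h; apply: contraNN; exact: s.
Qed.

Lemma cm_cop L t h : disj L (labels t) -> cm L (cop t h).
Proof.
elim: t h => [j|l IHl r IHr] h /=.
  rewrite /disj /= orbF => hj i x hi; apply: ioC.
  by apply: contraNneq hj => <-.
rewrite disj_cat => /andP[hl hr]; apply: cm_tsum => u v.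
by apply: cm_mul; [apply: IHl | apply: IHr].
Qed.

Lemma cm_phi3 L r s t x :
  disj L (labels r ++ labels s ++ labels t) -> cm L (phi3 r s t x).
Proof.
rewrite !disj_cat => /and3P[hr hs ht]; apply: cm_tsum => a y; apply: cm_tsum => b c.
by do !apply: cm_mul; apply: cm_cop.
Qed.

Lemma cop_comm s t h h' : disj (labels s) (labels t) ->
  cop s h * cop t h' = cop t h' * cop s h.
Proof. by move=> d; apply: cop_cm; apply: cm_cop. Qed.

Lemma cop1 t : cop t 1 = 1.
Proof.
elim: t => [i|l IHl r IHr] /=; first exact: io1.
by rewrite rmorph1 tsumE ?IHl ?IHr ?mulr1 //; lin_tac.
Qed.

(** Distinct leaves are essential: a component of [h] on the right subtree has to pass a component
    of [h'] on the left one. *)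
Lemma copM t h h' : uniq (labels t) -> cop t (h * h') = cop t h * cop t h'.
Proof.
elim: t h h' => [i|l IHl r IHr] h h' /=; first by rewrite ioM.
rewrite cat_uniq => /and3P[ul d ur].
rewrite rmorphM tsum_mul; last by lin_tac.
rewrite [in RHS]/tsum mulr_suml; apply: eq_bigr => p _.
rewrite mulr_sumr; apply: eq_bigr => q _.
rewrite IHl // IHr // !mulrA; congr (_ * _); rewrite -!mulrA; congr (_ * _).
by rewrite cop_comm.
Qed.

Definition udisj3 r s t := uniq (labels r ++ labels s ++ labels t).

Lemma udisj3P r s t : udisj3 r s t ->
  [/\ uniq (labels r), uniq (labels s), uniq (labels t) &
   [/\ disj (labels r) (labels s), disj (labels r) (labels t) &
       disj (labels s) (labels t)]].
Proof.
rewrite /udisj3 !cat_uniq -/(disj _ _) disj_cat => /and3P[ur /andP[d1 d2]].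
by case/and3P=> us d3 ut; split.
Qed.

Lemma commCA (x y z : T) : x * y = y * x -> x * (y * z) = y * (x * z).
Proof. by move=> e; rewrite mulrA e mulrA. Qed.

Lemma phi3M r s t (x y : H ⊗ H ⊗ H) : udisj3 r s t ->
  phi3 r s t (x * y) = phi3 r s t x * phi3 r s t y.
Proof.
case/udisj3P=> ur us ut [rs rt st].
have lM (z : H ⊗ H ⊗ H) : lin (fun x : H ⊗ H ⊗ H => phi3 r s t (x * z)).
  by move=> a u v; rewrite mulrDl -scalerAl phi3_lin.
have lM' (z : H ⊗ H ⊗ H) : lin (fun x : H ⊗ H ⊗ H => phi3 r s t (z * x)).
  by move=> a u v; rewrite mulrDr -scalerAr phi3_lin.
move: x; apply: tens3_eq_lin => // [|a b c].
  by apply: lin_mull; apply: phi3_lin.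
move: y; apply: tens3_eq_lin => // [|a' b' c'].
  by apply: lin_mulr; apply: phi3_lin.
rewrite !tensM !phi3E !copM // -!mulrA; congr (_ * _).
rewrite (commCA _ (esym (cop_comm a' c rt))) (commCA _ (esym (cop_comm a' b rs))).
by rewrite (commCA _ (esym (cop_comm b' c st))).
Qed.

Lemma phi3_tsum r s t (U V : lmodType k) (x : U ⊗ V) F :
  phi3 r s t (tsum x F) = tsum x (fun a b => phi3 r s t (F a b)).
Proof. by rewrite (lin_push _ _ (phi3_lin r s t)). Qed.

Lemma phi3_1 r s t : phi3 r s t 1 = 1.
Proof. by rewrite [1]/((1 : H) ⊗ (1 : H) ⊗ (1 : H)) phi3E !cop1 !mulr1. Qed.

Definition phi4 q r s t (x : H ⊗ H ⊗ H ⊗ H) : T :=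
  \sw[a, y <- x] (cop q a * phi3 r s t y).

Lemma lin_phi3 r s t (U : lmodType k) (f : U -> H ⊗ H ⊗ H) :
  lin f -> lin (fun x => phi3 r s t (f x)).
Proof. by move=> hf a x y; rewrite hf phi3_lin. Qed.

Lemma phi4_lin q r s t : lin (phi4 q r s t).
Proof.
apply: lin_tsumx; last by lin_tac.
by apply: bilinP => ?; [apply: lin_mull|apply: lin_mulr; apply: lin_phi3]; lin_tac.
Qed.

Lemma phi4_tsum q r s t (U V : lmodType k) (x : U ⊗ V) F :
  phi4 q r s t (tsum x F) = tsum x (fun a b => phi4 q r s t (F a b)).
Proof. by rewrite (lin_push _ _ (phi4_lin q r s t)). Qed.

Lemma bilin_phi4 q r s t : bilin (fun (a : H) (y : H ⊗ H ⊗ H) => cop q a * phi3 r s t y).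
Proof.
by apply: bilinP => ?; [apply: lin_mull|apply: lin_mulr; apply: lin_phi3]; lin_tac.
Qed.

Lemma phi4E q r s t a b c d :
  phi4 q r s t (a ⊗ b ⊗ c ⊗ d) = cop q a * cop r b * cop s c * cop t d.
Proof. by rewrite /phi4 tsumE ?phi3E -?mulrA //; apply: bilin_phi4. Qed.

Lemma phi4M q r s t (x y : H ⊗ H ⊗ H ⊗ H) :
  uniq (labels q ++ labels r ++ labels s ++ labels t) ->
  phi4 q r s t (x * y) = phi4 q r s t x * phi4 q r s t y.
Proof.
rewrite cat_uniq -/(disj _ _) => /and3P[uq d u3].
rewrite /phi4 tsum_mul; last exact: bilin_phi4.
rewrite [in RHS]/tsum mulr_suml; apply: eq_bigr => p _.
rewrite mulr_sumr; apply: eq_bigr => p' _.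
rewrite copM // phi3M // -!mulrA; congr (_ * _); apply: commCA.
by apply: cop_cm; apply: cm_phi3.
Qed.

Definition el (m : move) : T :=
  let: (b, r, s, t) := m in phi3 r s t (if b then Φ else Φi).

Lemma elV b r s t : udisj3 r s t -> el (b, r, s, t) * el (~~ b, r, s, t) = 1.
Proof.
move=> u; rewrite /el -phi3M //.
by case: b => /=; rewrite ?(qPhi_mulV Q) ?(qPhi_Vmul Q) phi3_1.
Qed.

Lemma mlabels_udisj m : uniq (mlabels m) -> let: (b, r, s, t) := m in udisj3 r s t.
Proof. by case: m => [[[[] r] s] t]; rewrite /mlabels /udisj3 /= ?catA. Qed.

Lemma cm_el L m : disj L (mlabels m) -> cm L (el m).
Proof.
case: m => [[[b r] s] t] h; apply: cm_phi3.
by case: b h; rewrite /mlabels /= -?catA.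
Qed.

(** Quasi-coassociativity, comultiplied further along [r], [s] and [t]: the associator intertwines
    the coproducts of its source and target bracketings. *)
Lemma nat_el_here r s t h : udisj3 r s t ->
  cop (Nd r (Nd s t)) h * phi3 r s t Φ = phi3 r s t Φ * cop (Nd (Nd r s) t) h.
Proof.
move=> u.
have -> : cop (Nd r (Nd s t)) h = phi3 r s t (\sw[h1, h2 <- Δ h] (h1 ⊗ Δ h2)).
  rewrite /phi3 tsum_tsum /=; last exact: bilin_phi3.
  apply: eq_tsum => a b; rewrite tsumE; last exact: bilin_phi3.
  rewrite /tsum mulr_sumr; apply: eq_bigr => p _; rewrite mulrA //.
have -> : cop (Nd (Nd r s) t) h =
    phi3 r s t (\sw[h1, h2 <- Δ h] \sw[h11, h12 <- Δ h1] (h11 ⊗ h12 ⊗ h2)).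
  rewrite phi3_tsum; apply: eq_tsum => a b; rewrite phi3_tsum /= /tsum mulr_suml.
  by apply: eq_bigr => p _; rewrite phi3E.
rewrite -!phi3M // (qcoassoc Q) -mulrA -mulrA; congr (phi3 _ _ _ (_ * _)).
by rewrite (qPhi_Vmul Q) mulr1.
Qed.

Lemma phi3_nat1 r r' s t z x :
  (forall h, cop r' h * z = z * cop r h) -> cm (labels s ++ labels t) z ->
  phi3 r' s t x * z = z * phi3 r s t x.
Proof.
move=> hr /cm_cat[hs ht].
rewrite /phi3 /tsum mulr_suml mulr_sumr; apply: eq_bigr => p _.
rewrite mulr_suml mulr_sumr; apply: eq_bigr => p' _.
by rewrite -mulrA (cop_cm ht) mulrA -[_ * z]mulrA (cop_cm hs) 2!mulrA hr -!mulrA.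
Qed.

Lemma phi3_nat2 r s s' t z x :
  (forall h, cop s' h * z = z * cop s h) -> cm (labels r ++ labels t) z ->
  phi3 r s' t x * z = z * phi3 r s t x.
Proof.
move=> hs /cm_cat[hr ht].
rewrite /phi3 /tsum mulr_suml mulr_sumr; apply: eq_bigr => p _.
rewrite mulr_suml mulr_sumr; apply: eq_bigr => p' _.
by rewrite -mulrA (cop_cm ht) mulrA -[_ * z]mulrA hs mulrA (cop_cm hr) -!mulrA.
Qed.

Lemma phi3_nat3 r s t t' z x :
  (forall h, cop t' h * z = z * cop t h) -> cm (labels r ++ labels s) z ->
  phi3 r s t' x * z = z * phi3 r s t x.
Proof.
move=> ht /cm_cat[hr hs].
rewrite /phi3 /tsum mulr_suml mulr_sumr; apply: eq_bigr => p _.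
rewrite mulr_suml mulr_sumr; apply: eq_bigr => p' _.
by rewrite -mulrA ht mulrA -[_ * z]mulrA (cop_cm hs) mulrA (cop_cm hr) -!mulrA.
Qed.

Lemma nat_Ndl l l' r z h :
  (forall h, cop l' h * z = z * cop l h) -> cm (labels r) z ->
  cop (Nd l' r) h * z = z * cop (Nd l r) h.
Proof.
move=> hl hr /=; rewrite /tsum mulr_suml mulr_sumr; apply: eq_bigr => p _.
by rewrite -mulrA (cop_cm hr) mulrA hl mulrA.
Qed.

Lemma nat_Ndr l r r' z h :
  (forall h, cop r' h * z = z * cop r h) -> cm (labels l) z ->
  cop (Nd l r') h * z = z * cop (Nd l r) h.
Proof.
move=> hr hl /=; rewrite /tsum mulr_suml mulr_sumr; apply: eq_bigr => p _.
by rewrite -mulrA hr mulrA (cop_cm hl) mulrA.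
Qed.

(** Inside a larger tree, the strands of the other subtree are disjoint from those of the move, so
    its components commute with the associator. A backward move at the root follows from the forward
    one by cancellation. *)
Lemma nat_el m t t' h : step m t t' -> uniq (labels t) ->
  cop t' h * el m = el m * cop t h.
Proof.
move=> st; elim: st h => [|{}t {}t' u sm IH|{}t {}t' u sm IH] h.
- move=> um; have := mlabels_udisj um.
  case: m um => [[[[] r] s] t0] um u; first exact: nat_el_here.
  have e1 : el (true, r, s, t0) * el (false, r, s, t0) = 1 by apply: (elV true).
  have e2 : el (false, r, s, t0) * el (true, r, s, t0) = 1 by apply: (elV false).
  rewrite -[LHS]mul1r -e2 -mulrA; congr (_ * _).
  by rewrite mulrA -nat_el_here // -mulrA e1 mulr1.
- rewrite /= cat_uniq -/(disj _ _) => /and3P[ut d _].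
  apply: nat_Ndl => [h'|]; first exact: IH.
  apply: cm_el; rewrite disjC; apply: disj_subl d; exact: mlabels_step sm.
- rewrite /= cat_uniq -/(disj _ _) disjC => /and3P[_ d ut].
  apply: nat_Ndr => [h'|]; first exact: IH.
  apply: cm_el; rewrite disjC; apply: disj_subl d; exact: mlabels_step sm.
Qed.

Lemma phi4_pad r s t u (x : H ⊗ H ⊗ H) :
  phi4 r s t u (\sw[X1, X2, X3 <- x] (X1 ⊗ X2 ⊗ X3 ⊗ 1)) = phi3 r s t x.
Proof.
rewrite phi4_tsum; apply: eq_tsum => a y; rewrite phi4_tsum; apply: eq_tsum => b c.
by rewrite phi4E cop1 mulr1.
Qed.

Lemma phi4_cop r s t u (x : H ⊗ H ⊗ H) :
  phi4 r s t u (\sw[X1, X2, X3 <- x] \sw[Y1, Y2 <- Δ X1] (Y1 ⊗ Y2 ⊗ X2 ⊗ X3)) =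
  phi3 (Nd r s) t u x.
Proof.
rewrite phi4_tsum; apply: eq_tsum => a y; rewrite phi4_tsum; apply: eq_tsum => b c.
rewrite phi4_tsum /= /tsum !mulr_suml; apply: eq_bigr => p _.
by rewrite phi4E.
Qed.

(** For distinct leaves [phi4 r s t u] is multiplicative, so it carries the pentagon of the fourfold
    tensor power over to arbitrary letters, one factor to the associator of one move. *)
Lemma pentagon r s t u :
  uniq (labels r ++ labels s ++ labels t ++ labels u) ->
  el (true, s, t, u) * el (true, r, Nd s t, u) * el (true, r, s, t) =
  el (true, r, s, Nd t u) * el (true, Nd r s, t, u).
Proof.
move=> un; rewrite /el.
have := congr1 (phi4 r s t u) (qpentagon Q).
rewrite !phi4M // => e.
have e1 : phi4 r s t u (1 ⊗ Φ) = phi3 s t u Φ.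
  by rewrite /phi4 tsumE ?cop1 ?mul1r //; apply: bilin_phi4.
have e2 : phi4 r s t u (\sw[X1, X2, X3 <- Φ] \sw[Y1, Y2 <- Δ X2]
    (X1 ⊗ Y1 ⊗ Y2 ⊗ X3)) = phi3 r (Nd s t) u Φ.
  rewrite phi4_tsum; apply: eq_tsum => a x; rewrite phi4_tsum; apply: eq_tsum => b c.
  rewrite phi4_tsum /= /tsum mulr_sumr mulr_suml; apply: eq_bigr => p _.
  by rewrite phi4E !mulrA.
have e4 : phi4 r s t u (\sw[X1, X2, X3 <- Φ] (X1 ⊗ X2 ⊗ Δ X3)) =
    phi3 r s (Nd t u) Φ.
  rewrite phi4_tsum; apply: eq_tsum => a x; rewrite phi4_tsum; apply: eq_tsum => b c.
  rewrite /phi4 tsumE; last exact: bilin_phi4.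
  rewrite /phi3 tsumE; last exact: bilin_phi3.
  rewrite /= /tsum !mulr_sumr; apply: eq_bigr => p _.
  by rewrite !mulrA.
by rewrite -e1 -e2 -e4 -(phi4_pad r s t u) -(phi4_cop r s t u).
Qed.

(* The path from (t u) to [graft t u]; by [nel_step] a step out of t can be
   prepended to it, which forces coherence. *)
Fixpoint nel t u : T :=
  if t is Nd l r then nel l (graft r u) * nel r u * el (true, l, r, u) else 1.

Lemma cm_nel L t u : disj L (labels t ++ labels u) -> cm L (nel t u).
Proof.
elim: t u => [i|l IHl r IHr] u /=; first by move=> _; apply: cm1.
rewrite -catA disj_cat => /andP[hl hru].
apply: cm_mul; last by apply: (@cm_el _ (true, l, r, u)); rewrite /mlabels /= -catA disj_cat hl.
by apply: cm_mul; [apply: IHl; rewrite labels_graft disj_cat hl | apply: IHr].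
Qed.

Lemma phi3_cm r s t x z : cm (labels r ++ labels s ++ labels t) z ->
  phi3 r s t x * z = z * phi3 r s t x.
Proof. by case/cm_cat=> hr hst; apply: phi3_nat1 => // h; apply: cop_cm. Qed.

Lemma nel_cm t u z : cm (labels t ++ labels u) z -> nel t u * z = z * nel t u.
Proof.
elim: t u => [i|l IHl r IHr] u /=; first by rewrite mulr1 mul1r.
rewrite -catA => h; have [hl hru] := (cm_cat _ _ _).1 h.
rewrite -mulrA phi3_cm // mulrA -[_ * z]mulrA IHr // mulrA IHl ?mulrA //.
by rewrite labels_graft.
Qed.

(** This is what lets the path of the third letter cross an associator in [nel_step]. *)
Lemma nel_nat t u h : uniq (labels t ++ labels u) ->
  cop (graft t u) h * nel t u = nel t u * cop (Nd t u) h.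
Proof.
elim: t u h => [i|l IHl r IHr] u h; first by rewrite mulr1 mul1r.
rewrite [labels _]/= -catA => un; have := un.
rewrite cat_uniq -/(disj _ _) => /and3P[ul d uru].
rewrite [nel _ _]/= [graft _ _]/= !mulrA IHl ?labels_graft //.
rewrite -[_ * cop _ _ * _]mulrA (nat_Ndr _ (IHr u ^~ uru)); last first.
  exact: cm_nel.
rewrite -[in RHS]mulrA -(nat_el (m := (true, l, r, u)) (t' := Nd l (Nd r u))) //.
- by rewrite !mulrA.
- exact: StepHere (true, l, r, u).
- by rewrite /= -catA.
Qed.

Lemma nel_inv t u : uniq (labels t ++ labels u) -> exists z, z * nel t u = 1.
Proof.
elim: t u => [i|l IHl r IHr] u; first by exists 1; rewrite mul1r.
rewrite [labels _]/= -catA => un; have := un.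
rewrite cat_uniq -/(disj _ _) => /and3P[ul d uru].
have [z1 h1] : exists z, z * nel l (graft r u) = 1 by apply: IHl; rewrite labels_graft.
have [z2 h2] := IHr u uru.
exists (el (false, l, r, u) * z2 * z1).
rewrite [nel _ _]/= -mulrA -mulrA [z1 * _]mulrA [z1 * _]mulrA h1 mul1r.
by rewrite [z2 * _]mulrA h2 mul1r; apply: (elV false).
Qed.

(** At the root this is the pentagon, once [nel t0 u] has crossed an associator by naturality; a
    backward move follows by cancellation. Below the root the move passes the other factors by
    naturality or disjointness until the induction hypothesis applies; on the right it also uses
    that [graft] does not see the move. *)
Lemma nel_step m t t' u : step m t t' -> uniq (labels t ++ labels u) ->
  nel t' u * el m = nel t u.
Proof.
move=> st; elim: st u => [|{}t {}t' v sm IH|{}t {}t' v sm IH] u.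
- have fwd r s t0 : uniq (labels r ++ labels s ++ labels t0 ++ labels u) ->
      nel (Nd r (Nd s t0)) u * el (true, r, s, t0) = nel (Nd (Nd r s) t0) u.
    move=> un; have := un; rewrite catA cat_uniq -/(disj _ _) => /and3P[_ d utu].
    have nat3 : nel t0 u * el (true, r, s, Nd t0 u) =
        el (true, r, s, graft t0 u) * nel t0 u.
      rewrite /el (phi3_nat3 (t := Nd t0 u) (z := nel t0 u)) // => [h|].
        exact: nel_nat.
      exact: cm_nel.
    rewrite [nel (Nd r _) u]/= [nel (Nd (Nd r s) _) u]/= -!mulrA; congr (_ * _).
    have := pentagon un; rewrite -!mulrA => ->.
    by congr (_ * _); rewrite mulrA nat3 -mulrA.
  case: m => [[[[] r] s] t0]; rewrite /msrc /mdst => un.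
    by apply: fwd; rewrite /= -!catA in un.
  have {}un : uniq (labels r ++ labels s ++ labels t0 ++ labels u).
    by rewrite /= -!catA in un.
  rewrite -fwd // -mulrA (elV true) ?mulr1 // /udisj3.
  by move: un; rewrite !catA cat_uniq -!catA => /andP[].
- rewrite [labels _]/= -catA => un; have := un.
  rewrite cat_uniq -/(disj _ _) => /and3P[ut d uvu].
  have dm : disj (labels v ++ labels u) (mlabels m).
    by rewrite disjC; apply: disj_subl d; apply: mlabels_step sm.
  have nat1 : el (true, t', v, u) * el m = el m * el (true, t, v, u).
    rewrite /= (phi3_nat1 (r := t) (z := el m)) // => [h|].
      exact: nat_el.
    exact: cm_el.
  have c : nel v u * el m = el m * nel v u.
    by apply: nel_cm; apply: cm_el.
  rewrite [LHS]/= -!mulrA nat1 [nel v u * _]mulrA c [RHS]/= -(IH (graft v u)).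
    by rewrite !mulrA.
  by rewrite labels_graft.
- rewrite [labels _]/= -catA => un; have := un.
  rewrite cat_uniq -/(disj _ _) disj_cat => /and3P[uv /andP[d d'] utu].
  have := utu; rewrite cat_uniq -/(disj _ _) => /and3P[ut du _].
  have nat2 : el (true, v, t', u) * el m = el m * el (true, v, t, u).
    rewrite /= (phi3_nat2 (s := t) (z := el m)) // => [h|].
      exact: nat_el.
    have ss := mlabels_step sm.
    apply: cm_el; rewrite disjC disj_cat (disj_subl ss du) andbT.
    by apply: disj_subl ss _; rewrite disjC.
  by rewrite [LHS]/= -!mulrA nat2 (graft_step u sm) [nel t' u * _]mulrA IH // mulrA.
Qed.

Fixpoint pel (p : seq move) : T := if p is m :: p' then pel p' * el m else 1.

Lemma run_nel p t t' u : run p t = Some t' -> uniq (labels t ++ labels u) ->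
  nel t' u * pel p = nel t u.
Proof.
elim: p t => [|m p IH] t /=; first by case=> ->; rewrite mulr1.
case e: (rewr _ _ t) => [t1|] // hr un; have st := rewr_step e.
by rewrite mulrA (IH t1) ?(nel_step st) // (labels_step st).
Qed.

(** Continued to the comb, both paths become the canonical path of [t]; their common last part has a
    left inverse and can be cancelled. *)
Theorem coherence p q t t' :
  uniq (labels t) -> run p t = Some t' -> run q t = Some t' -> pel p = pel q.
Proof.
move=> un hp hq.
(* A leaf absent from [t], serving as the tail of the comb. Such a strand always exists, as
   [strands] provides a copy of H at every index. *)
pose z := (\max_(i <- labels t) i).+1.
have hz : uniq (labels t ++ labels (Lf z)).
  rewrite cat_uniq un /= orbF andbT; apply/negP => hzt.
  by have := @leq_bigmax_seq _ _ xpredT (fun i => i) _ hzt isT; rewrite /z ltnn.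
have hz' : uniq (labels t' ++ labels (Lf z)).
  by rewrite (labels_run hp).
have [y hy] := nel_inv hz'.
by rewrite -[LHS]mul1r -hy -mulrA (run_nel hp hz) -(run_nel hq hz) mulrA hy mul1r.
Qed.

Lemma nat_pel p t t' h : run p t = Some t' -> uniq (labels t) ->
  cop t' h * pel p = pel p * cop t h.
Proof.
elim: p t => [|m p IH] t /=; first by case=> ->; rewrite mulr1 mul1r.
case e: (rewr _ _ t) => [t1|] // hr un; have st := rewr_step e.
rewrite mulrA (IH t1) // ?(labels_step st) //.
by rewrite -!mulrA (nat_el _ st).
Qed.

End Engine.

(** * Absorbed strands *)

Section PhiInv.
Variables (k : fieldType) (H : algType k) (Q : quasiHopf H).
Local Notation ε := (qeps Q).
Local Notation Φ := (qPhi Q).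
Local Notation Φi := (qPhi_inv Q).

(** Multiplicativity extends from pure tensors to all of H ⊗ H ⊗ H; then f(Φ^-1) = f(Φ) f(Φ^-1) =
    f(1). It yields the counit normalisations of Φ^-1 from those of Φ. *)
Lemma unit_transport (B : algType k) (f : H ⊗ H ⊗ H -> B) : lin f ->
  (forall a b c a' b' c', f ((a ⊗ b ⊗ c) * (a' ⊗ b' ⊗ c')) =
     f (a ⊗ b ⊗ c) * f (a' ⊗ b' ⊗ c')) ->
  f 1 = 1 -> f Φ = 1 -> f Φi = 1.
Proof.
move=> hf fM f1 fP.
have {}fM (x y : H ⊗ H ⊗ H) : f (x * y) = f x * f y.
  move: x; apply: tens3_eq_lin => [a u v||a b c].
  - by rewrite mulrDl -scalerAl hf.
  - by apply: lin_mull.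
  move: y; apply: tens3_eq_lin => [r u v||a' b' c'] //.
  - by rewrite mulrDr -scalerAr hf.
  - by apply: lin_mulr.
by rewrite -[LHS]mul1r -{1}fP -fM (qPhi_mulV Q) f1.
Qed.

Lemma qPhi_inv_eps1 : \sw[X1, X2, X3 <- Φi] ε X1 *: (X2 ⊗ X3) = 1 :> H ⊗ H.
Proof.
have bil : bilin (fun (X1 : H) (t : H ⊗ H) => \sw[X2, X3 <- t] ε X1 *: (X2 ⊗ X3)).
  by lin_tac.
have E (a b c : H) : \sw[X1, X2, X3 <- a ⊗ b ⊗ c] ε X1 *: (X2 ⊗ X3) = ε a *: (b ⊗ c).
  by rewrite (tsumE bil) tsumE //; lin_tac.
apply: (unit_transport (f := fun x => \sw[X1, X2, X3 <- x] ε X1 *: (X2 ⊗ X3))).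
- exact: tsum_linear.
- move=> a b c a' b' c'.
  by rewrite !tensM !E rmorphM -scalerAl -scalerAr scalerA tensM.
- by rewrite E rmorph1 scale1r.
- exact: qPhi_eps1.
Qed.

Lemma qPhi_inv_eps2 : \sw[X1, X2, X3 <- Φi] ε X2 *: (X1 ⊗ X3) = 1 :> H ⊗ H.
Proof.
have bil : bilin (fun (X1 : H) (t : H ⊗ H) => \sw[X2, X3 <- t] ε X2 *: (X1 ⊗ X3)).
  by lin_tac.
have E (a b c : H) : \sw[X1, X2, X3 <- a ⊗ b ⊗ c] ε X2 *: (X1 ⊗ X3) = ε b *: (a ⊗ c).
  by rewrite (tsumE bil) tsumE //; lin_tac.
apply: (unit_transport (f := fun x => \sw[X1, X2, X3 <- x] ε X2 *: (X1 ⊗ X3))).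
- exact: tsum_linear.
- move=> a b c a' b' c'.
  by rewrite !tensM !E rmorphM -scalerAl -scalerAr scalerA tensM.
- by rewrite E rmorph1 scale1r.
- exact: qPhi_eps2.
Qed.

Lemma qPhi_inv_eps3 : \sw[X1, X2, X3 <- Φi] ε X3 *: (X1 ⊗ X2) = 1 :> H ⊗ H.
Proof.
have bil : bilin (fun (X1 : H) (t : H ⊗ H) => \sw[X2, X3 <- t] ε X3 *: (X1 ⊗ X2)).
  by lin_tac.
have E (a b c : H) : \sw[X1, X2, X3 <- a ⊗ b ⊗ c] ε X3 *: (X1 ⊗ X2) = ε c *: (a ⊗ b).
  by rewrite (tsumE bil) tsumE //; lin_tac.
apply: (unit_transport (f := fun x => \sw[X1, X2, X3 <- x] ε X3 *: (X1 ⊗ X2))).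
- exact: tsum_linear.
- move=> a b c a' b' c'.
  by rewrite !tensM !E rmorphM -scalerAl -scalerAr scalerA tensM.
- by rewrite E rmorph1 scale1r.
- exact: qPhi_eps3.
Qed.

End PhiInv.

Section Absorb.
Variables (k : fieldType) (H T : algType k) (Q : quasiHopf H) (I : strands H T).
Variables (W : lmodType k) (Psi : T -> W).
Hypothesis (linPsi : lin Psi).

Local Notation ε := (qeps Q).
Local Notation cop := (cop Q I).

Ltac lin_ext ::= first
  [ apply: lin_io; lin_tac | apply: lin_cop; lin_tac | apply: (lin_comp linPsi); lin_tac ].

(** An α-pair absorbs a coproduct at the left end of the product, a β-pair at the right end, because
    S reverses products. The boolean treats both at once. *)
Definition side (b : bool) (x y : T) := if b then x * y else y * x.

Lemma sideM b x z y : x * z = z * x -> side b (x * z) y = side b x (side b z y).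
Proof. by case: b => e; rewrite /side; [rewrite mulrA|rewrite e mulrA]. Qed.

Lemma sideC b x z y : x * z = z * x -> side b x (side b z y) = side b z (side b x y).
Proof. by move=> e; rewrite -!sideM // e. Qed.

Lemma side_tsum b (U V : lmodType k) (x : U ⊗ V) (F : U -> V -> T) y :
  side b (tsum x F) y = tsum x (fun u v => side b (F u v) y).
Proof. by case: b; rewrite /side /tsum ?mulr_suml ?mulr_sumr. Qed.

Lemma lin_side b y : lin (fun x => side b x y).
Proof. by case: b; rewrite /side; lin_tac. Qed.

Lemma Psi_tsum (U V : lmodType k) (x : U ⊗ V) (F : U -> V -> T) :
  Psi (tsum x F) = tsum x (fun u v => Psi (F u v)).
Proof. exact: lin_push. Qed.

(* The typical u is a pair of strands that Psi evaluates against each other,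
   through alpha if b = true and through beta if b = false. *)
Definition absorb b u := forall h y, Psi (side b (cop u h) y) = ε h *: Psi y.

(** The trees [t] and [t'] are interchangeable at the outer end of the argument of [Psi]. In use
    [t'] is [t] with absorbed letters deleted; the inclusion of leaves passes disjointness on from
    [t] to [t']. *)
Definition sim b t t' := {subset labels t' <= labels t} /\
  forall h y, Psi (side b (cop t h) y) = Psi (side b (cop t' h) y).

Lemma sim_refl b t : sim b t t. Proof. by split=> [i|]. Qed.

Lemma sim_absorbed b t t' : sim b t t' -> absorb b t' -> absorb b t.
Proof. by move=> [_ h] ab x y; rewrite h ab. Qed.

Lemma lin_Psi_side b y (U : lmodType k) (f : U -> T) :
  lin f -> lin (fun x => Psi (side b (f x) y)).
Proof. by move=> hf a u v; rewrite hf lin_side linPsi. Qed.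

Lemma sim_unitr b t u : disj (labels t) (labels u) -> absorb b u -> sim b (Nd t u) t.
Proof.
move=> d ab; split=> [i hi|h y]; first by rewrite mem_cat hi.
rewrite /= side_tsum Psi_tsum.
under eq_tsum => h1 h2 do
  rewrite cop_comm // (sideM _ _ (esym (cop_comm _ _ _ _ d))) ab.
rewrite -[in RHS](qcounitr Q h).
rewrite (lin_push _ _ (cop_lin Q I t)) side_tsum Psi_tsum.
by apply: eq_tsum => a c; rewrite (linZ (cop_lin Q I t)) (linZ (lin_side b y)) (linZ linPsi).
Qed.

Lemma sim_unitl b t u : disj (labels u) (labels t) -> absorb b u -> sim b (Nd u t) t.
Proof.
move=> d ab; split=> [i hi|h y]; first by rewrite mem_cat hi orbT.
rewrite /= side_tsum Psi_tsum.
under eq_tsum => h1 h2 do rewrite (sideM _ _ (cop_comm _ _ _ _ d)) ab.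
rewrite -[in RHS](qcounitl Q h).
rewrite (lin_push _ _ (cop_lin Q I t)) side_tsum Psi_tsum.
by apply: eq_tsum => a c; rewrite (linZ (cop_lin Q I t)) (linZ (lin_side b y)) (linZ linPsi).
Qed.

(** The two legs have disjoint strands and commute, so each can be brought to the outer end,
    replaced there, and put back. *)
Lemma sim_Nd b l l' r r' : disj (labels l) (labels r) ->
  sim b l l' -> sim b r r' -> sim b (Nd l r) (Nd l' r').
Proof.
move=> d [sl hl] [sr hr].
have dl : disj (labels l') (labels r) by apply: disj_subl sl _.
have dr : disj (labels l') (labels r') by rewrite disjC; apply: disj_subl sr _; rewrite disjC.
split=> [i|h y] /=.
  by rewrite !mem_cat => /orP[/sl|/sr] ->; rewrite ?orbT.
rewrite !side_tsum !Psi_tsum; apply: eq_tsum => a c.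
rewrite (sideM _ _ (cop_comm _ _ _ _ d)) hl (sideC _ _ (cop_comm _ _ _ _ dl)) hr.
by rewrite (sideC _ _ (esym (cop_comm _ _ _ _ dr))) -(sideM _ _ (cop_comm _ _ _ _ dr)).
Qed.

Lemma sim_phi3 b r r' s s' t t' x y : udisj3 r s t ->
  sim b r r' -> sim b s s' -> sim b t t' ->
  Psi (side b (phi3 Q I r s t x) y) = Psi (side b (phi3 Q I r' s' t' x) y).
Proof.
move=> u3 [sr hr] [ss hs] [st ht].
have [_ _ _ [d1 d2 d3]] := udisj3P u3.
have c1 a c : cop r a * cop s c = cop s c * cop r a by apply: cop_comm.
have drs : disj (labels r') (labels s) by apply: disj_subl sr _.
have drt : disj (labels r') (labels t) by apply: disj_subl sr _.
have dst : disj (labels s') (labels t) by apply: disj_subl ss _.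
have drs' : disj (labels r') (labels s').
  by rewrite disjC; apply: disj_subl ss _; rewrite disjC.
have drt' : disj (labels r') (labels t').
  by rewrite disjC; apply: disj_subl st _; rewrite disjC.
have dst' : disj (labels s') (labels t').
  by rewrite disjC; apply: disj_subl st _; rewrite disjC.
have side3 r0 s0 t0 a c e : disj (labels r0) (labels s0) ->
    disj (labels r0) (labels t0) -> disj (labels s0) (labels t0) ->
    side b (cop r0 a * cop s0 c * cop t0 e) y =
    side b (cop r0 a) (side b (cop s0 c) (side b (cop t0 e) y)).
  move=> da db dc; rewrite -mulrA sideM ?(sideM _ _ (cop_comm _ _ _ _ dc)) //.
  by apply: cop_cm; apply: cm_mul; apply: cm_cop.
rewrite /phi3 !side_tsum !Psi_tsum; apply: eq_tsum => a z.
rewrite !side_tsum !Psi_tsum; apply: eq_tsum => c e.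
rewrite !side3 // hr (sideC _ _ (cop_comm _ _ _ _ drs)) hs.
rewrite (sideC _ _ (cop_comm _ _ _ _ drt)) (sideC _ _ (cop_comm _ _ _ _ dst)) ht.
rewrite (sideC _ _ (esym (cop_comm _ _ _ _ dst'))).
rewrite (sideC _ _ (esym (cop_comm _ _ _ _ drt'))).
by rewrite (sideC _ _ (esym (cop_comm _ _ _ _ drs'))).
Qed.

(** Absorption still works behind a factor that avoids the absorbed strands; associators deeper in a
    path are simplified this way. *)
Lemma absorb_side b u z : absorb b u -> cm I (labels u) z ->
  forall h y, Psi (side b z (side b (cop u h) y)) = ε h *: Psi (side b z y).
Proof. by move=> ab hz h y; rewrite sideC ?ab //; symmetry; apply: cop_cm. Qed.

(** An absorbed letter replaces its leg of Φ or Φ^-1 by the counit, and what is left is 1. The next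
    two lemmas do this for the other legs. *)
Lemma phi3_unit1 b c r s t y : udisj3 r s t -> absorb b r ->
  Psi (side b (el Q I (c, r, s, t)) y) = Psi y.
Proof.
move=> u3 ab; have [_ _ _ [d1 d2 d3]] := udisj3P u3.
rewrite /el; set P := (if c then _ else _).
have P1 : \sw[X1, X2, X3 <- P] ε X1 *: (X2 ⊗ X3) = 1 :> H ⊗ H.
  by rewrite /P; case: (c); [apply: qPhi_eps1 | apply: qPhi_inv_eps1].
pose f (x : H ⊗ H) := Psi (side b (\sw[v, w <- x] (cop s v * cop t w)) y).
have bil : bilin (fun v w => cop s v * cop t w) by lin_tac.
have linf : lin f by apply: lin_Psi_side; apply: (tsum_linear bil).
transitivity (f 1); last first.
  by rewrite /f (tsumE bil) !cop1 mulr1 /side; case: (b); rewrite ?mulr1 ?mul1r.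
rewrite -P1 /phi3 side_tsum Psi_tsum (lin_push _ _ linf); apply: eq_tsum => a z.
rewrite side_tsum Psi_tsum (lin_push _ _ linf); apply: eq_tsum => v w.
rewrite -mulrA sideM ?ab; last by apply: cop_cm; apply: cm_mul; apply: cm_cop.
by rewrite (linZ linf) /f (tsumE bil).
Qed.

Lemma phi3_unit2 b c r s t y : udisj3 r s t -> absorb b s ->
  Psi (side b (el Q I (c, r, s, t)) y) = Psi y.
Proof.
move=> u3 ab; have [_ _ _ [d1 d2 d3]] := udisj3P u3.
rewrite /el; set P := (if c then _ else _).
have P1 : \sw[X1, X2, X3 <- P] ε X2 *: (X1 ⊗ X3) = 1 :> H ⊗ H.
  by rewrite /P; case: (c); [apply: qPhi_eps2 | apply: qPhi_inv_eps2].
pose f (x : H ⊗ H) := Psi (side b (\sw[v, w <- x] (cop r v * cop t w)) y).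
have bil : bilin (fun v w => cop r v * cop t w) by lin_tac.
have linf : lin f by apply: lin_Psi_side; apply: (tsum_linear bil).
transitivity (f 1); last first.
  by rewrite /f (tsumE bil) !cop1 mulr1 /side; case: (b); rewrite ?mulr1 ?mul1r.
rewrite -P1 /phi3 side_tsum Psi_tsum (lin_push _ _ linf); apply: eq_tsum => a z.
rewrite side_tsum Psi_tsum (lin_push _ _ linf); apply: eq_tsum => v w.
rewrite (cop_comm _ _ _ _ d1) -mulrA sideM ?ab; last first.
  by apply: cop_cm; apply: cm_mul; apply: cm_cop; rewrite // disjC.
by rewrite (linZ linf) /f (tsumE bil).
Qed.

Lemma phi3_unit3 b c r s t y : udisj3 r s t -> absorb b t ->
  Psi (side b (el Q I (c, r, s, t)) y) = Psi y.
Proof.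
move=> u3 ab; have [_ _ _ [d1 d2 d3]] := udisj3P u3.
rewrite /el; set P := (if c then _ else _).
have P1 : \sw[X1, X2, X3 <- P] ε X3 *: (X1 ⊗ X2) = 1 :> H ⊗ H.
  by rewrite /P; case: (c); [apply: qPhi_eps3 | apply: qPhi_inv_eps3].
pose f (x : H ⊗ H) := Psi (side b (\sw[v, w <- x] (cop r v * cop s w)) y).
have bil : bilin (fun v w => cop r v * cop s w) by lin_tac.
have linf : lin f by apply: lin_Psi_side; apply: (tsum_linear bil).
transitivity (f 1); last first.
  by rewrite /f (tsumE bil) !cop1 mulr1 /side; case: (b); rewrite ?mulr1 ?mul1r.
rewrite -P1 /phi3 side_tsum Psi_tsum (lin_push _ _ linf); apply: eq_tsum => a z.
rewrite side_tsum Psi_tsum (lin_push _ _ linf); apply: eq_tsum => v w.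
rewrite -(@cop_cm _ _ _ Q I t (cop r a * cop s v)); last first.
  by apply: cm_mul; apply: cm_cop; rewrite disjC.
rewrite sideM ?ab; last by apply: cop_cm; apply: cm_mul; apply: cm_cop; rewrite disjC.
by rewrite (linZ linf) /f (tsumE bil).
Qed.
End Absorb.

(** * Tensor powers *)

Definition scons (X : Type) (x : X) (w : nat -> X) (i : nat) : X :=
  if i is j.+1 then w j else x.

Section TensorPower.
Variables (k : fieldType) (H : algType k) (Q : quasiHopf H).
Local Notation ε := (qeps Q).

Fixpoint tpow_def (n : nat) : algType k :=
  if n is m.+1 then (H ⊗ tpow_def m)%type : algType k else k^o : algType k.

Fixpoint word_def n : (nat -> H) -> tpow_def n :=
  match n return (nat -> H) -> tpow_def n with
  | 0 => fun _ => 1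
  | m.+1 => fun w => w 0 ⊗ word_def m (fun i => w i.+1)
  end.

Lemma tpow_eq_lin_def n (W : lmodType k) (f g : tpow_def n -> W) :
  lin f -> lin g -> (forall w, f (word_def n w) = g (word_def n w)) -> f =1 g.
Proof.
elim: n f g => [|n IH] f g hf hg e t.
  rewrite -[t](_ : t *: (1 : tpow_def 0) = t); last exact: mulr1.
  by rewrite (linZ hf) (linZ hg) (e (fun=> 0)).
move: t; apply: (tens_eq_lin hf hg) => u t.
apply: (IH (fun t => f (u ⊗ t)) (fun t => g (u ⊗ t))) => [||w].
- by apply: (lin_comp hf); lin_tac.
- by apply: (lin_comp hg); lin_tac.
exact: (e (scons u w)).
Qed.

(** Indices from [n] on act through ε. Since ε is an algebra map to k, the axioms of [strands] hold
    at every index, and coherence always finds a fresh strand. *)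
Fixpoint tio_def n (i : nat) (h : H) : tpow_def n :=
  match n return tpow_def n with
  | 0 => ε h
  | m.+1 => if i is j.+1 then 1 ⊗ tio_def m j h else h ⊗ 1
  end.

Lemma tio_lin_def n i : lin (tio_def n i).
Proof.
elim: n i => [|n IH] [|i] /=.
- by move=> a x y; apply: linearP.
- by move=> a x y; apply: linearP.
- by apply: lin_tensl; apply: lin_idf.
- by apply: lin_tensr; apply: IH.
Qed.

Lemma tio1_def n i : tio_def n i 1 = 1.
Proof. by elim: n i => [|n IH] [|i] //=; rewrite ?rmorph1 ?IH. Qed.

Lemma tioM_def n i x y : tio_def n i (x * y) = tio_def n i x * tio_def n i y.
Proof.
elim: n i => [|n IH] [|i] /=; rewrite ?rmorphM //.
  by rewrite tensM mulr1.
by rewrite tensM mulr1 IH.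
Qed.

Lemma tioC_def n i j x y : i != j -> tio_def n i x * tio_def n j y = tio_def n j y * tio_def n i x.
Proof.
elim: n i j => [|n IH] [|i] [|j] //=; try by rewrite [LHS]mulrC.
- by rewrite !tensM !mulr1 !mul1r.
- by rewrite !tensM !mulr1 !mul1r.
- by move=> ij; rewrite !tensM IH.
Qed.

Definition tpow_strands_def n : strands H (tpow_def n) :=
  Strands (@tio_lin_def n) (@tio1_def n) (@tioM_def n) (@tioC_def n).

Lemma word1_def n : word_def n (fun=> 1) = 1.
Proof. by elim: n => //= n ->. Qed.

Definition wmull i (h : H) (w : nat -> H) j := if j == i then h * w j else w j.
Definition wmulr i (h : H) (w : nat -> H) j := if j == i then w j * h else w j.

Lemma tio_word_def n i h w : (i < n)%N -> tio_def n i h * word_def n w = word_def n (wmull i h w).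
Proof.
elim: n i w => [|n IH] [|i] w //= hi; rewrite tensM mul1r ?mulr1 //.
by rewrite IH.
Qed.

Lemma word_tio_def n i h w : (i < n)%N -> word_def n w * tio_def n i h = word_def n (wmulr i h w).
Proof.
elim: n i w => [|n IH] [|i] w //= hi; rewrite tensM mulr1 ?mul1r //.
by rewrite IH.
Qed.

Lemma eq_word_def n w w' : (forall i, (i < n)%N -> w i = w' i) -> word_def n w = word_def n w'.
Proof.
elim: n w w' => [|n IH] w w' e //=; rewrite e //; congr (_ ⊗ _).
by apply: IH => i hi; apply: e.
Qed.

Section Lift.
Variable W : lmodType k.

Fixpoint mlin n (K : (nat -> H) -> W) : Prop :=
  if n is m.+1 then
    (forall w, lin (fun x => K (scons x w))) /\ forall x, mlin m (fun w => K (scons x w))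
  else True.

(** The linear map on the tensor power induced by a multilinear [K]. From position [n] on, [K] is
    fed zeros, whence the [trunc] in [teval_word_def]. *)
Fixpoint teval_def n : ((nat -> H) -> W) -> tpow_def n -> W :=
  match n return ((nat -> H) -> W) -> tpow_def n -> W with
  | 0 => fun K t => (t : k) *: K (fun=> 0)
  | m.+1 => fun K t => tsum t (fun x t' => teval_def (fun w => K (scons x w)) t')
  end.

Lemma eq_teval_def n (K K' : (nat -> H) -> W) t : K =1 K' -> teval_def (n := n) K t = teval_def K' t.
Proof.
elim: n K K' t => [|n IH] K K' t e /=; first by rewrite e.
by apply: eq_tsum => x t'; apply: IH => w; apply: e.
Qed.

Lemma teval_linK_def n (K K' : (nat -> H) -> W) a t :
  teval_def (n := n) (fun w => a *: K w + K' w) t = a *: teval_def K t + teval_def K' t.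
Proof.
elim: n K K' t => [|n IH] K K' t /=.
  by rewrite scalerDr !scalerA [t * a]mulrC.
by rewrite -tsum_linF; apply: eq_tsum => x t'; apply: IH.
Qed.

Lemma teval_lin_def n K : mlin n K -> lin (teval_def (n := n) K).
Proof.
elim: n K => [|n IH] K /=; first by move=> _ a x y; rewrite scalerDl scalerA.
case=> h1 h2; apply: tsum_linear; apply: bilinP => u; last exact: IH.
by move=> a x y; rewrite -teval_linK_def; apply: eq_teval_def => w; apply: h1.
Qed.

Fixpoint trunc n (w : nat -> H) : nat -> H :=
  if n is m.+1 then scons (w 0) (trunc m (fun i => w i.+1)) else fun=> 0.

Lemma teval_word_def n K w : mlin n K -> teval_def K (word_def n w) = K (trunc n w).
Proof.
elim: n K w => [|n IH] K w /=; first by rewrite scale1r.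
move=> [h1 h2]; rewrite tsumE ?IH //.
apply: bilinP => u; last exact: teval_lin_def.
by move=> a x y; rewrite -teval_linK_def; apply: eq_teval_def => w'; apply: h1.
Qed.

End Lift.

Section Embedding.
Variable T : algType k.
Implicit Type J : strands H T.

Definition shift J : strands H T :=
  @Strands k H T (fun i => J i.+1) (fun i => io_lin J i.+1) (fun i => io1 J i.+1)
    (fun i => ioM J i.+1) (fun i j x y ij => ioC J (i := i.+1) (j := j.+1) x y ij).

(** The universal property of the tensor power as an algebra: commuting algebra maps out of H
    multiply to one algebra map. *)
Fixpoint emb_def n J : tpow_def n -> T :=
  match n return tpow_def n -> T with
  | 0 => fun t => (t : k)%:A
  | m.+1 => fun t => tsum t (fun x t' => J 0 x * emb_def (shift J) t')
  end.

Lemma emb_lin_def n J : lin (emb_def (n := n) J).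
Proof.
elim: n J => [|n IH] J /=; first by move=> a x y; rewrite scalerDl scalerA.
apply: tsum_linear; apply: bilinP => u; first by apply: lin_mull; apply: io_lin.
by apply: lin_mulr; apply: IH.
Qed.

Lemma emb_cons_def n J x t : emb_def (n := n.+1) J (x ⊗ t) = J 0 x * emb_def (shift J) t.
Proof.
rewrite /= tsumE //; apply: bilinP => u; first by apply: lin_mull; apply: io_lin.
by apply: lin_mulr; apply: emb_lin_def.
Qed.

Lemma emb1_def n J : emb_def J (1 : tpow_def n) = 1.
Proof.
elim: n J => [|n IH] J; first by rewrite /= scale1r.
by rewrite [1]/((1 : H) ⊗ (1 : tpow_def n)) emb_cons_def io1 IH mul1r.
Qed.

Lemma emb_tio_def n J i h : (forall i h, (n <= i)%N -> J i h = (ε h)%:A) ->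
  emb_def J (tio_def n i h) = J i h.
Proof.
elim: n J i => [|n IH] J i hn; first by rewrite hn.
case: i => [|i].
  by rewrite [tio_def _ _ _]/(h ⊗ (1 : tpow_def n)) emb_cons_def emb1_def mulr1.
rewrite [tio_def _ _ _]/((1 : H) ⊗ tio_def n i h) emb_cons_def io1 mul1r IH // => j x hj.
exact: (hn j.+1).
Qed.

Lemma emb_cm_def n J (t : tpow_def n) z : (forall i h, J i h * z = z * J i h) ->
  emb_def J t * z = z * emb_def J t.
Proof.
elim: n J t => [|n IH] J t hz; first by rewrite /= -scalerAl -scalerAr mulr1 mul1r.
rewrite /= /tsum mulr_suml mulr_sumr; apply: eq_bigr => p _.
rewrite -mulrA IH; first by rewrite mulrA hz mulrA.
by move=> i h; apply: hz.
Qed.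

Lemma embM_def n J (x y : tpow_def n) : emb_def J (x * y) = emb_def J x * emb_def J y.
Proof.
elim: n J x y => [|n IH] J x y; first by rewrite /= -scalerAl mul1r scalerA.
move: x; apply: tens_eq_lin => [a u v||h t].
- by rewrite mulrDl -scalerAl emb_lin_def.
- by apply: lin_mull; apply: (emb_lin_def (n := n.+1) J).
move: y; apply: tens_eq_lin => [a u v||h' t'].
- by rewrite mulrDr -scalerAr emb_lin_def.
- by apply: lin_mulr; apply: (emb_lin_def (n := n.+1) J).
rewrite [_ * _]tensM !emb_cons_def IH ioM -!mulrA; congr (_ * _).
by symmetry; apply: commCA; apply: emb_cm_def => i x; exact: (ioC J (i := i.+1) (j := 0)).
Qed.

End Embedding.

Record tensorPowers := TensorPowers {
  tpow : nat -> algType k;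
  tpow_strands : forall n, strands H (tpow n);
  word : forall n, (nat -> H) -> tpow n;
  teval : forall (W : lmodType k) n, ((nat -> H) -> W) -> tpow n -> W;
  emb : forall (T : algType k) n, strands H T -> tpow n -> T;
  tpow_eq_lin : forall n (W : lmodType k) (f g : tpow n -> W),
    lin f -> lin g -> (forall w, f (word n w) = g (word n w)) -> f =1 g;
  eq_word : forall n w w', (forall i, (i < n)%N -> w i = w' i) -> word n w = word n w';
  word1 : forall n, word n (fun=> 1) = 1;
  tio_word : forall n i h w, (i < n)%N ->
    tpow_strands n i h * word n w = word n (wmull i h w);
  word_tio : forall n i h w, (i < n)%N ->
    word n w * tpow_strands n i h = word n (wmulr i h w);
  teval_lin : forall (W : lmodType k) n (K : (nat -> H) -> W),
    mlin n K -> lin (@teval W n K);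
  teval_word : forall (W : lmodType k) n (K : (nat -> H) -> W) w,
    mlin n K -> teval K (word n w) = K (trunc n w);
  emb_lin : forall (T : algType k) n (J : strands H T), lin (@emb T n J);
  emb1 : forall (T : algType k) n (J : strands H T), emb J (1 : tpow n) = 1;
  embM : forall (T : algType k) n (J : strands H T) (x y : tpow n),
    emb J (x * y) = emb J x * emb J y;
  emb_tio : forall (T : algType k) n (J : strands H T) i h,
    (forall i h, (n <= i)%N -> J i h = (ε h)%:A) ->
    emb J (tpow_strands n i h) = J i h
}.

(* Only the universal property of the tensor powers of H is used below; the
   record keeps them from being unfolded. *)
Lemma tensor_powers : tensorPowers.
Proof.
apply: (@TensorPowers tpow_def tpow_strands_def word_def (fun W n => @teval_def W n)
  (fun T n => @emb_def T n)).
- exact: tpow_eq_lin_def.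
- exact: eq_word_def.
- exact: word1_def.
- exact: tio_word_def.
- exact: word_tio_def.
- by move=> W n K; apply: teval_lin_def.
- by move=> W n K w; apply: teval_word_def.
- by move=> T n J; apply: emb_lin_def.
- by move=> T n J; apply: emb1_def.
- by move=> T n J; apply: embM_def.
- by move=> T n J; apply: emb_tio_def.
Qed.

End TensorPower.

Arguments tpow {k H Q} t n : rename.

(** * Products of letters on strands, and substitution of trees for strands *)

Section Words.
Variables (k : fieldType) (H : algType k) (Q : quasiHopf H) (P : tensorPowers Q).
Local Notation ε := (qeps Q).
Local Notation tpow := (tpow P).
Local Notation tio n := (tpow_strands P n).

Definition wprod n (l : seq (nat * H)) (x : tpow n) : tpow n :=
  foldr (fun p y => tio n p.1 p.2 * y) x l.

Definition wact (l : seq (nat * H)) (w : nat -> H) : nat -> H :=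
  foldr (fun p w => wmull p.1 p.2 w) w l.

Lemma wactE l w i :
  wact l w i = foldr (fun p x => p.2 * x) (w i) [seq p <- l | p.1 == i].
Proof. by elim: l => [|p l IH] //=; rewrite /wmull eq_sym; case: eqP => _ /=; rewrite IH. Qed.

Lemma wprod_word n l w : all (fun p => (p.1 < n)%N) l ->
  wprod l (word P n w) = word P n (wact l w).
Proof. by elim: l => [|p l IH] //= /andP[hp hl]; rewrite IH // tio_word. Qed.

Lemma teval_wprod n (W : lmodType k) (K : (nat -> H) -> W) l w :
  mlin n K -> all (fun p => (p.1 < n)%N) l ->
  teval (n := n) K (wprod l (word P n w)) = K (trunc n (wact l w)).
Proof. by move=> mK hl; rewrite wprod_word // teval_word. Qed.

(** Every translation of a Sweedler expression into a functional ends here: [l] lists the factors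
    from left to right with their strands, and [K] receives on each strand the product of its
    factors in that order. *)
Lemma teval_wprod1 n (W : lmodType k) (K : (nat -> H) -> W) l :
  mlin n K -> all (fun p => (p.1 < n)%N) l ->
  teval (n := n) K (wprod l (1 : tpow n)) = K (trunc n (wact l (fun=> 1))).
Proof. by move=> mK hl; rewrite -word1 teval_wprod. Qed.

Lemma wact_graph (s : seq nat) w v i : uniq s ->
  wact [seq (j, w j) | j <- s] v i = if i \in s then w i * v i else v i.
Proof.
elim: s => [|j s IH] //= /andP[hj us]; rewrite /wmull IH // inE.
by case: eqP => [->|_] //=; rewrite (negbTE hj).
Qed.

Lemma emb_word (T : algType k) n (J : strands H T) w :
  (forall i h, (n <= i)%N -> J i h = (ε h)%:A) ->
  emb J (word P n w) = foldr (fun i y => J i (w i) * y) 1 (iota 0 n).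
Proof.
move=> hJ; pose l := [seq (i, w i) | i <- iota 0 n].
have -> : word P n w = wprod l 1.
  rewrite -word1 wprod_word; last first.
    by apply/allP => p /mapP[i]; rewrite mem_iota => /andP[_ hi] ->.
  apply: eq_word => i hi; rewrite wact_graph ?iota_uniq // mem_iota add0n hi /=.
  by rewrite mulr1.
rewrite /l; elim: (iota 0 n) => [|i r IH] /=; first exact: emb1.
by rewrite embM emb_tio // IH.
Qed.

Section Substitution.
Variables (T : algType k) (J : strands H T) (s : seq tree).
Hypothesis us : uniq (flatten (map labels s)).

(** Beyond the list of trees the copy is ε, in agreement with the strands of the tensor power, as
    [emb_tio] requires. *)
Definition sub_io i h : T :=
  if (i < size s)%N then cop Q J (nth (Lf 0) s i) h else (ε h)%:A.

Lemma sub_io_lin i : lin (sub_io i).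
Proof.
rewrite /sub_io; case: (i < size s)%N; first exact: cop_lin.
by lin_tac.
Qed.

Lemma sub_io1 i : sub_io i 1 = 1.
Proof. by rewrite /sub_io cop1 rmorph1 scale1r if_same. Qed.

Lemma sub_ioM i x y : sub_io i (x * y) = sub_io i x * sub_io i y.
Proof.
rewrite /sub_io; case: ifP => hi; last first.
  by rewrite rmorphM -scalerAl mul1r scalerA.
apply: copM; elim: s us i hi => //= t s' IH; rewrite cat_uniq => /and3P[ut _ us'].
by case=> [|i] //= hi; apply: IH.
Qed.

Lemma sub_ioC i j x y : i != j -> sub_io i x * sub_io j y = sub_io j y * sub_io i x.
Proof.
rewrite /sub_io; case: ifP => hi; last by rewrite -scalerAl -scalerAr mulr1 mul1r.
case: ifP => hj; last by rewrite -scalerAl -scalerAr mulr1 mul1r.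
move=> ij; apply: cop_comm.
elim: s us i j ij hi hj => //= t s' IH; rewrite cat_uniq => /and3P[_ d us'].
have dt i : (i < size s')%N -> disj (labels t) (labels (nth (Lf 0) s' i)).
  move=> hi; apply: contraNN d => /hasP[l h1 h2]; apply/hasP; exists l => //.
  by apply/flattenP; exists (labels (nth (Lf 0) s' i)) => //; apply: map_f; apply: mem_nth.
case=> [|i] [|j] //= ij hi hj; [exact: dt | by rewrite disjC; apply: dt | exact: IH].
Qed.

Definition sub_strands : strands H T := Strands sub_io_lin sub_io1 sub_ioM sub_ioC.

Definition subst := emb (t := P) (n := size s) sub_strands.

Lemma subst_lin : lin subst.
Proof. exact: emb_lin. Qed.

Lemma substM x y : subst (x * y) = subst x * subst y.
Proof. exact: embM. Qed.

Lemma subst1 : subst 1 = 1.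
Proof. exact: emb1. Qed.

Fixpoint tsub t := match t with
  | Lf i => nth (Lf 0) s i
  | Nd l r => Nd (tsub l) (tsub r)
  end.

Definition msub (m : move) : move :=
  let: (b, r, s, t) := m in (b, tsub r, tsub s, tsub t).

Local Notation small L := (all (fun i => (i < size s)%N) L).

Lemma subst_cop t h : small (labels t) ->
  subst (cop Q (tpow_strands P (size s)) t h) = cop Q J (tsub t) h.
Proof.
elim: t h => [i|l IHl r IHr] h /=.
  rewrite andbT /subst => hi; rewrite emb_tio /=; first by rewrite /sub_io hi.
  by move=> j x; rewrite /sub_io ltnNge => ->.
rewrite all_cat => /andP[sl sr]; rewrite /subst (lin_push _ _ (emb_lin _)).
by apply: eq_tsum => a c; rewrite embM -/subst IHl ?IHr.
Qed.

Lemma subst_el m : small (mlabels m) ->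
  subst (el Q (tpow_strands P (size s)) m) = el Q J (msub m).
Proof.
case: m => [[[b r] t] u] hm; rewrite /el /msub /phi3 /subst.
have [hr ht hu] : [/\ small (labels r), small (labels t) & small (labels u)].
  by move: hm; case: (b); rewrite /mlabels /= !all_cat => /andP[];
    [case/andP|move=> ? /andP[]].
rewrite (lin_push _ _ (emb_lin _)); apply: eq_tsum => a c.
rewrite (lin_push _ _ (emb_lin _)); apply: eq_tsum => x y.
by rewrite !embM -/subst !subst_cop.
Qed.

Lemma subst_pel p : all (fun m => small (mlabels m)) p ->
  subst (pel Q (tpow_strands P (size s)) p) = pel Q J (map msub p).
Proof.
elim: p => [|m p IH] /=; first by rewrite /subst emb1.
by case/andP=> hm hp; rewrite /subst embM -/subst IH // subst_el.
Qed.

Lemma subst_word w : subst (word P (size s) w) =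
  foldr (fun p y => cop Q J p.2 (w p.1) * y) 1 (zip (iota 0 (size s)) s).
Proof.
rewrite /subst emb_word; last by move=> i h; rewrite /= /sub_io ltnNge => ->.
rewrite /= /sub_io.
(* Induction on the length d of a final segment: the lookups refer to positions in all of [s], so
   the list itself has to stay fixed. *)
have: forall d, (d <= size s)%N -> foldr (fun i y => (if (i < size s)%N
    then cop Q J (nth (Lf 0) s i) (w i) else (ε (w i))%:A) * y) 1
    (iota (size s - d) d) =
  foldr (fun p y => cop Q J p.2 (w p.1) * y) 1
    (zip (iota (size s - d) d) (drop (size s - d) s)).
  move=> d; elim: d => [_|d IH hd]; first by rewrite subn0 drop_size /= .
  have hlt : (size s - d.+1 < size s)%N by rewrite ltn_subrL /= (leq_trans _ hd).
  by rewrite (drop_nth (Lf 0) hlt) /= hlt -subSn // subSS IH // ltnW.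
by move/(_ (size s) (leqnn _)); rewrite subnn drop0.
Qed.

End Substitution.

End Words.

Arguments wact : simpl never.

Ltac wsimp := rewrite /= ?wactE /=; rewrite /wmull /wmulr /=.

(** * The Drinfeld twist *)

Section Drinfeld.
Variables (k : fieldType) (H : algType k) (Q : quasiHopf H) (P : tensorPowers Q).
Local Notation Δ := (qDelta Q).
Local Notation ε := (qeps Q).
Local Notation Φ := (qPhi Q).
Local Notation Φi := (qPhi_inv Q).
Local Notation S := (qS Q).
Local Notation α := (qalpha Q).
Local Notation β := (qbeta Q).
Local Notation st n := (tpow_strands P n).
Local Notation tcop n := (cop Q (tpow_strands P n)).
Local Notation tel n := (el Q (tpow_strands P n)).
Local Notation tpel n := (pel Q (tpow_strands P n)).

Lemma antipodel_lin (W : lmodType k) (F : H -> W) h : lin F ->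
  tsum (Δ h) (fun h1 h2 => F (S h1 * α * h2)) = ε h *: F α.
Proof. by move=> hF; rewrite -(lin_push _ _ hF) qantipodel (linZ hF). Qed.

Lemma antipoder_lin (W : lmodType k) (F : H -> W) h : lin F ->
  tsum (Δ h) (fun h1 h2 => F (h1 * β * S h2)) = ε h *: F β.
Proof. by move=> hF; rewrite -(lin_push _ _ hF) qantipoder (linZ hF). Qed.

Section Absorption.
Variables (W : lmodType k) (n : nat) (K : (nat -> H) -> W).
Hypothesis mK : mlin n K.

(** Words span the tensor power, so absorption need only be checked for [K] on streams. *)
Lemma absorb_left i j : (i < n)%N -> (j < n)%N ->
  (forall w h, \sw[h1, h2 <- Δ h] K (trunc n (wmull i h1 (wmull j h2 w))) =
     ε h *: K (trunc n w)) ->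
  absorb Q (st n) (teval (t := P) (n := n) K) true (Nd (Lf i) (Lf j)).
Proof.
move=> hi hj e h y; rewrite /side; move: y; apply: tpow_eq_lin => [||w].
- by apply: (lin_comp (teval_lin mK)); apply: lin_mulr; apply: lin_idf.
- by apply: lin_scale; apply: teval_lin.
rewrite teval_word // -e /= /tsum mulr_suml (lin_sumE (teval_lin mK)).
apply: eq_bigr => p _.
by rewrite -mulrA !tio_word // teval_word.
Qed.

Lemma absorb_right i j : (i < n)%N -> (j < n)%N ->
  (forall w h, \sw[h1, h2 <- Δ h] K (trunc n (wmulr j h2 (wmulr i h1 w))) =
     ε h *: K (trunc n w)) ->
  absorb Q (st n) (teval (t := P) (n := n) K) false (Nd (Lf i) (Lf j)).
Proof.
move=> hi hj e h y; rewrite /side; move: y; apply: tpow_eq_lin => [||w].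
- by apply: (lin_comp (teval_lin mK)); apply: lin_mull; apply: lin_idf.
- by apply: lin_scale; apply: teval_lin.
rewrite teval_word // -e /= /tsum mulr_sumr (lin_sumE (teval_lin mK)).
apply: eq_bigr => p _.
by rewrite mulrA !word_tio // teval_word.
Qed.

End Absorption.

Local Notation L i := (Lf i).
Local Infix "∙" := Nd (at level 38, left associativity).

Definition Kdelta (w : nat -> H) : H ⊗ H := (w 0 * β * S (w 3)) ⊗ (w 1 * β * S (w 2)).
Definition Kgamma (w : nat -> H) : H ⊗ H := (S (w 1) * α * w 2) ⊗ (S (w 0) * α * w 3).

Lemma mlin_Kdelta : mlin 4 Kdelta.
Proof. by rewrite /Kdelta /=; do !split=> *; lin_tac. Qed.

Lemma mlin_Kgamma : mlin 4 Kgamma.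
Proof. by rewrite /Kgamma /=; do !split=> *; lin_tac. Qed.

(** [Bmoves] leads from (0(12))3 to (01)(23), [Amoves] back. At (0(12))3 the pairs 12 and 03, which
    δ and γ evaluate, are nested and can be absorbed from inside out; at (01)(23) the bracketing is
    that of Δ and [S2]. *)
Definition Bmoves := [:: (false, L 0, L 1, L 2); (true, L 0 ∙ L 1, L 2, L 3)].
Definition Amoves := [:: (false, L 0 ∙ L 1, L 2, L 3); (true, L 0, L 1, L 2)].

Definition Pdelta := teval (t := P) (n := 4) Kdelta.
Definition Pgamma := teval (t := P) (n := 4) Kgamma.

Lemma Pdelta_lin : lin Pdelta. Proof. exact: teval_lin mlin_Kdelta. Qed.
Lemma Pgamma_lin : lin Pgamma. Proof. exact: teval_lin mlin_Kgamma. Qed.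

Ltac lin_ext ::= first
  [ apply: lin_io; lin_tac | apply: lin_cop; lin_tac | apply: (lin_comp Pdelta_lin); lin_tac
  | apply: (lin_comp Pgamma_lin); lin_tac ].

Definition drinfeld_gamma : H ⊗ H := Pgamma (tpel 4 Amoves).

Lemma drinfeld_deltaE : drinfeld_delta Q = Pdelta (tpel 4 Bmoves).
Proof.
rewrite /drinfeld_delta /= mul1r.
rewrite -(phi4_cop Q (st 4) (L 0) (L 1) (L 2) (L 3)).
rewrite -(phi4_pad Q (st 4) (L 0) (L 1) (L 2) (L 3)).
rewrite -phi4M //; set x := _ * _; move: x.
have bil3 (a b : H) : bilin (fun c d => (a * β * S d) ⊗ (b * β * S c)) by lin_tac.
have bil2 (a : H) : bilin (fun b (t : H ⊗ H) => \sw[c, d <- t] ((a * β * S d) ⊗ (b * β * S c))).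
  by lin_tac.
have bil1 : bilin (fun a (t : H ⊗ H ⊗ H) => \sw[b, c, d <- t] ((a * β * S d) ⊗ (b * β * S c))).
  by lin_tac.
apply: tens4_eq_lin => [||a b c d].
- exact: (tsum_linear bil1).
- apply: (lin_comp Pdelta_lin); exact: phi4_lin.
rewrite (tsumE bil1) (tsumE (bil2 a)) (tsumE (bil3 a b)).
rewrite phi4E /Pdelta -[X in teval _ X]mulr1 -!mulrA.
rewrite (teval_wprod1 P (l := [:: (0, a); (1, b); (2, c); (3, d)]) mlin_Kdelta erefl) /=.
by rewrite /Kdelta; wsimp; rewrite !mulr1 !mulrA.
Qed.

Lemma absorb_delta12 : absorb Q (st 4) Pdelta false (L 1 ∙ L 2).
Proof.
apply: (absorb_right mlin_Kdelta) => // w h; rewrite /Kdelta; wsimp.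
under eq_tsum => h1 h2 do rewrite qSM !mulrA.
rewrite -(antipoder_lin (F := fun z => (w 0 * β * S (w 3)) ⊗ (w 1 * z * S (w 2)))).
  by apply: eq_tsum => h1 h2; rewrite !mulrA.
by lin_tac.
Qed.

Lemma absorb_delta03 : absorb Q (st 4) Pdelta false (L 0 ∙ L 3).
Proof.
apply: (absorb_right mlin_Kdelta) => // w h; rewrite /Kdelta; wsimp.
under eq_tsum => h1 h2 do rewrite qSM !mulrA.
rewrite -(antipoder_lin (F := fun z => (w 0 * z * S (w 3)) ⊗ (w 1 * β * S (w 2)))).
  by apply: eq_tsum => h1 h2; rewrite !mulrA.
by lin_tac.
Qed.

Lemma absorb_gamma12 : absorb Q (st 4) Pgamma true (L 1 ∙ L 2).
Proof.
apply: (absorb_left mlin_Kgamma) => // w h; rewrite /Kgamma; wsimp.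
under eq_tsum => h1 h2 do rewrite qSM !mulrA.
rewrite -(antipodel_lin (F := fun z => (S (w 1) * z * w 2) ⊗ (S (w 0) * α * w 3))).
  by apply: eq_tsum => h1 h2; rewrite !mulrA.
by lin_tac.
Qed.

Lemma absorb_gamma03 : absorb Q (st 4) Pgamma true (L 0 ∙ L 3).
Proof.
apply: (absorb_left mlin_Kgamma) => // w h; rewrite /Kgamma; wsimp.
under eq_tsum => h1 h2 do rewrite qSM !mulrA.
rewrite -(antipodel_lin (F := fun z => (S (w 1) * α * w 2) ⊗ (S (w 0) * z * w 3))).
  by apply: eq_tsum => h1 h2; rewrite !mulrA.
by lin_tac.
Qed.

Definition S2 h : H ⊗ H := \sw[u, v <- Δ h] (S v ⊗ S u).

Lemma S2_lin : lin S2.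
Proof. by rewrite /S2; lin_tac. Qed.

Lemma S2M h h' : S2 (h * h') = S2 h' * S2 h.
Proof.
rewrite /S2 rmorphM tsum_mul; last by lin_tac.
rewrite (tsum_mulr (Δ h)); apply: eq_tsum => a b; rewrite (tsum_mull (Δ h')); apply: eq_tsum => c d.
by rewrite tensM !qSM.
Qed.

Lemma S2_1 : S2 1 = 1.
Proof. by rewrite /S2 rmorph1 tsumE ?qS1 //; lin_tac. Qed.

(** Outer factors Δ(a) and [S2 b] become coproducts on 01 and 23, the two halves of the target of
    [Bmoves], so they continue the path. *)
Lemma Pdelta_act a b y :
  Δ a * Pdelta y * S2 b = Pdelta (tcop 4 (L 0 ∙ L 1) a * tcop 4 (L 2 ∙ L 3) b * y).
Proof.
rewrite -[Δ a]tsum_tens /S2 /= -mulrA !(tsum_mull (Δ a)) (lin_push _ _ Pdelta_lin).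
apply: eq_tsum => u1 u2; rewrite !(tsum_mulr (Δ b)) (tsum_mull (Δ b)) (lin_push _ _ Pdelta_lin).
apply: eq_tsum => v1 v2; rewrite -!mulrA; move: y; apply: tpow_eq_lin => [||w].
- by lin_tac.
- by lin_tac.
rewrite /Pdelta (teval_word P w mlin_Kdelta).
rewrite (teval_wprod P (l := [:: (0, u1); (1, u2); (2, v1); (3, v2)]) w mlin_Kdelta erefl) /=.
by rewrite /Kdelta; wsimp; rewrite !tensM !qSM !mulrA.
Qed.

Lemma Pgamma_act a b y :
  S2 a * Pgamma y * Δ b = Pgamma (y * (tcop 4 (L 0 ∙ L 1) a * tcop 4 (L 2 ∙ L 3) b)).
Proof.
rewrite -[Δ b]tsum_tens /S2 /= -mulrA !(tsum_mull (Δ a)) (tsum_mulr (Δ a)) (lin_push _ _ Pgamma_lin).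
apply: eq_tsum => u1 u2; rewrite !(tsum_mulr (Δ b)) (lin_push _ _ Pgamma_lin).
apply: eq_tsum => v1 v2; move: y; apply: tpow_eq_lin => [||w].
- by lin_tac.
- by lin_tac.
rewrite !mulrA !word_tio // /Pgamma !(teval_word P _ mlin_Kgamma).
by rewrite /Kgamma; wsimp; rewrite !tensM !qSM !mulrA.
Qed.

(** With respect to Δ and [S2], δ behaves as β does for id and S. The coproduct along (01)(23)
    passes the path and becomes one along (0(12))3, where 12 and then 03 absorb it. *)
Lemma drinfeld_delta_absorb h :
  \sw[h1, h2 <- Δ h] (Δ h1 * drinfeld_delta Q * S2 h2) = ε h *: drinfeld_delta Q.
Proof.
rewrite drinfeld_deltaE; under eq_tsum => h1 h2 do rewrite Pdelta_act.
rewrite -(lin_push _ _ Pdelta_lin) -tsum_mull.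
rewrite -[tsum _ _]/(tcop 4 ((L 0 ∙ L 1) ∙ (L 2 ∙ L 3)) h).
rewrite (@nat_pel _ _ _ Q (st 4) Bmoves ((L 0 ∙ (L 1 ∙ L 2)) ∙ L 3)) //.
have [_ sm] : sim Q (st 4) Pdelta false ((L 0 ∙ (L 1 ∙ L 2)) ∙ L 3) (L 0 ∙ L 3).
  apply: (sim_Nd Pdelta_lin); [by [] | | exact: sim_refl].
  by apply: (sim_unitr Pdelta_lin) => //; apply: absorb_delta12.
by have := sm h (tpel 4 Bmoves); rewrite /side => ->; apply: absorb_delta03.
Qed.

Lemma drinfeld_gamma_absorb h :
  \sw[h1, h2 <- Δ h] (S2 h1 * drinfeld_gamma * Δ h2) = ε h *: drinfeld_gamma.
Proof.
rewrite /drinfeld_gamma; under eq_tsum => h1 h2 do rewrite Pgamma_act.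
rewrite -(lin_push _ _ Pgamma_lin) -tsum_mulr.
rewrite -[tsum _ _]/(tcop 4 ((L 0 ∙ L 1) ∙ (L 2 ∙ L 3)) h).
rewrite -(@nat_pel _ _ _ Q (st 4) Amoves _ ((L 0 ∙ (L 1 ∙ L 2)) ∙ L 3)) //.
have [_ sm] : sim Q (st 4) Pgamma true ((L 0 ∙ (L 1 ∙ L 2)) ∙ L 3) (L 0 ∙ L 3).
  apply: (sim_Nd Pgamma_lin); [by [] | | exact: sim_refl].
  by apply: (sim_unitr Pgamma_lin) => //; apply: absorb_gamma12.
by have := sm h (tpel 4 Amoves); rewrite /side => ->; apply: absorb_gamma03.
Qed.

(** The functional of a product of a δ-value and a γ-value. Strands 2 and 3 are shared by the
    factors, because S(x) S(y) = S(y x). *)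
Definition Kzig (w : nat -> H) : H ⊗ H :=
  (w 0 * β * S (w 3) * α * w 4) ⊗ (w 1 * β * S (w 2) * α * w 5).
Lemma mlin_Kzig : mlin 6 Kzig.
Proof. by rewrite /Kzig /=; do !split=> *; lin_tac. Qed.
Definition Pzig := teval (t := P) (n := 6) Kzig.
Lemma Pzig_lin : lin Pzig. Proof. exact: teval_lin mlin_Kzig. Qed.

Definition left4 := [:: L 0; L 1; L 2; L 3].
Definition right4 := [:: L 2; L 3; L 4; L 5].
Lemma uniq_left4 : uniq (flatten (map labels left4)). Proof. by []. Qed.
Lemma uniq_right4 : uniq (flatten (map labels right4)). Proof. by []. Qed.
Local Notation sl := (subst (st 6) uniq_left4).
Local Notation sr := (subst (st 6) uniq_right4).

Lemma Pdelta_Pgamma y z : Pdelta y * Pgamma z = Pzig (sr z * sl y).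
Proof.
move: y; apply: tpow_eq_lin => [||w].
- by lin_tac.
- apply: (lin_comp Pzig_lin); apply: lin_mulr; exact: emb_lin.
move: z; apply: tpow_eq_lin => [||v].
- by lin_tac.
- apply: (lin_comp Pzig_lin); apply: lin_mull; exact: emb_lin.
rewrite !subst_word /= /Pdelta /Pgamma (teval_word P w mlin_Kdelta).
rewrite (teval_word P v mlin_Kgamma) -mulrA.
rewrite /Pzig -!mulrA mul1r.
rewrite (teval_wprod1 P (l := [:: (2, v 0); (3, v 1); (4, v 2); (5, v 3);
  (0, w 0); (1, w 1); (2, w 2); (3, w 3)]) mlin_Kzig erefl).
by rewrite /Kdelta /Kgamma /Kzig; wsimp; rewrite !mulr1 !tensM !qSM !mulrA.
Qed.

Lemma absorb_zig34 : absorb Q (st 6) Pzig true (L 3 ∙ L 4).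
Proof.
apply: (absorb_left mlin_Kzig) => // w h; rewrite /Kzig; wsimp.
under eq_tsum => h1 h2 do rewrite qSM !mulrA.
rewrite -(antipodel_lin (F := fun z => (w 0 * β * S (w 3) * z * w 4) ⊗
  (w 1 * β * S (w 2) * α * w 5))).
  by apply: eq_tsum => h1 h2; rewrite !mulrA.
by lin_tac.
Qed.

Lemma absorb_zig25 : absorb Q (st 6) Pzig true (L 2 ∙ L 5).
Proof.
apply: (absorb_left mlin_Kzig) => // w h; rewrite /Kzig; wsimp.
under eq_tsum => h1 h2 do rewrite qSM !mulrA.
rewrite -(antipodel_lin (F := fun z => (w 0 * β * S (w 3) * α * w 4) ⊗
  (w 1 * β * S (w 2) * z * w 5))).
  by apply: eq_tsum => h1 h2; rewrite !mulrA.
by lin_tac.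
Qed.

Lemma absorb_zig12 : absorb Q (st 6) Pzig false (L 1 ∙ L 2).
Proof.
apply: (absorb_right mlin_Kzig) => // w h; rewrite /Kzig; wsimp.
under eq_tsum => h1 h2 do rewrite qSM !mulrA.
rewrite -(antipoder_lin (F := fun z => (w 0 * β * S (w 3) * α * w 4) ⊗
  (w 1 * z * S (w 2) * α * w 5))).
  by apply: eq_tsum => h1 h2; rewrite !mulrA.
by lin_tac.
Qed.

Lemma absorb_zig03 : absorb Q (st 6) Pzig false (L 0 ∙ L 3).
Proof.
apply: (absorb_right mlin_Kzig) => // w h; rewrite /Kzig; wsimp.
under eq_tsum => h1 h2 do rewrite qSM !mulrA.
rewrite -(antipoder_lin (F := fun z => (w 0 * z * S (w 3) * α * w 4) ⊗
  (w 1 * β * S (w 2) * α * w 5))).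
  by apply: eq_tsum => h1 h2; rewrite !mulrA.
by lin_tac.
Qed.

(** The path of δ on the strands 0 to 3, the associator between δ and γ, and the path of γ on 2 to
    5. *)
Definition zig_moves1 := map (msub left4) Bmoves ++
  (true, L 0 ∙ L 1, L 2 ∙ L 3, L 4 ∙ L 5) :: map (msub right4) Amoves.

(* A route with the same ends as [zig_moves1] each move of which involves an
   absorbed pair of strands. *)
Definition zig_moves2 :=
  let U := L 3 ∙ L 4 in
  [:: (false, (L 0 ∙ (L 1 ∙ L 2)) ∙ L 3, L 4, L 5); (true, L 0 ∙ (L 1 ∙ L 2), L 3, L 4);
      (true, L 0 ∙ (L 1 ∙ L 2), U, L 5); (true, L 0, L 1 ∙ L 2, U ∙ L 5);
      (true, L 1, L 2, U ∙ L 5);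
      (false, L 0, L 1, L 2 ∙ (U ∙ L 5)); (false, L 2, U, L 5)].

Lemma pel_cat (T : algType k) (I : strands H T) p q :
  pel Q I (p ++ q) = pel Q I q * pel Q I p.
Proof. by elim: p => [|m p IH] /=; rewrite ?mulr1 // IH mulrA. Qed.

Lemma pel_cons (T : algType k) (I : strands H T) m p :
  pel Q I (m :: p) = pel Q I p * el Q I m.
Proof. by []. Qed.

Lemma drinfeld_zigzagE :
  \sw[X1, X2, X3 <- Φ] (Δ X1 * drinfeld_delta Q * S2 X2 * drinfeld_gamma * Δ X3) =
  Pzig (tpel 6 zig_moves1).
Proof.
rewrite drinfeld_deltaE /drinfeld_gamma.
transitivity (\sw[X1, X2, X3 <- Φ] Pzig (sr (tpel 4 Amoves) * (tcop 6 (L 0 ∙ L 1) X1 *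
   tcop 6 (L 2 ∙ L 3) X2 * tcop 6 (L 4 ∙ L 5) X3) * sl (tpel 4 Bmoves))).
  apply: eq_tsum => a x; apply: eq_tsum => b c.
  have e : drinfeld_gamma * Δ c = Pgamma (tpel 4 Amoves * tcop 4 (L 2 ∙ L 3) c).
    by have := Pgamma_act 1 c (tpel 4 Amoves); rewrite S2_1 mul1r cop1 mul1r.
  rewrite Pdelta_act -mulrA e Pdelta_Pgamma !substM !subst_cop //.
  rewrite -!mulrA; congr (Pzig (_ * _)).
  rewrite -[tcop 6 (tsub right4 _) c]/(tcop 6 (L 4 ∙ L 5) c).
  rewrite (commCA _ (@cop_comm _ _ _ Q (st 6) (L 4 ∙ L 5) (L 0 ∙ L 1) c a erefl)).
  by rewrite (commCA _ (@cop_comm _ _ _ Q (st 6) (L 4 ∙ L 5) (L 2 ∙ L 3) c b erefl)).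
rewrite /zig_moves1 pel_cat (pel_cons _ _ (map (msub right4) Amoves)) 
  -(subst_pel P (st 6) uniq_left4) // -(subst_pel P (st 6) uniq_right4) //.
rewrite -[RHS]/(Pzig (_ * phi3 _ _ _ _ _ _ * _)).
rewrite /phi3 tsum_mulr tsum_mull (lin_push _ _ Pzig_lin); apply: eq_tsum => a x.
by rewrite tsum_mulr tsum_mull (lin_push _ _ Pzig_lin).
Qed.

(** The analogue for Δ, [S2], δ and γ of X^1 β S(X^2) α X^3 = 1. Along [zig_moves2] absorption
    removes everything except one Φ on 1, 2, 5 and one on 0, 3, 4, and each of these two evaluates
    to 1 by that axiom. *)
Lemma drinfeld_zigzag :
  \sw[X1, X2, X3 <- Φ] (Δ X1 * drinfeld_delta Q * S2 X2 * drinfeld_gamma * Δ X3) = 1.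
Proof.
rewrite drinfeld_zigzagE.
rewrite (@coherence _ _ _ Q (st 6) zig_moves1 zig_moves2 ((L 0 ∙ (L 1 ∙ L 2) ∙ L 3) ∙ (L 4 ∙ L 5))
  ((L 0 ∙ L 1) ∙ ((L 2 ∙ (L 3 ∙ L 4)) ∙ L 5))) //.
rewrite /zig_moves2; set U := L 3 ∙ L 4; rewrite [pel _ _ _]/= mul1r.
set m7 := phi3 _ _ _ _ _ _; set m6 := phi3 _ _ _ _ _ _; set m5 := phi3 _ _ _ _ _ _.
set m4 := phi3 _ _ _ _ _ _; set m3 := phi3 _ _ _ _ _ _; set m2 := phi3 _ _ _ _ _ _.
set m1 := phi3 _ _ _ _ _ _.
have simU5 : sim Q (st 6) Pzig true (U ∙ L 5) (L 5).
  exact: (sim_unitl Pzig_lin _ absorb_zig34).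
(* From the left, the α-pairs act: [m7] has 34 as its middle letter, and the last letter of [m6]
   reduces to the pair 25. *)
have -> : Pzig (m7 * m6 * m5 * m4 * m3 * m2 * m1) = Pzig (m5 * m4 * m3 * m2 * m1).
  rewrite -!mulrA -[LHS]/(Pzig (side true (tel 6 (false, L 2, U, L 5)) _)).
  rewrite (phi3_unit2 Pzig_lin _ _ _ absorb_zig34) //.
  rewrite -[LHS]/(Pzig (side true (tel 6 (false, L 0, L 1, L 2 ∙ (U ∙ L 5))) _)).
  rewrite (phi3_unit3 Pzig_lin) //.
  apply: sim_absorbed absorb_zig25.
  by apply: (sim_Nd Pzig_lin); [by [] | exact: sim_refl | exact: simU5].
(* From the right, the β-pairs act: (0(12))3 reduces to 03, which is absorbed. *)
have -> : Pzig (m5 * m4 * m3 * m2 * m1) = Pzig (m5 * m4 * m3 * m2).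
  rewrite -[LHS]/(Pzig (side false (tel 6 (false, L 0 ∙ (L 1 ∙ L 2) ∙ L 3, L 4, L 5)) _)).
  rewrite (phi3_unit1 Pzig_lin) //.
  apply: sim_absorbed absorb_zig03.
  apply: (sim_Nd Pzig_lin); [by [] | | exact: sim_refl].
  exact: (sim_unitr Pzig_lin _ absorb_zig12).
(* The rest is freed from 34 on the left and from 12 on the right. The pair 34 stays absorbable
   behind [n5] and [n4], which avoid these strands, and 12 behind [n2]. *)
pose n5 := phi3 Q (st 6) (L 1) (L 2) (L 5) Φ.
have -> : Pzig (m5 * m4 * m3 * m2) = Pzig (n5 * m4 * m3 * m2).
  rewrite -!mulrA; apply: (sim_phi3 Pzig_lin (b := true)) => //; exact: sim_refl.
have lin5 : lin (fun y => Pzig (n5 * y)).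
  by apply: (lin_comp Pzig_lin); apply: lin_mulr; apply: lin_idf.
have ab5 : absorb Q (st 6) (fun y => Pzig (n5 * y)) true U.
  move=> h y; apply: (absorb_side (z := n5) (b := true) absorb_zig34).
  exact: cm_phi3.
pose n4 := phi3 Q (st 6) (L 0) (L 1 ∙ L 2) (L 5) Φ.
have -> : Pzig (n5 * m4 * m3 * m2) = Pzig (n5 * n4 * m3 * m2).
  rewrite -!mulrA; apply: (sim_phi3 lin5 (b := true)) => //; try exact: sim_refl.
  exact: (sim_unitl lin5 _ ab5).
have lin4 : lin (fun y => Pzig (n5 * n4 * y)).
  by apply: (lin_comp Pzig_lin); apply: lin_mulr; apply: lin_idf.
have ab4 : absorb Q (st 6) (fun y => Pzig (n5 * n4 * y)) true U.
  move=> h y; apply: (absorb_side (z := n5 * n4) (b := true) absorb_zig34).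
  by apply: cm_mul; exact: cm_phi3.
have -> : Pzig (n5 * n4 * m3 * m2) = Pzig (n5 * n4 * m2).
  rewrite -[in LHS]mulrA.
  by apply: (phi3_unit2 lin4 true m2 _ ab4).
pose n2 := phi3 Q (st 6) (L 0) (L 3) (L 4) Φ.
have -> : Pzig (n5 * n4 * m2) = Pzig (n5 * n4 * n2).
  apply: (sim_phi3 Pzig_lin (b := false)) => //; try exact: sim_refl.
  exact: (sim_unitr Pzig_lin _ absorb_zig12).
have lin2 : lin (fun y => Pzig (y * n2)).
  by apply: (lin_comp Pzig_lin); apply: lin_mull; apply: lin_idf.
have ab2 : absorb Q (st 6) (fun y => Pzig (y * n2)) false (L 1 ∙ L 2).
  move=> h y; apply: (absorb_side (z := n2) (b := false) absorb_zig12).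
  exact: cm_phi3.
have -> : Pzig (n5 * n4 * n2) = Pzig (n5 * n2).
  by apply: (phi3_unit2 lin2 true n5 _ ab2).
pose e (x : H ⊗ H ⊗ H) : H := \sw[a, b, c <- x] (a * β * S b * α * c).
have bil2 (a : H) : bilin (fun b c => a * β * S b * α * c) by lin_tac.
have bil1 : bilin (fun (a : H) (t : H ⊗ H) => \sw[b, c <- t] (a * β * S b * α * c)).
  by lin_tac.
have lin_e : lin e by apply: (tsum_linear bil1).
have eE a b c : e (a ⊗ b ⊗ c) = a * β * S b * α * c.
  by rewrite /e (tsumE bil1) (tsumE (bil2 a)).
have key (x y : H ⊗ H ⊗ H) :
    Pzig (phi3 Q (st 6) (L 1) (L 2) (L 5) x * phi3 Q (st 6) (L 0) (L 3) (L 4) y) = e y ⊗ e x.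
  move: x; apply: tens3_eq_lin => [||a b c].
  - by apply: (lin_comp Pzig_lin); apply: lin_mull; apply: phi3_lin.
  - by apply: lin_tensr.
  move: y; apply: tens3_eq_lin => [||a' b' c'].
  - by apply: (lin_comp Pzig_lin); apply: lin_mulr; apply: phi3_lin.
  - by apply: lin_tensl.
  rewrite !phi3E !eE /Pzig -!mulrA -[X in teval _ X]mulr1 -!mulrA.
  rewrite (teval_wprod1 P (l := [:: (1, a); (2, b); (5, c); (0, a'); (3, b'); (4, c')])
    mlin_Kzig erefl).
  by rewrite /Kzig; wsimp; rewrite !mulr1 !mulrA.
by rewrite /n5 /n2 key /e (qPhi_antipode Q).
Qed.

Definition Ktwist (w : nat -> H) : H ⊗ H :=
  Δ (S (w 0) * α * w 1) * drinfeld_delta Q * S2 (w 2).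
Definition Ptwist := teval (t := P) (n := 3) Ktwist.

Lemma lin_S2 (U : lmodType k) (f : U -> H) : lin f -> lin (fun x => S2 (f x)).
Proof. by move=> hf a x y; rewrite hf S2_lin. Qed.

Ltac lin_ext ::= first
  [ apply: lin_io; lin_tac | apply: lin_cop; lin_tac | apply: lin_S2; lin_tac ].

Lemma mlin_Ktwist : mlin 3 Ktwist.
Proof. by rewrite /Ktwist /=; do !split=> *; lin_tac. Qed.

Lemma Ptwist_lin : lin Ptwist. Proof. exact: teval_lin mlin_Ktwist. Qed.

Lemma drinfeld_twistE : drinfeld_twist_inv Q = Ptwist (phi3 Q (st 3) (L 0) (L 1) (L 2) Φi).
Proof.
rewrite /phi3 (lin_push _ _ Ptwist_lin); apply: eq_tsum => a x.
rewrite (lin_push _ _ Ptwist_lin); apply: eq_tsum => b c.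
rewrite /Ptwist -[X in teval _ X]mulr1 -!mulrA.
rewrite (teval_wprod1 P (l := [:: (0, a); (1, b); (2, c)]) mlin_Ktwist erefl).
by rewrite /Ktwist; wsimp; rewrite !mulr1 !mulrA.
Qed.

Lemma absorb_twist12 : absorb Q (st 3) Ptwist false (L 1 ∙ L 2).
Proof.
apply: (absorb_right mlin_Ktwist) => // w h; rewrite /Ktwist; wsimp.
under eq_tsum => h1 h2 do rewrite S2M !mulrA rmorphM.
have linF : lin (fun z => Δ (S (w 0) * α * w 1) * z * S2 (w 2)) by lin_tac.
rewrite -(linZ linF) -drinfeld_delta_absorb (lin_push _ _ linF).
by apply: eq_tsum => h1 h2; rewrite !mulrA.
Qed.

Lemma absorb_twist01 : absorb Q (st 3) Ptwist true (L 0 ∙ L 1).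
Proof.
apply: (absorb_left mlin_Ktwist) => // w h; rewrite /Ktwist; wsimp.
under eq_tsum => h1 h2 do rewrite qSM !mulrA.
rewrite -(antipodel_lin (F := fun z => Δ (S (w 0) * z * w 1) * drinfeld_delta Q * S2 (w 2))).
  by apply: eq_tsum => h1 h2; rewrite !mulrA.
by lin_tac.
Qed.

(** As a functional of Φ^-1 on 0, 1, 2, the left side puts h on strand 0 and the right side on
    strand 2. Absorption of 12 pads 0 to 0(12), absorption of 01 pads 2 to (01)2, and Φ^-1
    intertwines the two coproducts. *)
Lemma drinfeld_twist_S h : Δ (S h) * drinfeld_twist_inv Q = drinfeld_twist_inv Q * S2 h.
Proof.
rewrite drinfeld_twistE; set y := phi3 _ _ _ _ _ _.
have e1 : Δ (S h) * Ptwist y = Ptwist (y * st 3 0%N h).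
  move: y; apply: tpow_eq_lin => [||w].
  - by apply: lin_mulr; apply: Ptwist_lin.
  - by apply: (lin_comp Ptwist_lin); apply: lin_mull; apply: lin_idf.
  rewrite word_tio // /Ptwist !(teval_word P _ mlin_Ktwist) /Ktwist; wsimp.
  by rewrite qSM !mulrA -!rmorphM !mulrA.
have e2 : Ptwist y * S2 h = Ptwist (st 3 2%N h * y).
  move: y {e1}; apply: tpow_eq_lin => [||w].
  - by apply: lin_mull; apply: Ptwist_lin.
  - by apply: (lin_comp Ptwist_lin); apply: lin_mulr; apply: lin_idf.
  rewrite tio_word // /Ptwist !(teval_word P _ mlin_Ktwist) /Ktwist; wsimp.
  by rewrite S2M !mulrA.
rewrite e1 e2.
have [_ s1] := sim_unitr (t := L 0) (u := L 1 ∙ L 2) Ptwist_lin isT absorb_twist12.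
have [_ s2] := sim_unitl (t := L 2) (u := L 0 ∙ L 1) Ptwist_lin isT absorb_twist01.
rewrite -[LHS]/(Ptwist (side false (tcop 3 (L 0) h) y)) -s1.
rewrite -[RHS]/(Ptwist (side true (tcop 3 (L 2) h) y)) -s2 /side.
congr Ptwist.
exact: (esym (nat_el Q (st 3) (m := (false, L 0, L 1, L 2)) h (StepHere _) isT)).
Qed.

Definition Kalpha (w : nat -> H) : H ⊗ H :=
  Δ (S (w 0) * α * w 1) * drinfeld_delta Q * S2 (w 2) * drinfeld_gamma * Δ (w 3).
Definition Palpha := teval (t := P) (n := 4) Kalpha.

Lemma mlin_Kalpha : mlin 4 Kalpha.
Proof. by rewrite /Kalpha /=; do !split=> *; lin_tac. Qed.

Lemma Palpha_lin : lin Palpha. Proof. exact: teval_lin mlin_Kalpha. Qed.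

Lemma absorb_alpha12 : absorb Q (st 4) Palpha false (L 1 ∙ L 2).
Proof.
apply: (absorb_right mlin_Kalpha) => // w h; rewrite /Kalpha; wsimp.
under eq_tsum => h1 h2 do rewrite S2M !mulrA rmorphM.
have linF : lin (fun z => Δ (S (w 0) * α * w 1) * z * S2 (w 2) * drinfeld_gamma * Δ (w 3)).
  by lin_tac.
rewrite -(linZ linF) -drinfeld_delta_absorb (lin_push _ _ linF).
by apply: eq_tsum => h1 h2; rewrite !mulrA.
Qed.

Lemma absorb_alpha01 : absorb Q (st 4) Palpha true (L 0 ∙ L 1).
Proof.
apply: (absorb_left mlin_Kalpha) => // w h; rewrite /Kalpha; wsimp.
under eq_tsum => h1 h2 do rewrite qSM !mulrA.
rewrite -(antipodel_lin (F := fun z => Δ (S (w 0) * z * w 1) * drinfeld_delta Q * S2 (w 2)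
  * drinfeld_gamma * Δ (w 3))).
  by apply: eq_tsum => h1 h2; rewrite !mulrA.
by lin_tac.
Qed.

Lemma absorb_alpha23 : absorb Q (st 4) Palpha true (L 2 ∙ L 3).
Proof.
apply: (absorb_left mlin_Kalpha) => // w h; rewrite /Kalpha; wsimp.
under eq_tsum => h1 h2 do rewrite S2M (rmorphM Δ h2) !mulrA.
have linF : lin (fun z => Δ (S (w 0) * α * w 1) * drinfeld_delta Q * S2 (w 2) * z * Δ (w 3)).
  by lin_tac.
rewrite -(linZ linF) -drinfeld_gamma_absorb (lin_push _ _ linF).
by apply: eq_tsum => h1 h2; rewrite !mulrA.
Qed.

(** The product gγ is a value at Φ^-1 on 0, 1, 2. The pentagon replaces it by four associators;
    three contain the absorbed pair 01, 23 or 12 and vanish, and Φ on 1, 2, 3 gives Δ(α) times the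
    zigzag, which is 1. *)
Lemma drinfeld_twist_alpha : Δ α = drinfeld_twist_inv Q * drinfeld_gamma.
Proof.
have -> : drinfeld_twist_inv Q * drinfeld_gamma =
    Palpha (tpel 4 [:: (false, L 0, L 1, L 2)]).
  rewrite [pel _ _ _]/= mul1r /drinfeld_twist_inv (tsum_mull Φi).
  rewrite /phi3 (lin_push _ _ Palpha_lin); apply: eq_tsum => a x.
  rewrite (tsum_mull x) (lin_push _ _ Palpha_lin); apply: eq_tsum => b c.
  rewrite /Palpha -[X in teval _ X]mulr1 -!mulrA.
  rewrite (teval_wprod1 P (l := [:: (0, a); (1, b); (2, c)]) mlin_Kalpha erefl).
  by rewrite /Kalpha; wsimp; rewrite !mulr1 rmorph1 mulr1 !mulrA.
rewrite (@coherence _ _ _ Q (st 4) _ [:: (true, L 0, L 1 ∙ L 2, L 3); (true, L 1, L 2, L 3);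
  (false, L 0, L 1, L 2 ∙ L 3); (false, L 0 ∙ L 1, L 2, L 3)] ((L 0 ∙ (L 1 ∙ L 2)) ∙ L 3)
  (((L 0 ∙ L 1) ∙ L 2) ∙ L 3)) //.
rewrite [pel _ _ _]/= mul1r -!mulrA.
rewrite -[RHS]/(Palpha (side true (tel 4 (false, L 0 ∙ L 1, L 2, L 3)) _)).
rewrite (phi3_unit1 Palpha_lin _ _ _ absorb_alpha01) //.
rewrite -[RHS]/(Palpha (side true (tel 4 (false, L 0, L 1, L 2 ∙ L 3)) _)).
rewrite (phi3_unit3 Palpha_lin _ _ _ absorb_alpha23) //.
rewrite -[RHS]/(Palpha (side false (tel 4 (true, L 0, L 1 ∙ L 2, L 3)) _)).
rewrite (phi3_unit2 Palpha_lin _ _ _ absorb_alpha12) //.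
rewrite -[LHS]mulr1 -drinfeld_zigzag (tsum_mulr Φ) /phi3 (lin_push _ _ Palpha_lin).
apply: eq_tsum => a x; rewrite (tsum_mulr x) (lin_push _ _ Palpha_lin).
apply: eq_tsum => b c; rewrite /Palpha -[X in teval _ X]mulr1 -!mulrA.
rewrite (teval_wprod1 P (l := [:: (1, a); (2, b); (3, c)]) mlin_Kalpha erefl).
by rewrite /Kalpha; wsimp; rewrite !mulr1 qS1 mul1r rmorphM !mulrA.
Qed.

End Drinfeld.

(** * The coaction of H_0 *)

Lemma tsum_float (k : fieldType) (U V U' V' : lmodType k) (W : zmodType) (x : U ⊗ V)
    (G : U -> V -> W) (y : U' ⊗ V') (F : U -> V -> U' -> V' -> W) :
  (forall a b, G a b = tsum y (F a b)) ->
  tsum x G = tsum y (fun c d => tsum x (fun a b => F a b c d)).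
Proof. by move=> e; rewrite -tsumC; apply: eq_tsum. Qed.

(* [float y n] brings the n-th sum over y of the left-hand side to the front. *)
Ltac float y n :=
  cbv beta;
  lazymatch goal with
  | |- @eq _ (tsum y _) _ =>
      lazymatch n with
      | O => reflexivity
      | S ?m => eapply tsum_float; intros ? ?; float y m
      end
  | |- @eq _ (tsum _ _) _ => eapply tsum_float; intros ? ?; float y n
  end.

Ltac peel y n := etransitivity; [float y n | apply: eq_tsum].

Section H0.
Variables (k : fieldType) (H : algType k) (Q : quasiHopf H) (P : tensorPowers Q).
Local Notation Δ := (qDelta Q).
Local Notation Φ := (qPhi Q).
Local Notation Φi := (qPhi_inv Q).
Local Notation S := (qS Q).
Local Notation α := (qalpha Q).
Local Notation g := (drinfeld_twist_inv Q).
Local Notation st n := (tpow_strands P n).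
Local Notation tcop n := (cop Q (tpow_strands P n)).
Local Notation tel n := (el Q (tpow_strands P n)).
Local Notation L i := (Lf i).
Local Infix "∙" := Nd (at level 38, left associativity).

Lemma tsum_q_R (W : lmodType k) (F : H -> H -> W) : bilin F ->
  tsum (q_R Q) F = \sw[X1, X2, X3 <- Φ] F X1 (qSinv Q (α * X3) * X2).
Proof.
move=> bF; rewrite /q_R tsum_tsum //; apply: eq_tsum => a x.
by rewrite tsum_tsum //; apply: eq_tsum => b c; rewrite tsumE.
Qed.

Lemma elT (T : algType k) (I : strands H T) r s t : el Q I (true, r, s, t) =
  \sw[X1, X2, X3 <- Φ] (cop Q I r X1 * cop Q I s X2 * cop Q I t X3).
Proof. by []. Qed.

Lemma elF (T : algType k) (I : strands H T) r s t : el Q I (false, r, s, t) =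
  \sw[X1, X2, X3 <- Φi] (cop Q I r X1 * cop Q I s X2 * cop Q I t X3).
Proof. by []. Qed.

(** [D] is meant to be Δ(h) g. The inverse antipode in q_R disappears under S, since S(S^-1(α X^3)
    X^2) = S(X^2) α X^3; this is the pairing of strands 3 and 4. *)
Definition KH0 (D : H ⊗ H) (w : nat -> H) : H ⊗ H :=
  \sw[u, v <- D] ((w 0 * u * S (w 3) * α * w 4) ⊗ (w 1 * v * S (w 2))).

Lemma mlin_KH0 D : mlin 5 (KH0 D).
Proof. by rewrite /KH0 /=; do !split=> *; lin_tac. Qed.

Definition PH0 D := teval (t := P) (n := 5) (KH0 D).
Lemma PH0_lin D : lin (PH0 D). Proof. exact: teval_lin (mlin_KH0 D). Qed.

(** The path from ((01)(23))4 to 0(1(2(34))), except that in its last associator the absorbed pair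
    34 is deleted from the letter 2(34). *)
Lemma H0_coactE h : H0_coact Q h = PH0 (Δ h * g)
  (tel 5 (true, L 0, L 1, L 2) * tel 5 (true, L 2, L 3, L 4) *
   tel 5 (true, L 0 ∙ L 1, L 2 ∙ L 3, L 4)).
Proof.
rewrite /H0_coact.
etransitivity; [float (q_R Q) 0%N|].
rewrite tsum_q_R; last by lin_tac.
move eW: (tel 5 (true, L 0 ∙ L 1, _, _)) => yW; move eQ: (tel 5 (true, L 2, _, _)) => yQ.
pose push := fun U V x F => @lin_push k U V _ _ _ x F (PH0_lin (Δ h * g)).
rewrite elT !(tsum_mull Φ) push; peel (qPhi Q) 1%N => X1 x.
rewrite !(tsum_mull x) push; peel x 0%N => X2 X3.
rewrite -eQ elT (tsum_mulr Φ) (tsum_mull Φ) push; peel (qPhi Q) 0%N => Q1 q.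
rewrite (tsum_mulr q) (tsum_mull q) push; peel q 0%N => Q2 Q3.
rewrite -eW elT (tsum_mulr Φ) push; peel (qPhi Q) 0%N => Y1 y.
rewrite (tsum_mulr y) push; peel y 0%N => Y2 Y3.
rewrite [tcop 5 (_ ∙ L 1) _]/= !(tsum_mull (Δ Y1)) (tsum_mulr (Δ Y1)) push.
peel (qDelta Q Y1) 0%N => Y11 Y12.
rewrite [tcop 5 (_ ∙ L 3) _]/= !(tsum_mull (Δ Y2), tsum_mulr (Δ Y2)) push.
peel (qDelta Q Y2) 0%N => Y21 Y22.
rewrite /PH0 -[X in teval _ X]mulr1 -!mulrA.
rewrite (teval_wprod1 P (l := [:: (0, X1); (1, X2); (2, X3); (2, Q1); (3, Q2); (4, Q3);
  (0, Y11); (1, Y12); (2, Y21); (3, Y22); (4, Y3)]%N) (mlin_KH0 _) erefl).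
rewrite /KH0; wsimp; rewrite tsum_mul; last by lin_tac.
peel (qDelta Q h) 0%N => h1 h2; apply: eq_tsum => g1 g2.
by rewrite !mulr1 !qSM (qSinvK Q) !mulrA.
Qed.

(** The factor g on the right turns Δ(S x^2) into [S2], so the action on h becomes a two-sided
    multiplication of Δ(h) g. *)
Lemma twist_act x h : Δ (twisted_act Q *%R id x h) * g =
  \sw[x1, x2 <- Δ x] (Δ x1 * (Δ h * g) * S2 Q x2).
Proof.
rewrite /twisted_act (lin_push (f := Δ)); last by lin_tac.
rewrite (tsum_mull (Δ x)); apply: eq_tsum => a b.
by rewrite !rmorphM -!mulrA (drinfeld_twist_S P).
Qed.

Lemma tsum_S2 (W : lmodType k) (G : H -> H -> W) a b (D : H ⊗ H) : bilin G ->
  tsum (Δ a * D * S2 Q b) G =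
  \sw[a1, a2 <- Δ a] \sw[b1, b2 <- Δ b] \sw[u, v <- D] G (a1 * u * S b2) (a2 * v * S b1).
Proof.
move=> bG; have lG1 v : lin (fun u => G u v) := proj1 bG v.
have lG2 u : lin (fun v => G u v) := proj2 bG u.
have lG (f1 f2 : H -> H) : lin f1 -> lin f2 -> bilin (fun u v => G (f1 u) (f2 v)).
  by move=> h1 h2; apply: bilinP => x; [apply: (lin_comp (lG1 _)) | apply: (lin_comp (lG2 _))].
rewrite -mulrA tsum_mul //; apply: eq_tsum => a1 a2.
rewrite tsum_mul; last by apply: lG; lin_tac.
rewrite /S2; under eq_tsum => u v do (rewrite tsum_tsum; last by apply: lG; lin_tac).
rewrite tsumC; apply: eq_tsum => b1 b2; apply: eq_tsum => u v.
by rewrite tsumE ?mulrA //; apply: lG; lin_tac.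
Qed.

(** * Functionals containing one coaction of H_0, shared by colinearity and multiplicativity *)

Section Link.
Variables (W : lmodType k) (F : H -> H -> H -> H -> H -> W).
Hypothesis hF0 : forall b c d e, lin (fun a => F a b c d e).
Hypothesis hF1 : forall a c d e, lin (fun b => F a b c d e).
Hypothesis hF2 : forall a b d e, lin (fun c => F a b c d e).
Hypothesis hF3 : forall a b c e, lin (fun d => F a b c d e).
Hypothesis hF4 : forall a b c d, lin (fun e => F a b c d e).

Ltac lin_ext ::= first
  [ apply: lin_io; lin_tac | apply: lin_cop; lin_tac | apply: lin_S2; lin_tac
  | apply: (lin_comp (hF0 _ _ _ _)); lin_tac | apply: (lin_comp (hF1 _ _ _ _)); lin_tac
  | apply: (lin_comp (hF2 _ _ _ _)); lin_tac | apply: (lin_comp (hF3 _ _ _ _)); lin_tac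
  | apply: (lin_comp (hF4 _ _ _ _)); lin_tac ].

(* Strands: 1 and 2 act on the two legs of D from the left, 3 and 4 from the
   right through S, 5 is evaluated against 4; 0, 6 and 7 only enter F. *)
Definition K8 (D : H ⊗ H) (w : nat -> H) : W :=
  \sw[u, v <- D] F (w 0) (w 6) (w 7) (w 1 * u * S (w 4) * α * w 5) (w 2 * v * S (w 3)).

(** The situation before the coaction of H_0 is expanded; [e] and [c] are its two legs. Strands 4
    and 5 here are 6 and 7 of [K8]. *)
Definition K6 (e c : H) (w : nat -> H) : W :=
  F (w 0) (w 4) (w 5) (w 1 * e) (w 2 * c * S (w 3)).

Lemma mlin_K8 D : mlin 8 (K8 D).
Proof. by rewrite /K8 /=; do !split=> *; lin_tac. Qed.

Lemma mlin_K6 e c : mlin 6 (K6 e c).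
Proof. by rewrite /K6 /=; do !split=> *; lin_tac. Qed.

Definition eval8 D := teval (t := P) (n := 8) (K8 D).
Definition eval6 e c := teval (t := P) (n := 6) (K6 e c).

Lemma P8_lin D : lin (eval8 D). Proof. exact: teval_lin (mlin_K8 D). Qed.
Lemma P6_lin e c : lin (eval6 e c). Proof. exact: teval_lin (mlin_K6 e c). Qed.

Lemma absorb_P8 D : absorb Q (st 8) (eval8 D) true (L 4 ∙ L 5).
Proof.
apply: (absorb_left (mlin_K8 D)) => // w h; rewrite /K8; wsimp.
rewrite tsumC.
under eq_tsum => u v do (under eq_tsum => h1 h2 do rewrite qSM !mulrA).
rewrite -(@antipodel_lin _ _ Q _ (fun z =>
    \sw[u, v <- D] F (w 0) (w 6) (w 7) (w 1 * u * S (w 4) * z * w 5) (w 2 * v * S (w 3)))).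
  by rewrite tsumC; apply: eq_tsum => h1 h2; apply: eq_tsum => u v; rewrite !mulrA.
by lin_tac.
Qed.

Lemma P8_twist a b D y : eval8 (Δ a * D * S2 Q b) y =
  eval8 D (y * (tcop 8 (L 1 ∙ L 2) a * tcop 8 (L 3 ∙ L 4) b)).
Proof.
move: y; apply: tpow_eq_lin => [||w].
- exact: P8_lin.
- by apply: (lin_comp (P8_lin _)); apply: lin_mull; apply: lin_idf.
rewrite [LHS](teval_word P _ (mlin_K8 _)) [LHS]/K8; wsimp.
rewrite tsum_S2; last by lin_tac.
rewrite (tsum_mull (Δ a)) (tsum_mulr (Δ a)) (lin_push _ _ (P8_lin D)).
apply: eq_tsum => a1 a2.
rewrite !(tsum_mulr (Δ b)) (lin_push _ _ (P8_lin D)); apply: eq_tsum => b1 b2.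
rewrite !mulrA !word_tio // [RHS](teval_word P _ (mlin_K8 _)) [RHS]/K8; wsimp.
by apply: eq_tsum => u v; rewrite !qSM !mulrA.
Qed.

(** The action spreads along (12)(34), the bracketing from which the path of the coaction starts. *)
Lemma P8_act x h y :
  eval8 (Δ (twisted_act Q *%R id x h) * g) y =
  eval8 (Δ h * g) (y * tcop 8 ((L 1 ∙ L 2) ∙ (L 3 ∙ L 4)) x).
Proof.
rewrite twist_act; set D := Δ h * g.
rewrite [RHS]/= (tsum_mulr (Δ x)) (lin_push _ _ (P8_lin D)).
under [RHS]eq_tsum => a b do rewrite -P8_twist.
move: y; apply: tpow_eq_lin => [||w].
- exact: P8_lin.
- by apply: lin_tsumF => u v; apply: P8_lin.
rewrite [LHS](teval_word P _ (mlin_K8 _)) [LHS]/K8 tsum_tsum; last by lin_tac.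
by apply: eq_tsum => a b; rewrite [RHS](teval_word P _ (mlin_K8 _)).
Qed.

(** [fat] turns the strands of [K6] into letters over those of [K8], [mid] those of [KH0]. The path
    of the coaction ends in 1(2(3(45))), so strand 3 is thickened to 3(45) for an outer path to
    continue it; 45 is absorbed. *)
Definition fat := [:: L 0; L 1; L 2; L 3 ∙ (L 4 ∙ L 5); L 6; L 7].
Definition mid := [:: L 1; L 2; L 3; L 4; L 5].
Lemma uniq_fat : uniq (flatten (map labels fat)). Proof. by []. Qed.
Lemma uniq_mid : uniq (flatten (map labels mid)). Proof. by []. Qed.

Definition thin (w : nat -> H) : tpow P 8 :=
  st 8 0%N (w 0) * (st 8 1%N (w 1) * (st 8 2%N (w 2) * (st 8 3%N (w 3) *
  (st 8 6%N (w 4) * (st 8 7%N (w 5) * 1))))).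

Lemma P8_fat D w y : eval8 D (subst (st 8) uniq_fat (word P 6 w) * y) = eval8 D (thin w * y).
Proof.
rewrite (subst_word P (st 8) uniq_fat w) /= /thin.
set c := (X in _ * (_ * (_ * (X * _)))).
have cC i (z : tpow P 8) x : disj [:: i] [:: 3; 4; 5] ->
    st 8 i x * (c * z) = c * (st 8 i x * z).
  by move=> d; apply: commCA; apply: (@cop_comm _ _ _ Q (st 8) (L i) (L 3 ∙ (L 4 ∙ L 5))).
rewrite !cC // -[X in eval8 D X]mulrA.
have [_ sm] := sim_unitr (t := L 3) (u := L 4 ∙ L 5) (P8_lin D) isT (@absorb_P8 D).
have := sm (w 3); rewrite /side -/c => -> /=.
have iC i (z : tpow P 8) x : 3 != i ->
    st 8 3%N (w 3) * (st 8 i x * z) = st 8 i x * (st 8 3%N (w 3) * z).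
  by move=> ni; apply: commCA; apply: ioC.
by rewrite -!mulrA !iC.
Qed.

Lemma thin_cm w : cm (st 8) [:: 4; 5]%N (thin w).
Proof.
by do ?apply: cm_mul; try exact: cm1; move=> i h; rewrite !inE => /orP[]/eqP->;
  apply: ioC.
Qed.

(** Expands the coaction of H_0 inside a functional: the outer path [y] is read on the letters [fat]
    and continues the path of the coaction. A factor [r] to the right of the first leg lands on
    strand 5, the last factor of that leg. *)
Lemma eval8_H0_coact h r y :
  tsum (H0_coact Q h) (fun e c => eval6 (e * r) c y) =
  eval8 (Δ h * g) (subst (st 8) uniq_fat y * (tel 8 (true, L 1, L 2, L 3 ∙ (L 4 ∙ L 5)) *
    tel 8 (true, L 3, L 4, L 5) * tel 8 (true, L 1 ∙ L 2, L 3 ∙ L 4, L 5)) * st 8 5%N r).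
Proof.
move: y; apply: tpow_eq_lin => [||w].
- by apply: lin_tsumF => u v; apply: P6_lin.
- by apply: (lin_comp (P8_lin _)); do 2!apply: lin_mull; exact: (subst_lin (P := P) (st 8) uniq_fat).
under eq_tsum => e c do rewrite /eval6 (teval_word P _ (mlin_K6 _ _)).
rewrite -2!mulrA P8_fat.
set D := _ * g.
have lin_w : lin (fun z => eval8 D (thin w * z)).
  by apply: (lin_comp (P8_lin D)); apply: lin_mulr; apply: lin_idf.
have ab_w : absorb Q (st 8) (fun z => eval8 D (thin w * z)) true (L 4 ∙ L 5).
  move=> x z; apply: (absorb_side (z := thin w) (b := true) (@absorb_P8 D)).
  exact: thin_cm.
rewrite -[X in thin w * X]mulrA. set R := tel 8 (true, L 3, L 4, L 5) * _.
have -> : eval8 D (thin w * (tel 8 (true, L 1, L 2, L 3 ∙ (L 4 ∙ L 5)) * R)) =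
    eval8 D (thin w * (tel 8 (true, L 1, L 2, L 3) * R)).
  apply: (sim_phi3 lin_w (b := true) _ R) => //; try exact: sim_refl.
  exact: (sim_unitr lin_w _ ab_w).
have key z : tsum (PH0 D z) (fun e c => K6 (e * r) c w) =
    eval8 D (thin w * (subst (st 8) uniq_mid z * st 8 5%N r)).
  move: z; apply: tpow_eq_lin => [||v].
  - by apply: lin_tsumx; [rewrite /K6; lin_tac | apply: PH0_lin].
  - apply: (lin_comp (P8_lin D)); apply: lin_mulr; apply: lin_mull.
    exact: (subst_lin (P := P) (st 8) uniq_mid).
  rewrite (subst_word P (st 8) uniq_mid v) /= /PH0 (teval_word P _ (mlin_KH0 _)).
  rewrite /KH0 tsum_tsum; last by rewrite /K6; lin_tac.
  rewrite /thin -!mulrA mul1r /eval8 -[X in teval _ X]mulr1 -!mulrA !mul1r.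
  rewrite (teval_wprod1 P (l := [:: (0, w 0); (1, w 1); (2, w 2); (3, w 3); (6, w 4);
    (7, w 5); (1, v 0); (2, v 1); (3, v 2); (4, v 3); (5, v 4); (5, r)]%N) (mlin_K8 _) erefl).
  rewrite /K8; wsimp; apply: eq_tsum => e c; rewrite tsumE; last by rewrite /K6; lin_tac.
  by rewrite /K6 !mulr1 !qSM !mulrA.
by rewrite H0_coactE key !substM !(subst_el P (st 8) uniq_mid) // -!mulrA.
Qed.

End Link.
End H0.

(** * Colinearity *)

Section Algebra.
Variables (k : fieldType) (H : algType k) (Q : quasiHopf H) (P : tensorPowers Q).
Variables (A : lmodType k) (OA : ydAlgOps H A) (hA : is_yd_algebra Q OA).
Local Notation Δ := (qDelta Q).
Local Notation ε := (qeps Q).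
Local Notation Φ := (qPhi Q).
Local Notation Φi := (qPhi_inv Q).
Local Notation S := (qS Q).
Local Notation α := (qalpha Q).
Local Notation g := (drinfeld_twist_inv Q).
Local Notation st n := (tpow_strands P n).
Local Notation tcop n := (cop Q (tpow_strands P n)).
Local Notation tel n := (el Q (tpow_strands P n)).
Local Notation L i := (Lf i).
Local Infix "∙" := Nd (at level 38, left associativity).
Local Notation "h · a" := (yd_act OA h a) (at level 39, left associativity).
Local Notation coact := (yd_coact OA).
Local Notation "h ▷ c" := (twisted_act Q *%R id h c) (at level 39, left associativity).

Lemma act_linl (U : lmodType k) (f : U -> H) a : lin f -> lin (fun x => f x · a).
Proof.
by case: hA => [[[[b _] _ _] _] _ _ _] hf r x y; rewrite hf; apply: (b a).
Qed.

Lemma act_linr (U : lmodType k) (f : U -> A) h : lin f -> lin (fun x => h · f x).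
Proof.
by case: hA => [[[[_ b] _ _] _] _ _ _] hf r x y; rewrite hf; apply: (b h).
Qed.

Lemma act1 a : 1 · a = a.
Proof. by case: hA => [[[_ e _] _] _ _ _]. Qed.

Lemma actM h h' a : (h * h') · a = h · (h' · a).
Proof. by case: hA => [[[_ _ e] _] _ _ _]. Qed.

Lemma mul_linl (U : lmodType k) (f : U -> A) a : lin f -> lin (fun x => yd_mul OA (f x) a).
Proof.
by case: hA => [[_ [[b _] _]] _ _ _] hf r x y; rewrite hf; apply: (b a).
Qed.

Lemma mul_linr (U : lmodType k) (f : U -> A) a : lin f -> lin (fun x => yd_mul OA a (f x)).
Proof.
by case: hA => [[_ [[_ b] _]] _ _ _] hf r x y; rewrite hf; apply: (b a).
Qed.

Lemma yd_mul1l a : yd_mul OA (yd_one OA) a = a.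
Proof. by case: hA => [[_ [_ [e _]]] _ _ _]. Qed.

Lemma yd_mul1r a : yd_mul OA a (yd_one OA) = a.
Proof. by case: hA => [[_ [_ [_ [e _]]]] _ _ _]. Qed.

Lemma act_mul h a b : h · (yd_mul OA a b) = \sw[h1, h2 <- Δ h] yd_mul OA (h1 · a) (h2 · b).
Proof. by case: hA => [[_ [_ [_ [_ [_ e _]]]]] _ _ _]. Qed.

Lemma act_one h : h · yd_one OA = ε h *: yd_one OA.
Proof. by case: hA => [[_ [_ [_ [_ [_ _ e]]]]] _ _ _]. Qed.

Lemma coact_lin (U : lmodType k) (f : U -> A) : lin f -> lin (fun x => coact (f x)).
Proof. by case: hA => [_ [_ [l _]] _ _] hf r x y; rewrite hf; apply: l. Qed.

Lemma coact_act h m :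
  \sw[h1, h2 <- Δ h] \sw[a, m0 <- coact m] ((h1 * a) ⊗ (h2 · m0)) =
  \sw[h1, h2 <- Δ h] \sw[a, m0 <- coact (h1 · m)] ((a * h2) ⊗ m0).
Proof. by case: hA => [_ [_ [_ [_ _ e]]] _ _]. Qed.

Ltac lin_ext ::= first
  [ apply: act_linl; lin_tac | apply: act_linr; lin_tac | apply: coact_lin; lin_tac
  | apply: mul_linl; lin_tac | apply: mul_linr; lin_tac
  | apply: lin_io; lin_tac | apply: lin_cop; lin_tac | apply: lin_S2; lin_tac ].

Lemma bilin_smash_Pi :
  bilin (fun a h => \sw[x1, x2, x3 <- Φi] ((x1 · a) ⊗ (x2 * h * S x3)) : A ⊗ H).
Proof. lin_tac. Qed.

Lemma smash_Pi_lin : lin (smash_Pi Q OA).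
Proof. exact: (tsum_linear bilin_smash_Pi). Qed.

Lemma smash_PiE a h :
  smash_Pi Q OA (a ⊗ h) = \sw[x1, x2, x3 <- Φi] ((x1 · a) ⊗ (x2 * h * S x3)).
Proof. exact: (tsumE bilin_smash_Pi). Qed.

Lemma smash_coact_lin : lin (smash_coact Q OA).
Proof. by rewrite /smash_coact; lin_tac. Qed.

Section Coaction.

(** Strand 0 acts on a before its coaction, strands 7 and 6 on the two outputs; [e] and [c] come
    from H. *)
Definition Fco a (w0 w6 w7 e c : H) : H ⊗ A ⊗ H :=
  \sw[a', a0 <- coact (w0 · a)] ((w7 * a' * e) ⊗ (w6 · a0) ⊗ c).

Lemma Fco0 a w6 w7 e c : lin (fun w0 => Fco a w0 w6 w7 e c).
Proof. by rewrite /Fco; lin_tac. Qed.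
Lemma Fco1 a w0 w7 e c : lin (fun w6 => Fco a w0 w6 w7 e c).
Proof. by rewrite /Fco; lin_tac. Qed.
Lemma Fco2 a w0 w6 e c : lin (fun w7 => Fco a w0 w6 w7 e c).
Proof. by rewrite /Fco; lin_tac. Qed.
Lemma Fco3 a w0 w6 w7 c : lin (fun e => Fco a w0 w6 w7 e c).
Proof. by rewrite /Fco; lin_tac. Qed.
Lemma Fco4 a w0 w6 w7 e : lin (fun c => Fco a w0 w6 w7 e c).
Proof. by rewrite /Fco; lin_tac. Qed.

Local Notation P8 a := (@eval8 _ _ Q P _ (Fco a)).
Local Notation P6 a := (@eval6 _ _ Q P _ (Fco a)).

Lemma P8co_lin a D : lin (P8 a D).
Proof. exact: (P8_lin (Fco0 a) (Fco1 a) (Fco2 a) (Fco3 a) (Fco4 a)). Qed.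
Lemma P6co_lin a e c : lin (P6 a e c).
Proof. exact: (P6_lin (Fco0 a) (Fco1 a) (Fco2 a) (Fco3 a) (Fco4 a)). Qed.
Lemma mlin_K8co a D : mlin 8 (K8 Q (Fco a) D).
Proof. exact: (mlin_K8 Q (Fco0 a) (Fco1 a) (Fco2 a) (Fco3 a) (Fco4 a)). Qed.
Lemma mlin_K6co a e c : mlin 6 (K6 Q (Fco a) e c).
Proof. exact: (mlin_K6 Q (Fco0 a) (Fco1 a) (Fco2 a) (Fco3 a) (Fco4 a)). Qed.

(** This product is not a path: the associator on 0, 1, 2 ends at (01)2, but the next one starts
    from (76)2. The coaction of A lies in between. *)
Lemma smash_coactE a h : smash_coact Q OA (a ⊗ h) = P8 a (Δ h * g)
  (tel 8 (true, L 7, L 6 ∙ L 2, L 3) * tel 8 (true, L 3, L 4, L 5) *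
   tel 8 (true, L 7 ∙ (L 6 ∙ L 2), L 3 ∙ L 4, L 5) * tel 8 (true, L 7, L 6, L 2) *
   tel 8 (false, L 0, L 1, L 2)).
Proof.
rewrite /smash_coact tsumE; last by lin_tac.
etransitivity; [float (q_R Q) 0%N|].
rewrite tsum_q_R; last by lin_tac.
move eD: (Δ h * g) => D; move et: (tel 8 (false, _, _, _)) => yt; move eT: (tel 8 (true, _, L 6, L 2)) => yT.
move eY: (tel 8 (true, _, L 3 ∙ L 4, _)) => yY; move eQ: (tel 8 (true, L 3, _, _)) => yQ.
pose push := fun U V x F => @lin_push k U V _ _ _ x F (P8co_lin a D).
rewrite elT !(tsum_mull Φ) push; peel (qPhi Q) 1%N => X1 x.
rewrite !(tsum_mull x) push; peel x 0%N => X2 X3.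
rewrite [tcop 8 (_ ∙ L 2) _]/= (tsum_mulr (Δ X2)) !(tsum_mull (Δ X2)) push.
peel (qDelta Q X2) 0%N => X21 X22.
rewrite -eQ elT (tsum_mulr Φ) !(tsum_mull Φ) push; peel (qPhi Q) 0%N => Q1 q.
rewrite (tsum_mulr q) !(tsum_mull q) push; peel q 0%N => Q2 Q3.
rewrite -eY elT (tsum_mulr Φ) !(tsum_mull Φ) push; peel (qPhi Q) 0%N => Y1 y.
rewrite (tsum_mulr y) !(tsum_mull y) push; peel y 0%N => Y2 Y3.
rewrite [tcop 8 (L 7 ∙ _) _]/=.
rewrite !(tsum_mulr (Δ Y1), tsum_mull (Δ Y1)) push.
peel (qDelta Q Y1) 0%N => Y11 Y12.
rewrite !(tsum_mulr (Δ Y12), tsum_mull (Δ Y12)) push.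
peel (qDelta Q Y12) 0%N => Y121 Y122.
rewrite [tcop 8 (L 3 ∙ _) _]/=.
rewrite !(tsum_mulr (Δ Y2), tsum_mull (Δ Y2)) push.
peel (qDelta Q Y2) 0%N => Y21 Y22.
rewrite -eT elT (tsum_mulr Φ) !(tsum_mull Φ) push; peel (qPhi Q) 0%N => T1 t.
rewrite (tsum_mulr t) !(tsum_mull t) push; peel t 0%N => T2 T3.
rewrite -et elF (tsum_mulr Φi) push; peel (qPhi_inv Q) 0%N => t1 t'.
rewrite (tsum_mulr t') push; peel t' 0%N => t2 t3.
rewrite /eval8 -[X in teval _ X]mulr1 -!mulrA.
rewrite (teval_wprod1 P (l := [:: (7, X1); (6, X21); (2, X22); (3, X3); (3, Q1); (4, Q2);
  (5, Q3); (7, Y11); (6, Y121); (2, Y122); (3, Y21); (4, Y22); (5, Y3); (7, T1); (6, T2);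
  (2, T3); (0, t1); (1, t2); (2, t3)]%N) (mlin_K8co _ _) erefl).
rewrite /K8 /Fco -eD; wsimp; rewrite tsum_mul; last by lin_tac.
peel (qDelta Q h) 0%N => h1 h2; peel (drinfeld_twist_inv Q) 0%N => g1 g2.
rewrite !mulr1; apply: eq_tsum => a' a0.
by rewrite !qSM (qSinvK Q) !mulrA.
Qed.

Lemma P8co_act a x D y : P8 (x · a) D y = P8 a D (y * st 8 0%N x).
Proof.
move: y; apply: tpow_eq_lin => [||w].
- exact: P8co_lin.
- by apply: (lin_comp (P8co_lin _ _)); apply: lin_mull; apply: lin_idf.
rewrite word_tio // [LHS](teval_word P _ (mlin_K8co _ _)).
rewrite [RHS](teval_word P _ (mlin_K8co _ _)) /K8 /Fco; wsimp.
by apply: eq_tsum => u v; rewrite actM.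
Qed.

(** The compatibility of action and coaction on strands. Factors on 7 and 6 closest to the coaction
    are the rightmost ones in the product; they become factors applied to a before the coaction and,
    on strand 1, directly after its first output. *)
Lemma P8co_braid a D x y :
  P8 a D (y * tcop 8 (L 7 ∙ L 6) x) = P8 a D (tcop 8 (L 0 ∙ L 1) x * y).
Proof.
move: y; apply: tpow_eq_lin => [||w].
- by apply: (lin_comp (P8co_lin _ _)); apply: lin_mull; apply: lin_idf.
- by apply: (lin_comp (P8co_lin _ _)); apply: lin_mulr; apply: lin_idf.
rewrite [tcop 8 (L 7 ∙ _) _]/= [tcop 8 (L 0 ∙ _) _]/=.
rewrite (tsum_mulr (Δ x)) (tsum_mull (Δ x)) !(lin_push _ _ (P8co_lin a D)).
pose G (p : H) (q : A) := \sw[u, v <- D]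
  ((w 7 * p * (w 1 * u * S (w 4) * α * w 5)) ⊗ (w 6 · q) ⊗ (w 2 * v * S (w 3))).
have bG : bilin G by rewrite /G; lin_tac.
have := congr1 (fun t => tsum t G) (coact_act x (w 0 · a)).
rewrite !(tsum_tsum _ _ bG).
under eq_tsum => h1 h2 do rewrite tsum_tsum //.
under [in RHS]eq_tsum => h1 h2 do rewrite tsum_tsum //.
move=> e; transitivity (\sw[h1, h2 <- Δ x] \sw[u, v <- coact (w 0 · a)]
    G (h1 * u) (h2 · v)); [|transitivity (\sw[h1, h2 <- Δ x]
    \sw[u, v <- coact (h1 · (w 0 · a))] G (u * h2) v)].
- apply: eq_tsum => h1 h2.
  rewrite mulrA !word_tio // [LHS](teval_word P _ (mlin_K8co _ _)) /K8 /Fco; wsimp.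
  rewrite tsumC; apply: eq_tsum => u v; rewrite /G.
  by apply: eq_tsum => u' v'; rewrite actM !mulrA.
- move: e; congr (_ = _).
    by apply: eq_tsum => h1 h2; apply: eq_tsum => u v; rewrite (tsumE bG).
  by apply: eq_tsum => h1 h2; apply: eq_tsum => u v; rewrite (tsumE bG).
apply: eq_tsum => h1 h2.
rewrite -mulrA !tio_word // [RHS](teval_word P _ (mlin_K8co _ _)) /K8 /Fco; wsimp.
rewrite [RHS]tsumC actM; apply: eq_tsum => u v; rewrite /G.
by apply: eq_tsum => u' v'; rewrite !mulrA.
Qed.

(* The compatibility of action and coaction in a Yetter-Drinfeld module swaps the
   pair of strands 7, 6 with the pair 0, 1. *)
Definition swap a D t t' := forall x y1 y2,
  cm (st 8) [:: 0; 1]%N y1 -> cm (st 8) [:: 6; 7]%N y2 ->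
  P8 a D (y1 * tcop 8 t x * y2) = P8 a D (y1 * tcop 8 t' x * y2).

(** The conditions on [y1] and [y2] let the coproduct on 76 reach the right end of the product, and
    the one on 01 return from the left end. *)
Lemma swap76 a D : swap a D (L 7 ∙ L 6) (L 0 ∙ L 1).
Proof.
move=> x y1 y2 h1 h2; rewrite -mulrA (@cop_cm _ _ _ Q (st 8) (L 7 ∙ L 6)); last first.
  by apply: cm_sub h2 => i; rewrite /= !inE orbC.
rewrite mulrA P8co_braid mulrA (@cop_cm _ _ _ Q (st 8) (L 0 ∙ L 1)) //.
Qed.

Lemma swap_Nd a D t t' r : disj [:: 6; 7]%N (labels r) ->
  swap a D t t' -> swap a D (t ∙ r) (t' ∙ r).
Proof.
move=> d sw x y1 y2 h1 h2 /=; rewrite !(tsum_mulr (Δ x)) !(tsum_mull (Δ x)).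
rewrite !(lin_push _ _ (P8co_lin a D)); apply: eq_tsum => u v.
rewrite !mulrA -![_ * tcop 8 r v * y2]mulrA; apply: sw => //.
by apply: cm_mul => //; apply: cm_cop.
Qed.

Lemma swap_phi3 a D t t' r s x y1 y2 : disj [:: 6; 7]%N (labels r ++ labels s) ->
  swap a D t t' -> cm (st 8) [:: 0; 1]%N y1 -> cm (st 8) [:: 6; 7]%N y2 ->
  P8 a D (y1 * phi3 Q (st 8) t r s x * y2) = P8 a D (y1 * phi3 Q (st 8) t' r s x * y2).
Proof.
rewrite disj_cat => /andP[dr ds] sw h1 h2; rewrite /phi3.
rewrite !(tsum_mulr x) !(tsum_mull x) !(lin_push _ _ (P8co_lin a D)); apply: eq_tsum => u z.
rewrite !(tsum_mulr z) !(tsum_mull z) !(lin_push _ _ (P8co_lin a D)); apply: eq_tsum => b c.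
rewrite !mulrA -![_ * tcop 8 s c * y2]mulrA -![_ * tcop 8 r b * _]mulrA; apply: sw => //.
by do 2!(apply: cm_mul => //; first exact: cm_cop).
Qed.

Lemma absorb_P8co a D : absorb Q (st 8) (P8 a D) true (L 4 ∙ L 5).
Proof. exact: (absorb_P8 (Fco0 a) (Fco1 a) (Fco2 a) (Fco3 a) (Fco4 a)). Qed.

Lemma colinear_path a D :
  P8 a D (tel 8 (true, L 7, L 6 ∙ L 2, L 3) * tel 8 (true, L 3, L 4, L 5) *
    tel 8 (true, L 7 ∙ (L 6 ∙ L 2), L 3 ∙ L 4, L 5) * tel 8 (true, L 7, L 6, L 2) *
    tel 8 (false, L 0, L 1, L 2) * tel 8 (false, L 0, L 1 ∙ L 2, L 3 ∙ L 4)) =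
  P8 a D (tel 8 (false, L 6, L 2, L 3 ∙ (L 4 ∙ L 5)) *
    tel 8 (true, L 7, L 6, L 2 ∙ (L 3 ∙ (L 4 ∙ L 5))) *
    tel 8 (false, L 0, L 1, L 2 ∙ (L 3 ∙ (L 4 ∙ L 5))) *
    tel 8 (true, L 1, L 2, L 3 ∙ (L 4 ∙ L 5)) * tel 8 (true, L 3, L 4, L 5) *
    tel 8 (true, L 1 ∙ L 2, L 3 ∙ L 4, L 5) *
    tel 8 (true, L 0, (L 1 ∙ L 2) ∙ (L 3 ∙ L 4), L 5)).
Proof.
set O := L 3 ∙ (L 4 ∙ L 5); set O' := L 3 ∙ L 4.
rewrite -!mulrA.
(* The absorbed pair 45 is put back, since the preceding moves end with the letter 3(45). *)
have -> (y : tpow P 8) : P8 a D (tel 8 (true, L 7, L 6 ∙ L 2, L 3) * y) =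
    P8 a D (tel 8 (true, L 7, L 6 ∙ L 2, O) * y).
  symmetry; apply: (sim_phi3 (P8co_lin a D) (b := true) _ y) => //; try exact: sim_refl.
  exact: (sim_unitr (P8co_lin a D) _ (@absorb_P8co a D)).
rewrite !mulrA.
(* Rerouting keeps 76 together as a block in the moves next to the gap, so that [swap] applies to
   them. *)
have -> : tel 8 (true, L 7, L 6 ∙ L 2, O) * tel 8 (true, L 3, L 4, L 5) *
    tel 8 (true, L 7 ∙ (L 6 ∙ L 2), O', L 5) * tel 8 (true, L 7, L 6, L 2) =
    tel 8 (false, L 6, L 2, O) * tel 8 (true, L 7, L 6, L 2 ∙ O) *
    tel 8 (true, L 7 ∙ L 6, L 2, O) * tel 8 (true, L 3, L 4, L 5) *
    tel 8 (true, (L 7 ∙ L 6) ∙ L 2, O', L 5).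
  have := @coherence _ _ _ Q (st 8) [:: (true, L 7, L 6, L 2); (true, L 7 ∙ (L 6 ∙ L 2), O', L 5);
    (true, L 3, L 4, L 5); (true, L 7, L 6 ∙ L 2, O)]
    [:: (true, (L 7 ∙ L 6) ∙ L 2, O', L 5); (true, L 3, L 4, L 5); (true, L 7 ∙ L 6, L 2, O);
      (true, L 7, L 6, L 2 ∙ O); (false, L 6, L 2, O)]
    ((((L 7 ∙ L 6) ∙ L 2) ∙ O') ∙ L 5) (L 7 ∙ ((L 6 ∙ L 2) ∙ O)) isT erefl erefl.
  by rewrite /pel !mul1r.
have -> : P8 a D (tel 8 (false, L 6, L 2, O) * tel 8 (true, L 7, L 6, L 2 ∙ O) *
    tel 8 (true, L 7 ∙ L 6, L 2, O) * tel 8 (true, L 3, L 4, L 5) *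
    tel 8 (true, (L 7 ∙ L 6) ∙ L 2, O', L 5) * tel 8 (false, L 0, L 1, L 2) *
    tel 8 (false, L 0, L 1 ∙ L 2, O')) =
  P8 a D (tel 8 (false, L 6, L 2, O) * tel 8 (true, L 7, L 6, L 2 ∙ O) *
    (tel 8 (true, L 0 ∙ L 1, L 2, O) * tel 8 (true, L 3, L 4, L 5) *
    tel 8 (true, (L 0 ∙ L 1) ∙ L 2, O', L 5) * tel 8 (false, L 0, L 1, L 2) *
    tel 8 (false, L 0, L 1 ∙ L 2, O'))).
  set z := tel 8 (false, L 6, L 2, O) * _; set yQ := tel 8 (true, L 3, L 4, L 5).
  set yt := tel 8 (false, L 0, L 1, L 2); set ys := tel 8 (false, L 0, L 1 ∙ L 2, O').
  have cz : cm (st 8) [:: 0; 1]%N z by apply: cm_mul; apply: cm_phi3.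
  have cts : cm (st 8) [:: 6; 7]%N (yt * ys) by apply: cm_mul; apply: cm_phi3.
  have cQ L : disj L [:: 3; 4; 5]%N -> cm (st 8) L yQ by move=> d; apply: cm_phi3.
  (* The right one of the two associators goes first: [swap] requires that no factor to the right
     involves the strands 6 and 7. *)
  transitivity (P8 a D (z * tel 8 (true, L 7 ∙ L 6, L 2, O) * yQ *
      tel 8 (true, (L 0 ∙ L 1) ∙ L 2, O', L 5) * (yt * ys))).
    rewrite -[LHS]/(P8 a D _) -[X in P8 a D X = _]mulrA.
    apply: (swap_phi3 Φ _ (swap_Nd _ (@swap76 a D))) => //.
    by apply: cm_mul; [apply: cm_mul => //; apply: cm_phi3 | apply: cQ].
  transitivity (P8 a D (z * tel 8 (true, L 0 ∙ L 1, L 2, O) * (yQ *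
      tel 8 (true, (L 0 ∙ L 1) ∙ L 2, O', L 5) * (yt * ys)))).
    rewrite -[LHS]/(P8 a D _) -!(mulrA (z * _)).
    apply: (swap_phi3 Φ _ (@swap76 a D)) => //.
    by apply: cm_mul => //; apply: cm_mul; [apply: cQ | apply: cm_phi3].
  by rewrite !mulrA.
congr (P8 a D _); rewrite -!mulrA; congr (_ * (_ * _)).
(* The last two moves already agree; the others now form genuine paths from (0((12)(34)))5 to
   (01)(2(3(45))). *)
have := @coherence _ _ _ Q (st 8) [:: (false, L 0, L 1 ∙ L 2, O'); (false, L 0, L 1, L 2);
    (true, (L 0 ∙ L 1) ∙ L 2, O', L 5); (true, L 3, L 4, L 5); (true, L 0 ∙ L 1, L 2, O)]
  [:: (true, L 0, (L 1 ∙ L 2) ∙ O', L 5); (true, L 1 ∙ L 2, O', L 5); (true, L 3, L 4, L 5);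
    (true, L 1, L 2, O); (false, L 0, L 1, L 2 ∙ O)]
  ((L 0 ∙ ((L 1 ∙ L 2) ∙ O')) ∙ L 5) ((L 0 ∙ L 1) ∙ (L 2 ∙ O)) isT erefl erefl.
by rewrite /pel !mul1r -!mulrA.
Qed.

(** The factors that Π puts around h become coproducts on 12 and 34 by [drinfeld_twist_S], so Π
    contributes the associator with letters 0, 12, 34. *)
Lemma smash_coact_Pi a h : smash_coact Q OA (smash_Pi Q OA (a ⊗ h)) =
  P8 a (Δ h * g)
   (tel 8 (true, L 7, L 6 ∙ L 2, L 3) * tel 8 (true, L 3, L 4, L 5) *
    tel 8 (true, L 7 ∙ (L 6 ∙ L 2), L 3 ∙ L 4, L 5) * tel 8 (true, L 7, L 6, L 2) *
    tel 8 (false, L 0, L 1, L 2) * tel 8 (false, L 0, L 1 ∙ L 2, L 3 ∙ L 4)).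
Proof.
rewrite smash_PiE; move eD: (Δ h * g) => D; move ey: (_ * tel 8 (false, L 0, L 1, L 2)) => y.
rewrite elF (lin_push _ _ smash_coact_lin) (tsum_mulr Φi) (lin_push _ _ (P8co_lin a D)).
apply: eq_tsum => z1 z; rewrite (lin_push _ _ smash_coact_lin) (tsum_mulr z).
rewrite (lin_push _ _ (P8co_lin a D)); apply: eq_tsum => z2 z3.
rewrite smash_coactE ey P8co_act.
have -> : Δ (z2 * h * S z3) * g = Δ z2 * D * S2 Q z3.
  by rewrite !rmorphM -!mulrA (drinfeld_twist_S P) -eD !mulrA.
rewrite (P8_twist (Fco0 a) (Fco1 a) (Fco2 a) (Fco3 a) (Fco4 a)).
by rewrite !mulrA.
Qed.

Lemma bilin_braided_coact : bilin (fun a c =>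
  \sw[X1, X2, X3 <- Φ] \sw[x1, x2, x3 <- Φi] \sw[Y1, Y2, Y3 <- Φ]
  \sw[a', a0 <- coact ((x1 * Y1) · a)] \sw[c', c0 <- H0_coact Q (Y2 ▷ c)]
    ((X1 * a' * x2 * c' * Y3) ⊗ (X2 · a0) ⊗ ((X3 * x3) ▷ c0))).
Proof. by rewrite /H0_coact /twisted_act; lin_tac. Qed.

Lemma tens_smash_Pi (w : H) q y y' c :
  w ⊗ smash_Pi Q OA (q ⊗ ((y * y') ▷ c)) =
  \sw[z1, z2, z3 <- Φi] \sw[k1, k2 <- Δ y] \sw[l1, l2 <- Δ y']
    (w ⊗ (z1 · q) ⊗ (z2 * (k1 * l1 * c * S (k2 * l2)) * S z3)).
Proof.
rewrite smash_PiE (lin_push _ _ (lin_tensr w (@lin_idf _ _))); apply: eq_tsum => z1 z.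
rewrite (lin_push _ _ (lin_tensr w (@lin_idf _ _))); apply: eq_tsum => z2 z3.
have lG : lin (fun x => w ⊗ (z1 · q) ⊗ (z2 * x * S z3)) by lin_tac.
rewrite /twisted_act (lin_push _ _ lG) rmorphM tsum_mul; last by lin_tac.
by apply: eq_tsum => k1 k2; apply: eq_tsum => l1 l2.
Qed.

(** The associators outside the coaction of H_0, with Π included. The gap between the strands 0, 1
    and 5, 4 is again the coaction of A. *)
Lemma P6coE a e c : P6 a e c (tel 6 (false, L 4, L 2, L 3) * tel 6 (true, L 5, L 4, L 2 ∙ L 3) *
    tel 6 (false, L 0, L 1, L 2 ∙ L 3)) =
  \sw[X1, X2, X3 <- Φ] \sw[x1, x2, x3 <- Φi] \sw[a', a0 <- coact (x1 · a)]
    ((X1 * a' * x2 * e) ⊗ smash_Pi Q OA ((X2 · a0) ⊗ ((X3 * x3) ▷ c))).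
Proof.
pose push := fun U V x F => @lin_push k U V _ _ _ x F (P6co_lin a e c).
symmetry.
move ex: (tel 6 (false, L 0, _, _)) => yx; move ez: (tel 6 (false, L 4, _, _)) => yz.
rewrite elT (tsum_mulr Φ) (tsum_mull Φ) push; apply: eq_tsum => X1 X.
rewrite (tsum_mulr X) (tsum_mull X) push; apply: eq_tsum => X2 X3.
rewrite -ex elF (tsum_mulr Φi) push; apply: eq_tsum => x1 x.
rewrite (tsum_mulr x) push; apply: eq_tsum => x2 x3.
under eq_tsum => a' a0 do rewrite tens_smash_Pi.
rewrite -ez elF !(tsum_mull Φi) push; peel (qPhi_inv Q) 0%N => z1 z.
rewrite !(tsum_mull z) push; peel z 0%N => z2 z3.
rewrite [tcop 6 (L 2 ∙ L 3) X3]/= !(tsum_mulr (Δ X3)) !(tsum_mull (Δ X3)) push.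
peel (qDelta Q X3) 0%N => k1 k2.
rewrite [tcop 6 (L 2 ∙ L 3) x3]/= !(tsum_mulr (Δ x3)) push.
peel (qDelta Q x3) 0%N => l1 l2.
rewrite /eval6 -[X in teval _ X]mulr1 -!mulrA.
rewrite (teval_wprod1 P (l := [:: (4, z1); (2, z2); (3, z3); (5, X1); (4, X2); (2, k1);
  (3, k2); (0, x1); (1, x2); (2, l1); (3, l2)]%N) (mlin_K6co _ _ _) erefl).
rewrite /K6 /Fco; wsimp; rewrite !mulr1.
by apply: eq_tsum => a' a0; rewrite !qSM !actM !mulrA.
Qed.

Lemma smash_Pi_colinear t : smash_coact Q OA (smash_Pi Q OA t) =
  \sw[a', t0 <- braided_tensor_coact Q OA (H0 Q) t] (a' ⊗ smash_Pi Q OA t0).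
Proof.
have bPi : bilin (fun (a' : H) t0 => a' ⊗ smash_Pi Q OA t0).
  by apply: bilinP => u; [lin_tac | apply: lin_tensr; apply: smash_Pi_lin].
move: t; apply: tens_eq_lin => [||a h].
- by apply: (lin_comp smash_coact_lin); apply: smash_Pi_lin.
- by apply: lin_tsumx; last exact: (tsum_linear bilin_braided_coact).
rewrite smash_coact_Pi colinear_path.
rewrite /braided_tensor_coact (tsumE bilin_braided_coact); symmetry.
etransitivity.
  do 8!(rewrite (tsum_tsum _ _ bPi); apply: eq_tsum => ? ?).
  by rewrite (tsumE bPi).
cbv beta.
move eD: (Δ h * g) => D; move ey: (tel 8 (false, L 6, _, _) * _ * _) => y.
rewrite (elT _ _ (L 0)) (tsum_mulr Φ) (lin_push _ _ (P8co_lin a D)); peel (qPhi Q) 1%N => Y1 Y.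
rewrite (tsum_mulr Y) (lin_push _ _ (P8co_lin a D)); peel Y 0%N => Y2 Y3.
(* The coaction of H_0 moves outward, with [Y3] multiplied to its first leg, as [eval8_H0_coact]
   requires. *)
transitivity (\sw[c', c0 <- H0_coact Q (Y2 ▷ h)] P6 (Y1 · a) (c' * Y3) c0
   (tel 6 (false, L 4, L 2, L 3) * tel 6 (true, L 5, L 4, L 2 ∙ L 3) *
    tel 6 (false, L 0, L 1, L 2 ∙ L 3))).
  under [RHS]eq_tsum => c' c0 do rewrite P6coE.
  symmetry; peel (qPhi Q) 0%N => X1 X; peel X 0%N => X2 X3.
  peel (qPhi_inv Q) 0%N => x1 x; peel x 0%N => x2 x3; rewrite actM.
  peel (coact (x1 · (Y1 · a))) 0%N => a' a0.
  by apply: eq_tsum => c' c0; rewrite !mulrA.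
rewrite (eval8_H0_coact (Fco0 (Y1 · a)) (Fco1 (Y1 · a)) (Fco2 (Y1 · a)) (Fco3 (Y1 · a)) (Fco4 (Y1 · a))).
rewrite (P8_act (Fco0 (Y1 · a)) (Fco1 (Y1 · a)) (Fco2 (Y1 · a)) (Fco3 (Y1 · a)) (Fco4 (Y1 · a))).
rewrite !substM !(subst_el P (st 8) uniq_fat) // -/(tel 8) P8co_act eD -ey.
have e : st 8 5%N Y3 * tcop 8 ((L 1 ∙ L 2) ∙ (L 3 ∙ L 4)) Y2 * st 8 0%N Y1 =
    tcop 8 (L 0) Y1 * tcop 8 ((L 1 ∙ L 2) ∙ (L 3 ∙ L 4)) Y2 * tcop 8 (L 5) Y3.
  rewrite (@cop_comm _ _ _ Q (st 8) (L 5) ((L 1 ∙ L 2) ∙ (L 3 ∙ L 4))) // -mulrA.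
  rewrite (@cop_comm _ _ _ Q (st 8) (L 5) (L 0)) // mulrA.
  by rewrite (@cop_comm _ _ _ Q (st 8) ((L 1 ∙ L 2) ∙ (L 3 ∙ L 4)) (L 0)).
by rewrite -e !mulrA.
Qed.

End Coaction.
End Algebra.

(** * Multiplicativity *)

Lemma bring_step (k : fieldType) (T : algType k) (x y l l' : T) :
  l = x * l' -> y * x = x * y -> y * l = x * (y * l').
Proof. by move=> -> e; rewrite mulrA e -mulrA. Qed.

Ltac bring x :=
  lazymatch goal with
  | |- x * _ = _ => reflexivity
  | |- _ * _ = _ => eapply bring_step; [bring x | by apply: cop_comm]
  end.

(* Proves an equality of right-associated products, ending in 1, of [cop]'s on
   disjoint strands that differ by commutations only. *)
Ltac cop_reorder :=
  lazymatch goal with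
  | |- _ = ?x * _ => etransitivity; [bring x | congr (_ * _); cop_reorder]
  | |- _ => reflexivity
  end.

Section Algebra.
Variables (k : fieldType) (H : algType k) (Q : quasiHopf H) (P : tensorPowers Q).
Variables (A : lmodType k) (OA : ydAlgOps H A) (hA : is_yd_algebra Q OA).
Local Notation Δ := (qDelta Q).
Local Notation ε := (qeps Q).
Local Notation Φ := (qPhi Q).
Local Notation Φi := (qPhi_inv Q).
Local Notation S := (qS Q).
Local Notation α := (qalpha Q).
Local Notation g := (drinfeld_twist_inv Q).
Local Notation st n := (tpow_strands P n).
Local Notation tcop n := (cop Q (tpow_strands P n)).
Local Notation tel n := (el Q (tpow_strands P n)).
Local Notation tpel n := (pel Q (tpow_strands P n)).
Local Notation L i := (Lf i).
Local Infix "∙" := Nd (at level 38, left associativity).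
Local Notation "h · a" := (yd_act OA h a) (at level 39, left associativity).
Local Notation "h ▷ c" := (twisted_act Q *%R id h c) (at level 39, left associativity).

Ltac lin_ext ::= first
  [ apply: (act_linl hA); lin_tac | apply: (act_linr hA); lin_tac
  | apply: (coact_lin hA); lin_tac
  | apply: (mul_linl hA); lin_tac | apply: (mul_linr hA); lin_tac
  | apply: lin_io; lin_tac | apply: lin_cop; lin_tac | apply: lin_S2; lin_tac ].

Local Notation "b ∘ c" := (smash_mul Q OA b c) (at level 40, left associativity).
Local Notation j := (smash_j OA).

Lemma bilin_smash a h : bilin (fun a' h' => \sw[x1, x2, x3 <- Φi] \sw[h1, h2 <- Δ h]
  (yd_mul OA (x1 · a) ((x2 * h1) · a') ⊗ (x3 * h2 * h'))).
Proof. lin_tac. Qed.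

Lemma bilin_smash2 t : bilin (fun a h => \sw[a', h' <- t] \sw[x1, x2, x3 <- Φi]
  \sw[h1, h2 <- Δ h] (yd_mul OA (x1 · a) ((x2 * h1) · a') ⊗ (x3 * h2 * h'))).
Proof. lin_tac. Qed.

Lemma smash_mulE a h a' h' : (a ⊗ h) ∘ (a' ⊗ h') =
  \sw[x1, x2, x3 <- Φi] \sw[h1, h2 <- Δ h]
    (yd_mul OA (x1 · a) ((x2 * h1) · a') ⊗ (x3 * h2 * h')).
Proof. by rewrite /smash_mul (tsumE (bilin_smash2 _)) (tsumE (bilin_smash _ _)). Qed.

Lemma smash_mul_linl t : lin (fun s => s ∘ t).
Proof. exact: (tsum_linear (bilin_smash2 t)). Qed.

Lemma smash_mul_linr s : lin (fun t => s ∘ t).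
Proof. by apply: lin_tsumF => a h; apply: (tsum_linear (bilin_smash a h)). Qed.

(** H acts on 1_A through ε, which removes the associator by the normalisation of its second leg and
    the coproduct of h by the counit axiom. In [smash_mul_jl] the first leg plays this part and the
    coproduct remains. *)
Lemma smash_mul_jr a h x : (a ⊗ h) ∘ j x = a ⊗ (h * x).
Proof.
rewrite /smash_j smash_mulE.
pose G (x1 x3 : H) : A ⊗ H := (x1 · a) ⊗ (x3 * h * x).
have bG : bilin G by rewrite /G; lin_tac.
have inner x1 x2 x3 : \sw[h1, h2 <- Δ h] (yd_mul OA (x1 · a) ((x2 * h1) · yd_one OA) ⊗
    (x3 * h2 * x)) = ε x2 *: G x1 x3.
  rewrite /G -[h in RHS](qcounitl Q) (lin_push (f := fun y => ε x2 *: ((x1 · a) ⊗ (x3 * y * x)))).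
    apply: eq_tsum => h1 h2.
    rewrite (act_one hA) rmorphM -scalerA !(linZ (mul_linr hA _ (@lin_idf _ _))).
    rewrite (yd_mul1r hA) -!scalerAr -!scalerAl.
    rewrite (linZ (lin_tensr _ (@lin_idf _ _))) !(linZ (lin_tensl _ (@lin_idf _ _))).
    by rewrite !scalerA.
  by lin_tac.
under eq_tsum => x1 t do under eq_tsum => x2 x3 do rewrite inner.
transitivity (tsum (1 : H ⊗ H) G); last by rewrite (tsumE bG) /G (act1 hA) mul1r.
rewrite -(qPhi_inv_eps2 Q) (tsum_tsum _ _ bG); apply: eq_tsum => x1 t.
rewrite (tsum_tsum _ _ bG); apply: eq_tsum => x2 x3.
by rewrite (tsumZ bG) (tsumE bG).
Qed.

Lemma smash_mul_jl a h x : j x ∘ (a ⊗ h) = \sw[x1, x2 <- Δ x] ((x1 · a) ⊗ (x2 * h)).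
Proof.
rewrite /smash_j smash_mulE.
pose G (y2 y3 : H) : A ⊗ H := \sw[x1, x2 <- Δ x] (((y2 * x1) · a) ⊗ (y3 * x2 * h)).
have bG : bilin G by rewrite /G; lin_tac.
have inner y1 y2 y3 : \sw[x1, x2 <- Δ x] (yd_mul OA (y1 · yd_one OA) ((y2 * x1) · a) ⊗
    (y3 * x2 * h)) = ε y1 *: G y2 y3.
  rewrite /G (lin_push _ _ (lin_scale _ (@lin_idf _ _))); apply: eq_tsum => x1 x2.
  rewrite (act_one hA) (linZ (mul_linl hA _ (@lin_idf _ _))) (yd_mul1l hA).
  by rewrite (linZ (lin_tensl _ (@lin_idf _ _))).
under eq_tsum => y1 t do under eq_tsum => y2 y3 do rewrite inner.
transitivity (tsum (1 : H ⊗ H) G).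
  rewrite -(qPhi_inv_eps1 Q) (tsum_tsum _ _ bG); apply: eq_tsum => x1 t.
  rewrite (tsum_tsum _ _ bG); apply: eq_tsum => x2 x3.
  by rewrite (tsumZ bG) (tsumE bG).
by rewrite (tsumE bG) /G; apply: eq_tsum => x1 x2; rewrite !mul1r.
Qed.

Lemma copN (T : algType k) (I : strands H T) l r x :
  cop Q I (l ∙ r) x = \sw[x1, x2 <- Δ x] (cop Q I l x1 * cop Q I r x2).
Proof. by []. Qed.

Section Product.

(** Together with [K8], this pairs strands 4, 5 and strands 3, 6 through α. In the braided product
    these pairings come from q_R and from the product of H_0, in (A # H)^j from the two legs of γ;
    so one functional fits both sides. *)
Definition Fmul a a' h' (w0 w6 w7 e c : H) : A ⊗ H :=
  yd_mul OA (w0 · a) (e · a') ⊗ (c * α * w6 * h' * S w7).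

Lemma Fmul0 a a' h' w6 w7 e c : lin (fun w0 => Fmul a a' h' w0 w6 w7 e c).
Proof. by rewrite /Fmul; lin_tac. Qed.
Lemma Fmul1 a a' h' w0 w7 e c : lin (fun w6 => Fmul a a' h' w0 w6 w7 e c).
Proof. by rewrite /Fmul; lin_tac. Qed.
Lemma Fmul2 a a' h' w0 w6 e c : lin (fun w7 => Fmul a a' h' w0 w6 w7 e c).
Proof. by rewrite /Fmul; lin_tac. Qed.
Lemma Fmul3 a a' h' w0 w6 w7 c : lin (fun e => Fmul a a' h' w0 w6 w7 e c).
Proof. by rewrite /Fmul; lin_tac. Qed.
Lemma Fmul4 a a' h' w0 w6 w7 e : lin (fun c => Fmul a a' h' w0 w6 w7 e c).
Proof. by rewrite /Fmul; lin_tac. Qed.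

Local Notation P8 a a' h' := (@eval8 _ _ Q P _ (Fmul a a' h')).
Local Notation P6 a a' h' := (@eval6 _ _ Q P _ (Fmul a a' h')).
Local Notation withF lem a a' h' :=
  (lem (Fmul0 a a' h') (Fmul1 a a' h') (Fmul2 a a' h') (Fmul3 a a' h') (Fmul4 a a' h')).

Lemma P8mul_lin a a' h' D : lin (P8 a a' h' D).
Proof. exact: (withF (@P8_lin _ _ Q P _ _) a a' h'). Qed.
Lemma P6mul_lin a a' h' e c : lin (P6 a a' h' e c).
Proof. exact: (withF (@P6_lin _ _ Q P _ _) a a' h'). Qed.
Lemma mlin_K8mul a a' h' D : mlin 8 (K8 Q (Fmul a a' h') D).
Proof. exact: (withF (@mlin_K8 _ _ Q _ _) a a' h'). Qed.
Lemma mlin_K6mul a a' h' e c : mlin 6 (K6 Q (Fmul a a' h') e c).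
Proof. exact: (withF (@mlin_K6 _ _ Q _ _) a a' h'). Qed.

Lemma absorb_P6mul a a' h' e c : absorb Q (st 6) (P6 a a' h' e c) true (L 3 ∙ L 4).
Proof.
apply: (absorb_left (mlin_K6mul a a' h' e c)) => // w x; rewrite /K6 /Fmul; wsimp.
under eq_tsum => h1 h2 do rewrite qSM !mulrA.
rewrite -(@antipodel_lin _ _ Q _ (fun z => yd_mul OA (w 0 · a) ((w 1 * e) · a') ⊗
  (w 2 * c * S (w 3) * z * w 4 * h' * S (w 5)))).
  by apply: eq_tsum => h1 h2; rewrite !mulrA.
by lin_tac.
Qed.

Lemma P6_acta a x a' h' e c y : P6 (x · a) a' h' e c y = P6 a a' h' e c (y * st 6 0%N x).
Proof.
move: y; apply: tpow_eq_lin => [||w].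
- exact: P6mul_lin.
- by apply: (lin_comp (P6mul_lin _ _ _ _ _)); apply: lin_mull; apply: lin_idf.
rewrite word_tio // [LHS](teval_word P _ (mlin_K6mul _ _ _ _ _)).
by rewrite [RHS](teval_word P _ (mlin_K6mul _ _ _ _ _)) /K6 /Fmul; wsimp; rewrite (actM hA (w 0%N)).
Qed.

Lemma P6_acte a x a' h' e c y : P6 a a' h' (x * e) c y = P6 a a' h' e c (y * st 6 1%N x).
Proof.
move: y; apply: tpow_eq_lin => [||w].
- exact: P6mul_lin.
- by apply: (lin_comp (P6mul_lin _ _ _ _ _)); apply: lin_mull; apply: lin_idf.
rewrite word_tio // [LHS](teval_word P _ (mlin_K6mul _ _ _ _ _)).
by rewrite [RHS](teval_word P _ (mlin_K6mul _ _ _ _ _)) /K6 /Fmul; wsimp; rewrite !mulrA.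
Qed.

Lemma P6_actc a x a' h' e c y :
  P6 a a' h' e (x ▷ c) y = P6 a a' h' e c (y * tcop 6 (L 2 ∙ L 3) x).
Proof.
move: y; apply: tpow_eq_lin => [||w].
- exact: P6mul_lin.
- by apply: (lin_comp (P6mul_lin _ _ _ _ _)); apply: lin_mull; apply: lin_idf.
rewrite [LHS](teval_word P _ (mlin_K6mul _ _ _ _ _)) [LHS]/K6 [LHS]/Fmul; wsimp.
rewrite /twisted_act.
rewrite (lin_push (f := fun z => yd_mul OA (w 0 · a) ((w 1 * e) · a') ⊗
  (w 2 * z * S (w 3) * α * w 4 * h' * S (w 5)))); last by lin_tac.
rewrite (tsum_mulr (Δ x)) (lin_push _ _ (P6mul_lin _ _ _ _ _)).
apply: eq_tsum => x1 x2; rewrite mulrA !word_tio //.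
by rewrite [RHS](teval_word P _ (mlin_K6mul _ _ _ _ _)) /K6 /Fmul; wsimp; rewrite qSM !mulrA.
Qed.

Lemma P6_acth a x a' h' e c y :
  P6 a a' (x ▷ h') e c y = P6 a a' h' e c (y * tcop 6 (L 4 ∙ L 5) x).
Proof.
move: y; apply: tpow_eq_lin => [||w].
- exact: P6mul_lin.
- by apply: (lin_comp (P6mul_lin _ _ _ _ _)); apply: lin_mull; apply: lin_idf.
rewrite [LHS](teval_word P _ (mlin_K6mul _ _ _ _ _)) [LHS]/K6 [LHS]/Fmul; wsimp.
rewrite /twisted_act.
rewrite (lin_push (f := fun z => yd_mul OA (w 0 · a) ((w 1 * e) · a') ⊗
  (w 2 * c * S (w 3) * α * w 4 * z * S (w 5)))); last by lin_tac.
rewrite (tsum_mulr (Δ x)) (lin_push _ _ (P6mul_lin _ _ _ _ _)).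
apply: eq_tsum => x1 x2; rewrite mulrA !word_tio //.
by rewrite [RHS](teval_word P _ (mlin_K6mul _ _ _ _ _)) /K6 /Fmul; wsimp; rewrite qSM !mulrA.
Qed.

Lemma smash_Pi_product a a' k' e c :
  smash_Pi Q OA (yd_mul OA a (e · a') ⊗ twisted_mul Q *%R id c k') =
  P6 a a' k' e c (tel 6 (false, L 0 ∙ L 1, L 2, L 5) * tel 6 (false, L 3, L 4, L 5) *
    tel 6 (true, L 2, L 3, L 4 ∙ L 5)).
Proof.
pose push := fun U V x F => @lin_push k U V _ _ _ x F (P6mul_lin a a' k' e c).
rewrite (smash_PiE hA); move ev: (tel 6 (false, L 3, _, _)) => yv; move eV: (tel 6 (true, _, _, _)) => yV.
rewrite elF !(tsum_mull Φi) push; apply: eq_tsum => z1 z.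
rewrite !(tsum_mull z) push; apply: eq_tsum => z2 z3.
have l2 q : lin (fun y => q ⊗ (z2 * y * S z3) : A ⊗ H) by lin_tac.
rewrite /twisted_mul (lin_push _ _ (l2 _)) -eV elT (tsum_mulr Φ) push.
apply: eq_tsum => V1 V; rewrite (lin_push _ _ (l2 _)) (tsum_mulr V) push.
apply: eq_tsum => V2 V3; rewrite (lin_push _ _ (l2 _)).
rewrite -ev elF (tsum_mulr Φi) !(tsum_mull Φi) push; apply: eq_tsum => v1 v.
rewrite (lin_push _ _ (l2 _)) (tsum_mulr v) !(tsum_mull v) push; apply: eq_tsum => v2 v3.
rewrite (lin_push _ _ (l2 _)) [tcop 6 (L 4 ∙ L 5) _]/= !(tsum_mulr (Δ V3)) push.
apply: eq_tsum => V31 V32; rewrite (act_mul hA) (lin_push _ _ (lin_tensl _ (@lin_idf _ _))).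
rewrite [tcop 6 (L 0 ∙ L 1) _]/= !(tsum_mull (Δ z1)) push; apply: eq_tsum => z11 z12.
rewrite /eval6 -[X in teval _ X]mulr1 -!mulrA.
rewrite (teval_wprod1 P (l := [:: (0, z11); (1, z12); (2, z2); (5, z3); (3, v1); (4, v2);
  (5, v3); (2, V1); (3, V2); (4, V31); (5, V32)]%N) (mlin_K6mul _ _ _ _ _) erefl).
by rewrite /K6 /Fmul; wsimp; rewrite !mulr1 !qSM !(actM hA) !mulrA.
Qed.

Lemma twisted_actM x y h : (x * y) ▷ h = x ▷ (y ▷ h).
Proof.
rewrite /twisted_act rmorphM tsum_mul; last by lin_tac.
apply: eq_tsum => x1 x2; rewrite (lin_push (f := fun z => x1 * z * S x2)); last by lin_tac.
by apply: eq_tsum => y1 y2; rewrite /= !qSM !mulrA.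
Qed.

(** Collects the part of the braided product outside the coaction of H_0, Π included, as a path on
    six strands; [e] and [c] are the legs of that coaction. *)
Lemma smash_Pi_Omega a a' h' e c :
  \sw[y1, y2, y3 <- Φi] \sw[Y1, Y2, Y3 <- Φ] \sw[y31, y32 <- Δ y3]
    smash_Pi Q OA (yd_mul OA (y1 · a) ((y2 * Y1 * e) · a') ⊗
      twisted_mul Q *%R id ((y31 * Y2) ▷ c) ((y32 * Y3) ▷ h')) =
  P6 a a' h' e c
   (tel 6 (false, L 0 ∙ L 1, L 2, (L 3 ∙ L 4) ∙ L 5) * tel 6 (false, L 3, L 4, L 5) *
    tel 6 (true, L 2, L 3, L 4 ∙ L 5) * tel 6 (false, L 0, L 1, (L 2 ∙ L 3) ∙ (L 4 ∙ L 5)) *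
    tel 6 (true, L 1, L 2 ∙ L 3, L 4 ∙ L 5)).
Proof.
rewrite -!mulrA.
(* The product of H_0 pairs 3 with 4 through α, so 5 may be read as (34)5, which the preceding move
   provides. *)
have -> y : P6 a a' h' e c (tel 6 (false, L 0 ∙ L 1, L 2, (L 3 ∙ L 4) ∙ L 5) * y) =
    P6 a a' h' e c (tel 6 (false, L 0 ∙ L 1, L 2, L 5) * y).
  apply: (sim_phi3 (P6mul_lin a a' h' e c) (b := true) _ y) => //; try exact: sim_refl.
  exact: (sim_unitl (P6mul_lin a a' h' e c) _ (@absorb_P6mul a a' h' e c)).
rewrite !mulrA.
under eq_tsum => y1 y do under eq_tsum => y2 y3 do under eq_tsum => Y1 Y do
  under eq_tsum => Y2 Y3 do under eq_tsum => y31 y32 do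
  rewrite smash_Pi_product P6_acta P6_acte P6_actc P6_acth.
move ez: (_ * tel 6 (true, L 2, L 3, L 4 ∙ L 5)) => z.
pose push := fun U V x F => @lin_push k U V _ _ _ x F (P6mul_lin a a' h' e c).
move eY: (tel 6 (true, L 1, _, _)) => yY.
rewrite elF (tsum_mulr Φi) (tsum_mull Φi) push; apply: eq_tsum => y1 y.
rewrite (tsum_mulr y) (tsum_mull y) push; apply: eq_tsum => y2 y3.
rewrite -eY elT (tsum_mulr Φ) push; apply: eq_tsum => Y1 Y.
rewrite (tsum_mulr Y) push; apply: eq_tsum => Y2 Y3.
rewrite (copN _ (L 2 ∙ L 3)) (tsum_mulr (Δ y3)) (tsum_mulr (Δ y3)) (tsum_mull (Δ y3)) push.
apply: eq_tsum => y31 y32.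
rewrite -[st 6 0%N y1]/(tcop 6 (L 0) y1) -[st 6 1%N _]/(tcop 6 (L 1) _) !copM //.
rewrite -!mulrA; congr (P6 a a' h' e c (z * _)).
by rewrite -[LHS]mulr1 -[RHS]mulr1 -!mulrA; cop_reorder.
Qed.

Lemma P8_acta a x a' h' D y : P8 (x · a) a' h' D y = P8 a a' h' D (y * st 8 0%N x).
Proof.
move: y; apply: tpow_eq_lin => [||w].
- exact: P8mul_lin.
- by apply: (lin_comp (P8mul_lin _ _ _ _)); apply: lin_mull; apply: lin_idf.
rewrite word_tio // [LHS](teval_word P _ (mlin_K8mul _ _ _ _)).
rewrite [RHS](teval_word P _ (mlin_K8mul _ _ _ _)) /K8 /Fmul; wsimp.
by rewrite (actM hA (w 0%N)).
Qed.

Lemma P8_acta' a x a' h' D y : P8 a (x · a') h' D y = P8 a a' h' D (y * st 8 5%N x).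
Proof.
move: y; apply: tpow_eq_lin => [||w].
- exact: P8mul_lin.
- by apply: (lin_comp (P8mul_lin _ _ _ _)); apply: lin_mull; apply: lin_idf.
rewrite word_tio // [LHS](teval_word P _ (mlin_K8mul _ _ _ _)).
rewrite [RHS](teval_word P _ (mlin_K8mul _ _ _ _)) /K8 /Fmul; wsimp.
by apply: eq_tsum => u v; rewrite -(actM hA) !mulrA.
Qed.

Lemma P8_mulh a x z a' h' D y :
  P8 a a' (x * h' * S z) D y = P8 a a' h' D (y * (st 8 6%N x * st 8 7%N z)).
Proof.
move: y; apply: tpow_eq_lin => [||w].
- exact: P8mul_lin.
- by apply: (lin_comp (P8mul_lin _ _ _ _)); apply: lin_mull; apply: lin_idf.
rewrite mulrA !word_tio // [LHS](teval_word P _ (mlin_K8mul _ _ _ _)).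
rewrite [RHS](teval_word P _ (mlin_K8mul _ _ _ _)) /K8 /Fmul; wsimp.
by apply: eq_tsum => u v; rewrite qSM !mulrA.
Qed.

Lemma P8_acth a x a' h' D y :
  P8 a a' (x ▷ h') D y = P8 a a' h' D (y * tcop 8 (L 6 ∙ L 7) x).
Proof.
rewrite [tcop 8 _ _]/= (tsum_mulr (Δ x)) (lin_push _ _ (P8mul_lin _ _ _ _)).
under [RHS]eq_tsum => x1 x2 do rewrite -P8_mulh.
move: y; apply: tpow_eq_lin => [||w].
- exact: P8mul_lin.
- by apply: lin_tsumF => u v; apply: P8mul_lin.
rewrite [LHS](teval_word P _ (mlin_K8mul _ _ _ _)).
under [RHS]eq_tsum => x1 x2 do rewrite [P8 _ _ _ _ _](teval_word P _ (mlin_K8mul _ _ _ _)).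
rewrite /K8 /Fmul; wsimp.
rewrite [RHS]tsumC; apply: eq_tsum => u v; rewrite /twisted_act.
by rewrite (lin_push (f := fun z => yd_mul OA (w 0 · a) ((w 1 * u * S (w 4) * α * w 5) · a') ⊗
  (w 2 * v * S (w 3) * α * w 6 * z * S (w 7)))); last by lin_tac.
Qed.

Lemma braided_mulE a h a' h' : braided_tensor_mul Q OA (H0 Q) (a ⊗ h) (a' ⊗ h') =
  \sw[y1, y2, y3 <- Φi] \sw[X1, X2, X3 <- Φ] \sw[Y1, Y2, Y3 <- Φ]
  \sw[x1, x2, x3 <- Φi] \sw[X31, X32 <- Δ X3] \sw[y31, y32 <- Δ y3]
  \sw[e, c0 <- H0_coact Q ((x1 * X2) ▷ h)]
    (yd_mul OA ((y1 * X1) · a) ((y2 * Y1 * e * x2 * X31) · a')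
    ⊗ twisted_mul Q *%R id ((y31 * Y2) ▷ c0) ((y32 * Y3 * x3 * X32) ▷ h')).
Proof.
rewrite /braided_tensor_mul /= tsumE; last first.
  by rewrite /H0_coact /twisted_mul /twisted_act; lin_tac.
by rewrite tsumE //; rewrite /H0_coact /twisted_mul /twisted_act; lin_tac.
Qed.

Lemma braided_mul_linl t : lin (fun s => braided_tensor_mul Q OA (H0 Q) s t).
Proof.
rewrite /braided_tensor_mul /= /H0_coact /twisted_mul /twisted_act; lin_tac.
Qed.

Lemma braided_mul_linr s : lin (fun t => braided_tensor_mul Q OA (H0 Q) s t).
Proof.
rewrite /braided_tensor_mul /= /H0_coact /twisted_mul /twisted_act; lin_tac.
Qed.

Local Notation Ω := (L 3 ∙ (L 4 ∙ L 5)).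

(** The moves form a path from (0((12)(34)))(5(67)) to ((01)2)((Ω6)7): the path of [smash_Pi_Omega]
    read on [fat], preceded by that of the coaction and by the two associators in front of it. *)
Lemma smash_Pi_mulE a h a' h' :
  smash_Pi Q OA (braided_tensor_mul Q OA (H0 Q) (a ⊗ h) (a' ⊗ h')) =
  P8 a a' h' (Δ h * g)
   (tel 8 (false, L 0 ∙ L 1, L 2, (Ω ∙ L 6) ∙ L 7) * tel 8 (false, Ω, L 6, L 7) *
    tel 8 (true, L 2, Ω, L 6 ∙ L 7) * tel 8 (false, L 0, L 1, (L 2 ∙ Ω) ∙ (L 6 ∙ L 7)) *
    tel 8 (true, L 1, L 2 ∙ Ω, L 6 ∙ L 7) * tel 8 (true, L 1, L 2, Ω) *
    tel 8 (true, L 3, L 4, L 5) * tel 8 (true, L 1 ∙ L 2, L 3 ∙ L 4, L 5) *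
    tel 8 (false, (L 1 ∙ L 2) ∙ (L 3 ∙ L 4), L 5, L 6 ∙ L 7) *
    tel 8 (true, L 0, (L 1 ∙ L 2) ∙ (L 3 ∙ L 4), L 5 ∙ (L 6 ∙ L 7))).
Proof.
rewrite braided_mulE.
etransitivity.
  do 11!(rewrite (lin_push _ _ (smash_Pi_lin hA)); apply: eq_tsum => ? ?).
  reflexivity.
cbv beta.
move eD: (Δ h * g) => D; pose push := fun U V x F => @lin_push k U V _ _ _ x F (P8mul_lin a a' h' D).
move ex: (tel 8 (false, _, L 5, _)) => yx.
move ez: (_ * tel 8 (true, L 1 ∙ L 2, L 3 ∙ L 4, L 5)) => z.
rewrite (elT _ _ (L 0)) (tsum_mulr Φ) push; peel (qPhi Q) 0%N => X1 X.
rewrite (tsum_mulr X) push; peel X 0%N => X2 X3.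
rewrite (copN _ (L 5)) !(tsum_mulr (Δ X3)) push; peel (qDelta Q X3) 0%N => X31 X32.
rewrite -ex elF (tsum_mulr Φi) !(tsum_mull Φi) push; peel (qPhi_inv Q) 1%N => x1 x.
rewrite (tsum_mulr x) !(tsum_mull x) push; peel x 0%N => x2 x3.
transitivity (\sw[e, c0 <- H0_coact Q ((x1 * X2) ▷ h)]
  P6 (X1 · a) a' ((x3 * X32) ▷ h') (e * (x2 * X31)) c0
   (tel 6 (false, L 0 ∙ L 1, L 2, (L 3 ∙ L 4) ∙ L 5) * tel 6 (false, L 3, L 4, L 5) *
    tel 6 (true, L 2, L 3, L 4 ∙ L 5) * tel 6 (false, L 0, L 1, (L 2 ∙ L 3) ∙ (L 4 ∙ L 5)) *
    tel 6 (true, L 1, L 2 ∙ L 3, L 4 ∙ L 5))).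
  under [RHS]eq_tsum => e c do rewrite -smash_Pi_Omega.
  peel (H0_coact Q ((x1 * X2) ▷ h)) 0%N => e c.
  apply: eq_tsum => y1 y; apply: eq_tsum => y2 y3.
  apply: eq_tsum => Y1 Y; apply: eq_tsum => Y2 Y3; apply: eq_tsum => y31 y32.
  by rewrite (actM hA y1) -(twisted_actM (y32 * Y3)) !mulrA.
rewrite (withF (@eval8_H0_coact _ _ Q P _ _) (X1 · a) a' ((x3 * X32) ▷ h')).
rewrite (withF (@P8_act _ _ Q P _ _) (X1 · a) a' ((x3 * X32) ▷ h')).
rewrite P8_acta P8_acth eD.
rewrite !substM !(subst_el P (st 8) uniq_fat) // -/(tel 8).
rewrite -[st 8 0%N X1]/(tcop 8 (L 0) X1) -[st 8 5%N _]/(tcop 8 (L 5) _) !copM //.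
rewrite -ez -!mulrA; congr (P8 a a' h' D _); do 8!congr (_ * _).
by rewrite -[LHS]mulr1 -[RHS]mulr1 -!mulrA; cop_reorder.
Qed.

Definition strands3456 := [:: L 3; L 4; L 5; L 6].
Lemma uniq_strands3456 : uniq (flatten (map labels strands3456)). Proof. by []. Qed.

(** Δ(α) = gγ supplies the g that turns Δ(S s) into [S2 s] and then stands next to Δ(h); γ takes up
    the factors on both sides of α. *)
Lemma coprod_S_alpha h s l : Δ (h * S s * α * l) = Δ h * g * Pgamma (P := P)
  (tpel 4 Amoves * (tcop 4 (L 0 ∙ L 1) s * tcop 4 (L 2 ∙ L 3) l)).
Proof.
have -> : Δ (h * S s * α * l) = Δ h * Δ (S s) * Δ α * Δ l by rewrite !rmorphM.
rewrite -Pgamma_act -/(drinfeld_gamma P) (drinfeld_twist_alpha P).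
by rewrite !mulrA -[_ * Δ (S s) * _]mulrA (drinfeld_twist_S P) !mulrA.
Qed.

End Product.
End Algebra.

(** * The product of (A # H)^j on eight strands, and its comparison with the braided product *)

Section Algebra.
Variables (k : fieldType) (H : algType k) (Q : quasiHopf H) (P : tensorPowers Q).
Variables (A : lmodType k) (OA : ydAlgOps H A) (hA : is_yd_algebra Q OA).
Local Notation Δ := (qDelta Q).
Local Notation Φ := (qPhi Q).
Local Notation Φi := (qPhi_inv Q).
Local Notation S := (qS Q).
Local Notation α := (qalpha Q).
Local Notation g := (drinfeld_twist_inv Q).
Local Notation st n := (tpow_strands P n).
Local Notation tcop n := (cop Q (tpow_strands P n)).
Local Notation tel n := (el Q (tpow_strands P n)).
Local Notation tpel n := (pel Q (tpow_strands P n)).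
Local Notation L i := (Lf i).
Local Infix "∙" := Nd (at level 38, left associativity).
Local Notation "h · a" := (yd_act OA h a) (at level 39, left associativity).
Local Notation "h ▷ c" := (twisted_act Q *%R id h c) (at level 39, left associativity).

Ltac lin_ext ::= first
  [ apply: (act_linl hA); lin_tac | apply: (act_linr hA); lin_tac
  | apply: (coact_lin hA); lin_tac
  | apply: (mul_linl hA); lin_tac | apply: (mul_linr hA); lin_tac
  | apply: lin_io; lin_tac | apply: lin_cop; lin_tac | apply: lin_S2; lin_tac ].

Local Notation "b ∘ c" := (smash_mul Q OA b c) (at level 40, left associativity).
Local Notation j := (smash_j OA).

Section Product.
Local Notation P8 a a' h' := (@eval8 _ _ Q P _ (Fmul Q OA a a' h')).
Local Notation withF lem a a' h' :=
  (lem (Fmul0 hA a a' h') (Fmul1 Q OA a a' h') (Fmul2 Q OA a a' h') (Fmul3 hA a a' h') (Fmul4 Q OA a a' h')).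
Local Notation Ω := (L 3 ∙ (L 4 ∙ L 5)).

(** Φ^-1 on 0, 1, 2 is the associator of the smash product; the two associators after it are the
    path of γ, moved to the strands 3 to 6. *)
Lemma smash_step a h s l a' h' p :
  (a ⊗ (h * S s * α * l)) ∘ (a' ⊗ h') ∘ j (S p) =
  P8 a a' h' (Δ h * g) (tel 8 (false, L 0, L 1, L 2) * (tel 8 (true, L 3, L 4, L 5) *
    tel 8 (false, L 3 ∙ L 4, L 5, L 6)) *
    (tcop 8 (L 3 ∙ L 4) s * tcop 8 (L 5 ∙ L 6) l * tcop 8 (L 7) p)).
Proof.
rewrite (smash_mulE hA).
transitivity (\sw[t1, t2, t3 <- Φi] \sw[h1, h2 <- Δ (h * S s * α * l)]
    (yd_mul OA (t1 · a) ((t2 * h1) · a') ⊗ (t3 * h2 * h' * S p))).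
  do 3!(rewrite (lin_push _ _ (smash_mul_linl hA (j (S p)))); apply: eq_tsum => ? ?).
  exact: (smash_mul_jr hA).
rewrite (coprod_S_alpha P); move eD: (Δ h * g) => D; move eY: (tpel 4 _ * _) => Y.
have key (y : tpow P 4) : \sw[t1, t2, t3 <- Φi] \sw[h1, h2 <- D * Pgamma (P := P) y]
    (yd_mul OA (t1 · a) ((t2 * h1) · a') ⊗ (t3 * h2 * h' * S p)) =
    P8 a a' h' D (tel 8 (false, L 0, L 1, L 2) * (subst (st 8) uniq_strands3456 y * tcop 8 (L 7) p)).
  move: y; apply: tpow_eq_lin => [||v].
  - have lg : lin (fun y => D * Pgamma (P := P) y) by apply: lin_mulr; apply: Pgamma_lin.
    do 2!apply: lin_tsumF => ? ?; apply: lin_tsumx => //; lin_tac.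
  - apply: (lin_comp (P8mul_lin hA _ _ _ _)); apply: lin_mulr; apply: lin_mull.
    exact: (subst_lin (P := P) (st 8) uniq_strands3456).
  rewrite (subst_word P (st 8) uniq_strands3456 v) [Pgamma (P := P) _](teval_word P _ (mlin_Kgamma Q)) /Kgamma.
  move ee: (tel 8 (false, L 0, L 1, L 2)) => y0; rewrite /= -ee.
  pose push := fun U V x F => @lin_push k U V _ _ _ x F (P8mul_lin hA a a' h' D).
  rewrite elF !(tsum_mull Φi) push; apply: eq_tsum => t1 t.
  rewrite !(tsum_mull t) push; apply: eq_tsum => t2 t3.
  rewrite tsum_mul; last by lin_tac.
  rewrite /eval8 -[X in teval _ X]mulr1 -!mulrA !mul1r.
  rewrite (teval_wprod1 P (l := [:: (0, t1); (1, t2); (2, t3); (3, v 0); (4, v 1); (5, v 2);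
    (6, v 3); (7, p)]%N) (mlin_K8mul hA _ _ _ _) erefl) /K8 /Fmul; wsimp; rewrite !mulr1.
  by apply: eq_tsum => u u'; rewrite tsumE ?mulrA //; lin_tac.
rewrite key -eY !substM subst1 !(subst_el P (st 8) uniq_strands3456) // !(subst_cop P (st 8) uniq_strands3456) //.
by rewrite /= !mul1r !mulrA.
Qed.

Lemma smash_word v a h s l a' h' p :
  j v ∘ (a ⊗ h) ∘ j (S s * α * l) ∘ (a' ⊗ h') ∘ j (S p) =
  P8 a a' h' (Δ h * g) (tel 8 (false, L 0, L 1, L 2) * (tel 8 (true, L 3, L 4, L 5) *
    tel 8 (false, L 3 ∙ L 4, L 5, L 6)) *
    (tcop 8 (L 3 ∙ L 4) s * tcop 8 (L 5 ∙ L 6) l * tcop 8 (L 7) p) *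
    tcop 8 (L 0 ∙ (L 1 ∙ L 2)) v).
Proof.
rewrite (smash_mul_jl hA) (copN _ _ (L 0)).
move eD: (Δ h * g) => D; move ey: (_ * (tcop 8 (L 3 ∙ L 4) s * _ * _)) => y.
rewrite (tsum_mulr (Δ v)) (lin_push _ _ (P8mul_lin hA a a' h' D)).
rewrite (lin_push _ _ (smash_mul_linl hA (j (S s * α * l)))) (lin_push _ _ (smash_mul_linl hA (a' ⊗ h')))
  (lin_push _ _ (smash_mul_linl hA (j (S p)))); apply: eq_tsum => v1 v2.
rewrite (smash_mul_jr hA) !mulrA smash_step (P8_acta hA) ey.
have -> : Δ (v2 * h) * g = Δ v2 * D * S2 Q 1 by rewrite S2_1 mulr1 rmorphM -eD mulrA.
by rewrite (withF (@P8_twist _ _ Q P _ _) a a' h') cop1 mulr1.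
Qed.

Lemma smash_push v s x' (z : H ⊗ H ⊗ H) (x : H ⊗ H ⊗ H) a h a' h' :
  j v ∘ (\sw[z1, z2, z3 <- z] ((z1 · a) ⊗ (z2 * h * S z3))) ∘ s ∘
    (\sw[x1, x2, x3 <- x] ((x1 · a') ⊗ (x2 * h' * S x3))) ∘ x' =
  \sw[z1, z2, z3 <- z] \sw[x1, x2, x3 <- x]
    (j v ∘ ((z1 · a) ⊗ (z2 * h * S z3)) ∘ s ∘ ((x1 · a') ⊗ (x2 * h' * S x3)) ∘ x').
Proof.
pose f t t' := j v ∘ t ∘ s ∘ t' ∘ x'.
have f1 t' : lin (fun t => f t t').
  by do 3!apply: (lin_comp (smash_mul_linl hA _)); apply: (smash_mul_linr hA).
have f2 t : lin (f t).
  by apply: (lin_comp (smash_mul_linl hA _)); apply: (smash_mul_linr hA).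
rewrite -[LHS]/(f _ _) (lin_push _ _ (f1 _)); apply: eq_tsum => z1 y.
rewrite (lin_push _ _ (f1 _)); apply: eq_tsum => z2 z3.
rewrite (lin_push _ _ (f2 _)); apply: eq_tsum => x1 y'.
by rewrite (lin_push _ _ (f2 _)).
Qed.

Lemma smash_mul_PiE a h a' h' :
  twisted_mul Q (smash_mul Q OA) j (smash_Pi Q OA (a ⊗ h)) (smash_Pi Q OA (a' ⊗ h')) =
  P8 a a' h' (Δ h * g) (tel 8 (false, L 0, L 1, L 2) * (tel 8 (true, L 3, L 4, L 5) *
    tel 8 (false, L 3 ∙ L 4, L 5, L 6)) * tel 8 (false, L 3 ∙ L 4, L 5 ∙ L 6, L 7) *
    tel 8 (true, L 0 ∙ (L 1 ∙ L 2), L 3 ∙ L 4, (L 5 ∙ L 6) ∙ L 7) *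
    tel 8 (false, L 0, L 1 ∙ L 2, L 3 ∙ L 4) * tel 8 (false, L 5, L 6, L 7)).
Proof.
rewrite /twisted_mul !(smash_PiE hA).
etransitivity.
  do 5!(apply: eq_tsum => ? ?).
  rewrite smash_push -(mulrA (S _ * α)); do 4!(apply: eq_tsum => ? ?).
  rewrite smash_word (P8_acta hA) (P8_acta' hA) (P8_mulh hA).
  reflexivity.
cbv beta; move eg: g => g0; move eD: (Δ h * g0) => D.
pose push := fun U V x F => @lin_push k U V _ _ _ x F (P8mul_lin hA a a' h' D).
move eB: (tel 8 (false, L 0, L 1, L 2) * _) => B.
move ex: (tel 8 (false, L 5, L 6, L 7)) => yx; move ez: (tel 8 (false, L 0, _, _)) => yz.
move ev: (tel 8 (false, L 3 ∙ L 4, _, _)) => yv.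
rewrite elT !(tsum_mulr Φ) !(tsum_mull Φ) push; apply: eq_tsum => V1 V.
rewrite !(tsum_mulr V) !(tsum_mull V) push; apply: eq_tsum => V2 V3.
rewrite -ev elF !(tsum_mulr Φi) !(tsum_mull Φi) push; apply: eq_tsum => v1 v.
rewrite !(tsum_mulr v) !(tsum_mull v) push; apply: eq_tsum => v2 v3.
rewrite (copN _ _ (L 5 ∙ L 6)) !(tsum_mulr (Δ V3)) !(tsum_mull (Δ V3)) push; apply: eq_tsum => V31 V32.
rewrite -ez elF !(tsum_mulr Φi) !(tsum_mull Φi) push; apply: eq_tsum => z1 z.
rewrite !(tsum_mulr z) !(tsum_mull z) push; apply: eq_tsum => z2 z3.
rewrite -ex elF !(tsum_mulr Φi) push; apply: eq_tsum => x1 x.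
rewrite !(tsum_mulr x) push; apply: eq_tsum => x2 x3.
have -> : Δ (z2 * h * S z3) * g0 = Δ z2 * D * S2 Q z3.
  by rewrite !rmorphM -!mulrA -eg (drinfeld_twist_S P) -eD -eg !mulrA.
rewrite (withF (@P8_twist _ _ Q P _ _) a a' h').
rewrite -[st 8 0%N z1]/(tcop 8 (L 0) z1) -[st 8 5%N x1]/(tcop 8 (L 5) x1).
rewrite -[st 8 6%N x2]/(tcop 8 (L 6) x2) -[st 8 7%N x3]/(tcop 8 (L 7) x3) !copM //.
rewrite -!mulrA; congr (P8 a a' h' D (B * _)).
by rewrite -[LHS]mulr1 -[RHS]mulr1 -!mulrA; cop_reorder.
Qed.

Lemma smash_Pi_mul s t : smash_Pi Q OA (braided_tensor_mul Q OA (H0 Q) s t) =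
  twisted_mul Q (smash_mul Q OA) j (smash_Pi Q OA s) (smash_Pi Q OA t).
Proof.
have hPi := smash_Pi_lin hA.
move: s; apply: tens_eq_lin => [||a h].
- exact: (lin_comp hPi (braided_mul_linl hA t)).
- do 5!apply: lin_tsumF => ? ?; do 3!apply: (lin_comp (smash_mul_linl hA _)).
  exact: (lin_comp (smash_mul_linr hA _)).
move: t; apply: tens_eq_lin => [||a' h'].
- exact: (lin_comp hPi (braided_mul_linr hA _)).
- do 5!apply: lin_tsumF => ? ?; apply: (lin_comp (smash_mul_linl hA _)).
  exact: (lin_comp (smash_mul_linr hA _)).
rewrite (smash_Pi_mulE P hA) smash_mul_PiE; congr (P8 a a' h' _ _).
(* The common source is the bracketing of the diagonal action on (a ⊗ h) ⊗ (a' ⊗ h'): 0 acts on a,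
   12 and 34 on the two sides of Δ(h) g, 5 on a', 6 and 7 on the two sides of h'. *)
have := @coherence _ _ _ Q (st 8)
  [:: (true, L 0, (L 1 ∙ L 2) ∙ (L 3 ∙ L 4), L 5 ∙ (L 6 ∙ L 7));
      (false, (L 1 ∙ L 2) ∙ (L 3 ∙ L 4), L 5, L 6 ∙ L 7);
      (true, L 1 ∙ L 2, L 3 ∙ L 4, L 5); (true, L 3, L 4, L 5); (true, L 1, L 2, Ω);
      (true, L 1, L 2 ∙ Ω, L 6 ∙ L 7); (false, L 0, L 1, (L 2 ∙ Ω) ∙ (L 6 ∙ L 7));
      (true, L 2, Ω, L 6 ∙ L 7); (false, Ω, L 6, L 7);
      (false, L 0 ∙ L 1, L 2, (Ω ∙ L 6) ∙ L 7)]
  [:: (false, L 5, L 6, L 7); (false, L 0, L 1 ∙ L 2, L 3 ∙ L 4);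
      (true, L 0 ∙ (L 1 ∙ L 2), L 3 ∙ L 4, (L 5 ∙ L 6) ∙ L 7);
      (false, L 3 ∙ L 4, L 5 ∙ L 6, L 7); (false, L 3 ∙ L 4, L 5, L 6);
      (true, L 3, L 4, L 5); (false, L 0, L 1, L 2)]
  ((L 0 ∙ ((L 1 ∙ L 2) ∙ (L 3 ∙ L 4))) ∙ (L 5 ∙ (L 6 ∙ L 7)))
  (((L 0 ∙ L 1) ∙ L 2) ∙ ((Ω ∙ L 6) ∙ L 7)) isT erefl erefl.
by rewrite /pel !mul1r -!mulrA.
Qed.

End Product.
End Algebra.

(** * Linearity and the inverse *)

Lemma inverse_yd_algebra_morphism (k : fieldType) (H : algType k)
    (A B : lmodType k) (OA : ydAlgOps H A) (OB : ydAlgOps H B) (f : A -> B) (f' : B -> A) :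
  is_yd_algebra_morphism OA OB f -> cancel f f' -> cancel f' f ->
  is_yd_algebra_morphism OB OA f'.
Proof.
case=> lf [f_act f_coact f_one f_mul] fK f'K.
have lf' : lin f' by move=> a x y; apply: (can_inj fK); rewrite lf !f'K.
split=> //; split=> [h b|b||b c]; last 2 first.
- by rewrite -f_one fK.
- by apply: (can_inj fK); rewrite f_mul !f'K.
- by apply: (can_inj fK); rewrite f_act !f'K.
have bf' : bilin (fun (b' : H) b0 => b' ⊗ f' b0).
  by apply: bilinP => ?; [lin_tac | apply: lin_tensr].
rewrite -[in RHS](f'K b) f_coact (tsum_tsum _ _ bf') -[LHS]tsum_tens.
by apply: eq_tsum => a' a0; rewrite (tsumE bf') fK.
Qed.

Section Algebra.
Variables (k : fieldType) (H : algType k) (Q : quasiHopf H) (P : tensorPowers Q).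
Variables (A : lmodType k) (OA : ydAlgOps H A) (hA : is_yd_algebra Q OA).
Local Notation Δ := (qDelta Q).
Local Notation Φ := (qPhi Q).
Local Notation Φi := (qPhi_inv Q).
Local Notation S := (qS Q).
Local Notation β := (qbeta Q).
Local Notation st n := (tpow_strands P n).
Local Notation tcop n := (cop Q (tpow_strands P n)).
Local Notation tel n := (el Q (tpow_strands P n)).
Local Notation L i := (Lf i).
Local Infix "∙" := Nd (at level 38, left associativity).
Local Notation "h · a" := (yd_act OA h a) (at level 39, left associativity).
Local Notation "h ▷ c" := (twisted_act Q *%R id h c) (at level 39, left associativity).

Ltac lin_ext ::= first
  [ apply: (act_linl hA); lin_tac | apply: (act_linr hA); lin_tac
  | apply: (coact_lin hA); lin_tac
  | apply: (mul_linl hA); lin_tac | apply: (mul_linr hA); lin_tac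
  | apply: lin_io; lin_tac | apply: lin_cop; lin_tac | apply: lin_S2; lin_tac ].

Local Notation "b ∘ c" := (smash_mul Q OA b c) (at level 40, left associativity).
Local Notation j := (smash_j OA).

Definition K3 a c (w : nat -> H) : A ⊗ H := (w 0 · a) ⊗ (w 1 * c * S (w 2)).

Lemma mlin_K3 a c : mlin 3 (K3 a c).
Proof. by rewrite /K3 /=; do !split=> *; lin_tac. Qed.

Local Notation P3 a c := (@teval _ _ Q P _ 3 (K3 a c)).

Lemma P3_lin a c : lin (P3 a c). Proof. exact: teval_lin (mlin_K3 a c). Qed.

Lemma P3_act a c x1 x2 x3 y : P3 (x1 · a) (x2 * c * S x3) y =
  P3 a c (y * (st 3 0%N x1 * st 3 1%N x2 * st 3 2%N x3)).
Proof.
move: y; apply: tpow_eq_lin => [||w].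
- exact: P3_lin.
- by apply: (lin_comp (P3_lin _ _)); apply: lin_mull; apply: lin_idf.
rewrite !mulrA !word_tio // !(teval_word P _ (mlin_K3 _ _)) /K3; wsimp.
by rewrite (actM hA (w 0%N)) qSM !mulrA.
Qed.

Lemma P3_1 a c : P3 a c 1 = a ⊗ c.
Proof.
by rewrite -word1 (teval_word P _ (mlin_K3 _ _)) /K3 /= (act1 hA) qS1 mulr1 mul1r.
Qed.

Lemma P3_phi3 a c (x : H ⊗ H ⊗ H) y :
  P3 a c (y * phi3 Q (st 3) (L 0) (L 1) (L 2) x) =
  \sw[x1, x2, x3 <- x] P3 (x1 · a) (x2 * c * S x3) y.
Proof.
rewrite /phi3 (tsum_mulr x) (lin_push _ _ (P3_lin a c)); apply: eq_tsum => x1 t.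
rewrite (tsum_mulr t) (lin_push _ _ (P3_lin a c)); apply: eq_tsum => x2 x3.
by rewrite P3_act.
Qed.

(** The formula of Π with Φ in place of Φ^-1. On the three strands of [K3] both maps are right
    multiplications, so they are mutually inverse by [elV]. *)
Definition smash_Pi_inv (t : A ⊗ H) : A ⊗ H :=
  \sw[a, h <- t] \sw[X1, X2, X3 <- Φ] (X1 · a) ⊗ (X2 * h * S X3).

Lemma P3_Pi a c : smash_Pi Q OA (a ⊗ c) = P3 a c (tel 3 (false, L 0, L 1, L 2)).
Proof.
rewrite (smash_PiE hA) -[tel 3 _]mul1r P3_phi3.
by apply: eq_tsum => x1 t; apply: eq_tsum => x2 x3; rewrite P3_1.
Qed.

Lemma bilin_smash_Pi_inv :
  bilin (fun a h => \sw[X1, X2, X3 <- Φ] ((X1 · a) ⊗ (X2 * h * S X3)) : A ⊗ H).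
Proof. lin_tac. Qed.

Lemma smash_Pi_inv_lin : lin smash_Pi_inv.
Proof. exact: (tsum_linear bilin_smash_Pi_inv). Qed.

Lemma P3_Pi_inv a c : smash_Pi_inv (a ⊗ c) = P3 a c (tel 3 (true, L 0, L 1, L 2)).
Proof.
rewrite /smash_Pi_inv (tsumE bilin_smash_Pi_inv) -[tel 3 _]mul1r P3_phi3.
by apply: eq_tsum => x1 t; apply: eq_tsum => x2 x3; rewrite P3_1.
Qed.

Lemma smash_PiK : cancel (smash_Pi Q OA) smash_Pi_inv.
Proof.
apply: tens_eq_lin => [||a h]; [|exact: lin_idf|].
  exact: (lin_comp smash_Pi_inv_lin (smash_Pi_lin hA)).
rewrite (smash_PiE hA) -P3_1 -(elV Q (st 3) true (r := L 0) (s := L 1) (t := L 2)) //.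
rewrite P3_phi3; do 2!(rewrite (lin_push _ _ smash_Pi_inv_lin); apply: eq_tsum => ? ?).
exact: P3_Pi_inv.
Qed.

Lemma smash_Pi_invK : cancel smash_Pi_inv (smash_Pi Q OA).
Proof.
apply: tens_eq_lin => [||a h]; [|exact: lin_idf|].
  exact: (lin_comp (smash_Pi_lin hA) smash_Pi_inv_lin).
rewrite /smash_Pi_inv (tsumE bilin_smash_Pi_inv) -P3_1.
rewrite -(elV Q (st 3) false (r := L 0) (s := L 1) (t := L 2)) // P3_phi3.
do 2!(rewrite (lin_push _ _ (smash_Pi_lin hA)); apply: eq_tsum => ? ?).
exact: P3_Pi.
Qed.

(** On three strands H acts on A ⊗ H_0 along 0(12) and on (A # H)^j along (01)2; Π is Φ^-1, which
    intertwines the two by quasi-coassociativity. *)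
Lemma smash_Pi_act x t : smash_Pi Q OA (braided_tensor_act Q OA (H0 Q) x t) =
  twisted_act Q (smash_mul Q OA) j x (smash_Pi Q OA t).
Proof.
move: t; apply: tens_eq_lin => [||a h].
- apply: (lin_comp (smash_Pi_lin hA)); rewrite /braided_tensor_act /= /twisted_act; lin_tac.
- apply: lin_tsumF => ? ?; apply: (lin_comp (smash_mul_linl hA _)).
  exact: (lin_comp (smash_mul_linr hA _) (smash_Pi_lin hA)).
have step012 : step (false, L 0, L 1, L 2) (L 0 ∙ (L 1 ∙ L 2)) ((L 0 ∙ L 1) ∙ L 2).
  exact: StepHere (false, L 0, L 1, L 2).
transitivity (P3 a h (tel 3 (false, L 0, L 1, L 2) * tcop 3 (L 0 ∙ (L 1 ∙ L 2)) x)).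
  rewrite /braided_tensor_act tsumE /=; last by rewrite /twisted_act; lin_tac.
  move ee: (phi3 _ _ _ _ _ _) => y.
  rewrite (tsum_mulr (Δ x)) (lin_push _ _ (P3_lin a h)) (lin_push _ _ (smash_Pi_lin hA)).
  apply: eq_tsum => x1 x2; rewrite /twisted_act (lin_push _ _ (lin_tensr _ (@lin_idf _ _))).
  rewrite (lin_push _ _ (smash_Pi_lin hA)) !(tsum_mulr (Δ x2)) (lin_push _ _ (P3_lin a h)).
  by apply: eq_tsum => x21 x22; rewrite P3_Pi P3_act -ee !mulrA.
rewrite -(nat_el Q (st 3) x step012) //=.
rewrite (smash_PiE hA) /twisted_act.
move ee: (phi3 _ _ _ _ _ _) => y.
rewrite (tsum_mull (Δ x)) (lin_push _ _ (P3_lin a h)); apply: eq_tsum => x1 x2.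
have lS : lin (fun t => j x1 ∘ t ∘ j (S x2)).
  exact: (lin_comp (smash_mul_linl hA _) (smash_mul_linr hA _)).
rewrite -ee /phi3 !(tsum_mulr Φi) (lin_push _ _ (P3_lin a h)) (lin_push _ _ lS).
apply: eq_tsum => z1 z; rewrite !(tsum_mulr z) (lin_push _ _ (P3_lin a h)) (lin_push _ _ lS).
apply: eq_tsum => z2 z3; rewrite (smash_mul_jl hA) !(tsum_mull (Δ x1)) (lin_push _ _ (P3_lin a h)).
rewrite (lin_push _ _ (smash_mul_linl hA (j (S x2)))); apply: eq_tsum => x11 x12.
rewrite (smash_mul_jr hA) -[X in teval _ X]mulr1 -!mulrA.
rewrite (teval_wprod1 P (l := [:: (0, x11); (1, x12); (2, x2); (0, z1); (1, z2); (2, z3)]%N)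
  (mlin_K3 _ _) erefl) /K3; wsimp.
by rewrite !mulr1 qSM (actM hA) !mulrA.
Qed.

(** The first leg of Φ^-1 acts on 1_A through ε, and the other two legs then reduce to 1. *)
Lemma smash_Pi_one : smash_Pi Q OA (yd_one OA ⊗ β) = j β.
Proof.
rewrite (smash_PiE hA); pose G (x2 x3 : H) := yd_one OA ⊗ (x2 * β * S x3).
have bG : bilin G by rewrite /G; lin_tac.
transitivity (tsum (1 : H ⊗ H) G); last by rewrite (tsumE bG) /G qS1 mulr1 mul1r.
rewrite -(qPhi_inv_eps1 Q) (tsum_tsum _ _ bG); apply: eq_tsum => x1 t.
rewrite (tsum_tsum _ _ bG); apply: eq_tsum => x2 x3.
rewrite (tsumZ bG) (tsumE bG) /G (act_one hA).
by rewrite (linZ (lin_tensl _ (@lin_idf _ _))).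
Qed.

End Algebra.

Theorem theorem4p7 (k : fieldType) (H : algType k) (Q : quasiHopf H)
    (A : lmodType k) (OA : ydAlgOps H A) (hA : is_yd_algebra Q OA) :
  is_yd_algebra_isomorphism
    (braided_tensor Q OA (H0 Q)) (smash_j_algebra Q OA) (smash_Pi Q OA).
Proof.
have P := tensor_powers Q.
have mPi : is_yd_algebra_morphism (braided_tensor Q OA (H0 Q)) (smash_j_algebra Q OA)
    (smash_Pi Q OA).
  split; first exact: (smash_Pi_lin hA).
  split; [exact: smash_Pi_act | exact: (smash_Pi_colinear P hA)
         | exact: smash_Pi_one | exact: (smash_Pi_mul P hA)].
split=> //; exists (smash_Pi_inv Q OA).
split; [|exact: (smash_PiK P hA)|exact: (smash_Pi_invK P hA)].
exact: inverse_yd_algebra_morphism mPi (smash_PiK P hA) (smash_Pi_invK P hA).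
Qed.
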